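(* Let $X$ be a compact complex manifold, let $k\ge 0$ be an integer, and let $(E,h)$ be a Griffiths $k$-positive hermitian holomorphic vector bundle of rank $r$ on $X$. Let $0=s_0<s_1<\cdots<s_m=r$ be integers with $m\ge 2$, let $\pi:\mathscr F_s(E)\to X$ be the associated flag bundle, and let $Q_{s_j}$ be its tautological quotient bundles. Then the line bundle $$\det(Q_{s_1})\otimes\cdots\otimes\det(Q_{s_{m-1}})$$ on $\mathscr F_s(E)$ is $k$-positive.
   Context: Flag bundle: for $s=(s_0,\dots,s_m)$ with $0=s_0<s_1<\cdots<s_m=r$, $\pi:\mathscr F_s(E)\to X$ is the bundle whose fibre over $x$ is the manifold of flags $E_x=V_{s_0}\supset V_{s_1}\supset\cdots\supset V_{s_m}=\{0\}$ of linear subspaces with $\operatorname{codim}V_{s_j}=s_j$. On $\mathscr F_s(E)$ there are tautological subbundles $\pi^*E=\widetilde E_{s_0}\supset\widetilde E_{s_1}\supset\cdots\supset\widetilde E_{s_m}=0$ (the fibre of $\widetilde E_{s_j}$ at a flag is $V_{s_j}$), and $Q_{s_j}=\pi^*E/\widetilde E_{s_j}$, of rank $s_j$. $k$-positive line bundle: a holomorphic line bundle $B$ on a compact complex manifold $Y$ is $k$-positive if it admits a hermitian metric whose Chern curvature form $\frac{i}{2\pi}\Theta(B)$ is positive semidefinite and has at least $\dim Y-k$ positive eigenvalues at every point of $Y$. For a holomorphic vector bundle $E$ with hermitian metric $h$ on a complex manifold $X$, $\Theta_h(E)$ is the curvature of its Chern connection. For each $x\in X$, $i\Theta_h(E)$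 is regarded as a hermitian form on $T_xX\otimes E_x$ ($TX$ is the holomorphic tangent bundle): if $u=\sum u^{j\alpha}\,\partial/\partial z^j\otimes e_\alpha$, then $i\Theta_h(E)(u,u)=\sum R_{\alpha\bar\beta j\bar k}u^{j\alpha}\overline{u^{k\beta}}$, where $R_{\alpha\bar\beta j\bar k}=-\partial_j\bar\partial_k h_{\alpha\bar\beta}+h^{\lambda\bar\mu}\,\partial_j h_{\alpha\bar\mu}\,\bar\partial_k h_{\lambda\bar\beta}$ (so a positive line bundle has positive definite $i\Theta_h$). Definition. $(E,h)$ is Griffiths $k$-positive (also called $(k,1)$-positive) if for every $x\in X$: for every nonzero $v\in E_x$ the hermitian form $\xi\mapsto i\Theta_h(E)(\xi\otimes v,\xi\otimes v)$ on $T_xX$ is positive semidefinite with kernel of dimension at most $k$; and for every nonzero $\xi\in T_xX$ the hermitian form $v\mapsto i\Theta_h(E)(\xi\otimes v,\xi\otimes v)$ on $E_x$ is positive semidefinite with kernel of dimension at most $k$. *)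

(* Defs.v *)
From HB Require Import structures.
From mathcomp Require Import all_boot all_order all_algebra.
From mathcomp Require Import complex.
From mathcomp Require Import all_classical all_reals all_analysis.
Import Order.TTheory GRing.Theory Num.Theory.
Import numFieldNormedType.Exports.

Set Implicit Arguments.
Unset Strict Implicit.
Unset Printing Implicit Defensive.

Local Open Scope classical_set_scope.
Local Open Scope ring_scope.

(* R[i] as a numClosedFieldType, so that the norm and topology instances of
   numFieldNormedType are found on it and on the matrices over it. *)
Definition cplx (R : realType) : numClosedFieldType := R[i].

Section Calculus.
Variables (R : realType) (n : nat).
Local Notation C := (cplx R).
Implicit Types (f : 'rV[C]_n -> C) (v z : 'rV[C]_n) (D : set 'rV[C]_n).

Definition line_re f v z (t : R) : R := complex.Re (f (z + (t%:C)%C *: v)).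
Definition line_im f v z (t : R) : R := complex.Im (f (z + (t%:C)%C *: v)).

(* Derivative of f along the real line t |-> z + t v; no complex
   differentiability is involved. *)
Definition rderivable f v z : Prop :=
  derivable (line_re f v z) 0 1 /\ derivable (line_im f v z) 0 1.

Definition rderive v f : 'rV[C]_n -> C :=
  fun z => Complex (derive1 (line_re f v z) 0) (derive1 (line_im f v z) 0).

(* C^oo on an open set D: all iterated real directional derivatives exist and
   are continuous. *)
Definition smooth_on D f : Prop :=
  forall vs : seq 'rV[C]_n, let g := foldr rderive f vs in
  forall z, D z -> {for z, continuous g} /\ forall v, rderivable g v z.

(* The Wirtinger operators d/dz_j and d/d\bar z_j. *)
Definition dz (j : 'I_n) f : 'rV[C]_n -> C := fun z =>
  2^-1 * (rderive (delta_mx 0 j) f z - 'i * rderive ('i *: delta_mx 0 j) f z).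

Definition dzbar (j : 'I_n) f : 'rV[C]_n -> C := fun z =>
  2^-1 * (rderive (delta_mx 0 j) f z + 'i * rderive ('i *: delta_mx 0 j) f z).

(* Hermitian forms on C^n are given by their matrix A through
   (u, v) |-> sum_(j, k) A j k * u_j * conj v_k. *)
Definition herm_form (A : 'M[C]_n) (u : 'rV[C]_n) : C :=
  \sum_j \sum_k A j k * u 0 j * (u 0 k)^*.

Definition psd (A : 'M[C]_n) : Prop := forall u, 0 <= herm_form A u.

(* dimension of {u | forall v, A(u, v) = 0} = {u | u *m A = 0} *)
Definition ker_dim (A : 'M[C]_n) : nat := \rank (kermx A).

(* Eigenvalues are counted with multiplicity. *)
Definition has_pos_eigenvalues (A : 'M[C]_n) (N : nat) : Prop :=
  exists s : seq C, char_poly A = \prod_(a <- s) ('X - a%:P) /\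
    (N <= count (fun a : C => (0 < a)%R) s)%N.

End Calculus.

(* A set with an atlas: chart i is a coordinate map, meaningful on dom i only. *)
Record atlas (R : realType) (n : nat) := Atlas {
  carrier : Type;
  cindex : Type;
  dom : cindex -> set carrier;
  chart : cindex -> carrier -> 'rV[cplx R]_n }.

(* The points of A, with the topology generated by the charts. *)
Definition points (R : realType) (n : nat) (A : atlas R n) : Type := carrier A.

Section Space.
Variables (R : realType) (n : nat) (A : atlas R n).

HB.instance Definition _ := gen_eqMixin (points A).
HB.instance Definition _ := gen_choiceMixin (points A).

Definition atlas_open (U : set (points A)) : Prop :=
  forall p i, U p -> dom i p ->
  \forall z \near chart i p, forall q, dom i q -> chart i q = z -> U q.

Lemma atlas_openT : atlas_open setT.
Proof. by move=> p i _ _; near=> z. Unshelve. all: by end_near. Qed.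

Lemma atlas_openI (U V : set (points A)) :
  atlas_open U -> atlas_open V -> atlas_open (U `&` V).
Proof.
move=> oU oV p i [Up Vp] ip; have HU := oU p i Up ip; have HV := oV p i Vp ip.
by apply: filterS2 HU HV => z hU hV q iq qz; split; [exact: hU|exact: hV].
Qed.

Lemma atlas_open_bigU (I : Type) (f : I -> set (points A)) :
  (forall i, atlas_open (f i)) -> atlas_open (\bigcup_i f i).
Proof.
move=> of_ p i [k _ fkp] ip; have H := of_ k p i fkp ip.
by apply: filterS H => z h q iq qz; exists k => //; exact: h.
Qed.

HB.instance Definition _ :=
  isOpenTopological.Build (points A) atlas_openT atlas_openI atlas_open_bigU.

End Space.

Section Manifold.
Variables (R : realType) (n : nat) (A : atlas R n).
Local Notation C := (cplx R).
Local Notation X := (points A).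

(* f read in the chart i, i.e. f \o (chart i)^-1 on the image of dom i. *)
Definition in_chart (V : normedModType C) (i : cindex A) (f : X -> V) :
    'rV[C]_n -> V :=
  fun z => xget 0 [set f p | p in [set p | dom i p /\ chart i p = z]].

(* For D open in A. *)
Definition holomorphic_on (V : normedModType C) (D : set X) (f : X -> V) : Prop :=
  forall i p, dom i p -> D p -> differentiable (in_chart i f) (chart i p).

Definition smooth_fun_on (D : set X) (f : X -> C) : Prop :=
  forall i, smooth_on (chart i @` (D `&` dom i)) (in_chart i f).

(* Second countability is automatic, by compactness. *)
Definition compact_complex_manifold : Prop :=
  [/\ forall p, exists i, @dom _ _ A i p,
      forall i, {in dom i &, injective (@chart _ _ A i)},
      forall i j, open (chart i @` (@dom _ _ A i `&` dom j)),
      forall j, holomorphic_on (dom j) (@chart _ _ A j)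
    & hausdorff_space X /\ compact [set: X]].

Record frame_cover := FrameCover { tindex : Type; tdom : tindex -> set X }.

Definition open_frame_cover (U : frame_cover) : Prop :=
  (forall t, open (@tdom U t)) /\ forall p, exists t, @tdom U t p.

(* A vector bundle is a family of vector spaces with a local frame over each
   member of U; frame t p is meaningful for p in tdom t only. *)
Record bundle (U : frame_cover) (r : nat) := Bundle {
  fibre : X -> vectType C;
  frame : tindex U -> forall p, r.-tuple (fibre p) }.

(* frame t' = frame t * transition t t' *)
Definition transition (U : frame_cover) (r : nat) (E : bundle U r)
    (t t' : tindex U) (p : X) : 'M[C]_r :=
  \matrix_(a < r, b < r) coord (frame E t p) a (frame E t' p)`_b.

Definition holomorphic_bundle (U : frame_cover) (r : nat) (E : bundle U r) : Prop :=
  [/\ open_frame_cover U,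
      forall t p, tdom t p -> basis_of fullv (frame E t p)
    & forall t t', holomorphic_on (tdom t `&` tdom t') (transition E t t')].

(* A line bundle over U is given by its transition functions, with the same
   convention as [transition]. *)
Definition line_bundle (U : frame_cover) : Type := tindex U -> tindex U -> X -> C.

Definition holomorphic_line_bundle (U : frame_cover) (L : line_bundle U) : Prop :=
  [/\ open_frame_cover U,
      forall t p, tdom t p -> L t t p = 1,
      forall t t' t'' p, tdom t p -> tdom t' p -> tdom t'' p ->
        L t t' p * L t' t'' p = L t t'' p
    & forall t t', holomorphic_on (tdom t `&` tdom t') (L t t' : X -> C)].

Definition det_bundle (U : frame_cover) (r : nat) (E : bundle U r) : line_bundle U :=
  fun t t' p => \det (transition E t t' p).

Definition line_trivial (U : frame_cover) : line_bundle U := fun _ _ _ => 1.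

Definition line_tensor (U : frame_cover) (L L' : line_bundle U) : line_bundle U :=
  fun t t' p => L t t' p * L' t t' p.

Section Hermitian.
Variables (U : frame_cover) (r : nat) (E : bundle U r).

(* h p is linear in its first argument and conjugate linear in the second. *)
Definition metric : Type := forall p, {dot (fibre E p) for Num.conj}.

Variable h : metric.

Definition gram (t : tindex U) (p : X) : 'M[C]_r :=
  \matrix_(a < r, b < r) h p (frame E t p)`_a (frame E t p)`_b.

Definition smooth_metric : Prop :=
  forall t a b, smooth_fun_on (tdom t) (fun p => gram t p a b).

(* The matrix (R_(a \bar b j \bar k))_(a, b), in the coordinates of the chart i
   and the frame t. With H = (h_(a \bar b)), the h^(l \bar m) of the curvature
   formula is invmx H m l. *)
Definition curvature (i : cindex A) (t : tindex U) (p : X) (j k : 'I_n) : 'M[C]_r :=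
  let H a b := in_chart i (fun q => gram t q a b : C) in
  let dH := \matrix_(a < r, b < r) dz j (H a b) (chart i p) in
  let dbarH := \matrix_(a < r, b < r) dzbar k (H a b) (chart i p) in
  let ddbarH := \matrix_(a < r, b < r) dz j (dzbar k (H a b)) (chart i p) in
  - ddbarH + dH *m invmx (gram t p) *m dbarH.

(* Matrix of xi |-> i Theta (xi (x) v, xi (x) v) on T_p X. *)
Definition curv_tangent i t p (v : 'rV[C]_r) : 'M[C]_n :=
  \matrix_(j < n, k < n)
    \sum_a \sum_b curvature i t p j k a b * v 0 a * (v 0 b)^*.

(* Matrix of v |-> i Theta (xi (x) v, xi (x) v) on E_p. *)
Definition curv_fibre i t p (xi : 'rV[C]_n) : 'M[C]_r :=
  \matrix_(a < r, b < r)
    \sum_j \sum_k curvature i t p j k a b * xi 0 j * (xi 0 k)^*.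

Definition griffiths_k_positive (k : nat) : Prop :=
  forall i t p, dom i p -> tdom t p ->
    (forall v : 'rV[C]_r, v != 0 ->
       psd (curv_tangent i t p v) /\ (ker_dim (curv_tangent i t p v) <= k)%N) /\
    (forall xi : 'rV[C]_n, xi != 0 ->
       psd (curv_fibre i t p xi) /\ (ker_dim (curv_fibre i t p xi) <= k)%N).

End Hermitian.

Section LineMetric.
Variables (U : frame_cover) (L : line_bundle U).

(* h t is the squared norm of the frame over tdom t. *)
Definition line_metric (h : tindex U -> X -> R) : Prop :=
  [/\ forall t p, tdom t p -> 0 < h t p,
      forall t t' p, tdom t p -> tdom t' p ->
        ((h t' p)%:C)%C = `|L t t' p| ^+ 2 * ((h t p)%:C)%C :> C
    & forall t, smooth_fun_on (tdom t) (fun p => ((h t p)%:C)%C)].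

(* (i / 2 pi) Theta = - (i / 2 pi) d dbar log h *)
Definition line_curvature (h : tindex U -> X -> R) i t p : 'M[C]_n :=
  \matrix_(j < n, k < n)
    (- (((2 * pi)^-1 : R)%:C)%C
       * dz j (dzbar k (in_chart i (fun q => ((ln (h t q))%:C)%C : C))) (chart i p)).

Definition k_positive (k : nat) : Prop :=
  [/\ compact_complex_manifold,
      holomorphic_line_bundle L
    & exists2 h, line_metric h &
      forall i t p, dom i p -> tdom t p ->
        psd (line_curvature h i t p) /\
        has_pos_eigenvalues (line_curvature h i t p) (n - k)].

End LineMetric.

End Manifold.

Section FlagBundle.
Variables (R : realType) (n : nat) (A : atlas R n) (U : frame_cover A).
Variables (r : nat) (E : bundle U r) (m : nat) (s : 'I_m.+1 -> nat).
Local Notation C := (cplx R).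

Definition is_flag (p : points A) (V : 'I_m.+1 -> {vspace fibre E p}) : Prop :=
  [/\ V ord0 = fullv, V ord_max = 0%VS,
      forall j j' : 'I_m.+1, (j <= j')%N -> (V j' <= V j)%VS
    & forall j, (\dim (V j) + s j)%N = \dim {: fibre E p}].

Record flag := Flag {
  flag_base : points A;
  flag_sub : 'I_m.+1 -> {vspace fibre E flag_base};
  _ : is_flag flag_sub }.

(* The j with s j <= b < s (j + 1), for b < r. *)
Definition block (b : nat) : 'I_m.+1 := [arg max_(j > ord0 | (s j <= b)%N) s j].

Definition cell_pairs : {set 'I_r * 'I_r} :=
  [set ab : 'I_r * 'I_r | (ab.1 < s (block ab.2))%N].

(* The flag bundle is covered by affine cells, one for each chart i of the
   base, each frame t of E and each constant change of frame g. *)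
Definition cell : Type :=
  (cindex A * tindex U * {g : 'M[C]_r | g \in unitmx})%type.

Definition cell_frame (c : cell) (p : points A) : r.-tuple (fibre E p) :=
  [tuple \sum_(a < r) val c.2 a b *: (frame E c.1.2 p)`_a | b < r].

Definition cell_span (c : cell) (p : points A) (j : 'I_m.+1) : {vspace fibre E p} :=
  (\sum_(a < r | (a < s j)%N) <[(cell_frame c p)`_a]>)%VS.

(* The flags (V_j) with V_j complementary to cell_span c _ j for all j. *)
Definition cell_dom (c : cell) : set flag :=
  [set y | [/\ dom c.1.1 (flag_base y), tdom c.1.2 (flag_base y)
    & forall j, (flag_sub y j :&: cell_span c (flag_base y) j = 0)%VS]].

(* With e := cell_frame c and j := block b, V_j contains a unique vector
   f_b of the form e_b + sum_(a < s j) z_ab e_a, and each V_j is spanned by the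
   f_b with s j <= b. f_b is the projection of e_b to V_j along
   cell_span c _ j. The z_ab and the coordinates of the base point are the
   coordinates of the flag. *)
Definition cell_coord (c : cell) (y : flag) (a b : 'I_r) : C :=
  let e := cell_frame c (flag_base y) in
  let j := block b in
  coord e a (daddv_pi (flag_sub y j) (cell_span c (flag_base y) j) e`_b).

Definition cell_chart (c : cell) (y : flag) : 'rV[C]_(n + #|cell_pairs|) :=
  row_mx (chart c.1.1 (flag_base y))
    (\row_(k < #|cell_pairs|)
       cell_coord c y (enum_val k).1 (enum_val k).2).

Definition flag_bundle : atlas R (n + #|cell_pairs|) :=
  @Atlas R _ flag cell cell_dom cell_chart.

Definition cell_cover : frame_cover flag_bundle := @FrameCover _ _ flag_bundle cell cell_dom.

End FlagBundle.

Section Quotient.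
Variables (K : fieldType) (V : vectType K) (W : {vspace V}).

(* V / W, realised on a complement of W. *)
Definition quotient_space : vectType K := subvs_of (W^C)%VS.

Definition quotient_map (v : V) : quotient_space :=
  vsproj (W^C)%VS (daddv_pi (W^C)%VS W v).

Lemma quotient_map_eq0 v : (quotient_map v == 0) = (v \in W).
Proof.
have WC : (W^C :&: W = 0)%VS by rewrite capvC capv_compl.
have fullE : (W^C + W = fullv)%VS by rewrite addvC addv_complf.
have vD : v \in (W^C + W)%VS by rewrite fullE memvf.
rewrite -[X in X \in W](daddv_pi_add WC vD).
rewrite /quotient_map -(inj_eq val_inj) /= vsprojK ?memv_pi //.
apply/eqP/idP => [->|]; first by rewrite add0r memv_pi.
set u := daddv_pi _ _ v; set w := daddv_pi _ _ v => uwW.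
have uW : u \in W by rewrite -[u](addrK w) rpredB // memv_pi.
have : u \in (W^C :&: W)%VS by rewrite memv_cap uW memv_pi.
by rewrite WC memv0 => /eqP.
Qed.

Lemma quotient_map_linear : linear quotient_map.
Proof. by move=> a u v; rewrite /quotient_map !linearP. Qed.

Lemma quotient_map_surj : forall w : quotient_space, exists v, quotient_map v = w.
Proof.
have WC : (W^C :&: W = 0)%VS by rewrite capvC capv_compl.
move=> w; exists (vsval w); apply: val_inj => /=.
by rewrite vsprojK ?memv_pi // daddv_pi_id // subvsP.
Qed.

End Quotient.

Section TautologicalQuotients.
Variables (R : realType) (n : nat) (A : atlas R n) (U : frame_cover A).
Variables (r : nat) (E : bundle U r) (m : nat) (s : 'I_m.+1 -> nat).

(* Q_(s_j) = pi^* E / E~_(s_j): the fibre at the flag (p, V) is E_p / V_j. Over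
   each cell, the classes of the e_a with a < s j are a holomorphic frame. *)
Definition taut_quotient (j : 'I_m.+1) : bundle (cell_cover E s) (s j) :=
  @Bundle _ _ _ (cell_cover E s) (s j)
    (fun y : flag E s => quotient_space (flag_sub y j))
    (fun (c : cell U r) (y : flag E s) =>
       [tuple quotient_map (flag_sub y j) (cell_frame E c (flag_base y))`_a | a < s j]).

(* det Q_(s_1) (x) ... (x) det Q_(s_(m-1)) *)
Definition det_taut_quotients : line_bundle (cell_cover E s) :=
  \big[@line_tensor _ _ _ _/@line_trivial _ _ _ _]_(j < m.+1 | (0 < j < m)%N)
    det_bundle (taut_quotient j).

End TautologicalQuotients.

Arguments det_taut_quotients {R n A U r} E {m} s _ _ _.

(* Main.v *)
(** The metric of E induces a metric on each quotient Q_(s_j), hence on the line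
    bundle. In a local frame of E with Gram matrix H, let the columns of the
    holomorphic matrix Th_j be the linear forms on E that vanish on V_j and are
    dual to the frame of Q_(s_j). Then det Q_(s_j) has squared norm
    1 / det W_j with W_j = Th_j^* H^-1 Th_j, so the curvature of the line bundle
    is the sum over 0 < j < m of the Levi forms of log det W_j. With K = H^-1,
    and with R(xi, xi) the curvature of E in the horizontal direction xi of a
    tangent vector, the Levi form of log det W is
      tr (W^-1 (K Th)^* R(xi, xi) (K Th)) + tr (W^-1 Z^* (H - Th W^-1 Th^* ) Z),
    where Z is the derivative of K Th along the tangent vector. Both terms are
    nonnegative. At a null vector the first one puts xi in the kernel of
    xi |-> i Theta(xi (x) v, xi (x) v) for a fixed nonzero v, namely the dual of a
    column of K Th_j, and this kernel has dimension at most k. If moreover xi = 0,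
    the second one says that the derivative of Th_j is Th_j times a matrix, so
    that no V_j moves to first order and the tangent vector is zero. *)

Require Import Defs.
From HB Require Import structures.
From mathcomp Require Import all_boot all_order all_algebra.
From mathcomp Require Import fingroup perm complex ring zify.
From mathcomp Require Import all_classical all_reals all_analysis.
Import Order.TTheory GRing.Theory Num.Theory.
Import numFieldNormedType.Exports.

Set Implicit Arguments.
Unset Strict Implicit.
Unset Printing Implicit Defensive.

Local Open Scope classical_set_scope.
Local Open Scope ring_scope.

(** * Real directional derivatives *)

Section RealLines.
Variables (R : realType) (n : nat).
Local Notation C := (cplx R).
Implicit Types (f g : 'rV[C]_n -> C) (v z : 'rV[C]_n).

(** The transition matrices of E are only assumed complex differentiable, whereas log det W_j has to
    be smooth in the sense of iterated real derivatives. No integral formula is used: the metric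
    itself supplies the regularity, because the smooth Gram matrices of two frames are related by G'
    = T G T^*, and this relation determines the derivative of T from T.

    The curvature of the line bundle has to be computed in the chart of one cell with the frame of
    another, so Th_j depends on a transition matrix of E as well as on the affine coordinates.
    Linear forms vanishing on V_j, unlike orthogonal complements of V_j, are holomorphic in these
    coordinates; the metric then enters through H^-1 alone.

    The vector v must not depend on the null vector: then the whole kernel of the Levi form projects
    into one kernel on the base. The projection is injective on it because a vertical null vector is
    zero. An index 0 < j < m, which m >= 2 provides, yields such a v. A positive semidefinite form
    whose kernel has dimension at most k has all but at most k of its eigenvalues positive. *)

Definition is_rderive v z f (d : C) : Prop :=
  is_derive (0 : R) (1 : R) (line_re f v z) (complex.Re d) /\
  is_derive (0 : R) (1 : R) (line_im f v z) (complex.Im d).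

Lemma is_rderiveP v z f d :
  is_rderive v z f d <-> rderivable f v z /\ rderive v f z = d.
Proof.
split=> [[[dre ere] [dim eim]]|[[dre dim] <-]].
  split; first exact: conj dre dim.
  rewrite /rderive !derive1E ere eim; by case: d {dre ere dim eim}.
split.
  by apply: (DeriveDef dre); rewrite -derive1E.
by apply: (DeriveDef dim); rewrite -derive1E.
Qed.

Lemma is_rderive_rderive v z f : rderivable f v z ->
  is_rderive v z f (rderive v f z).
Proof. by move=> fv; apply/is_rderiveP. Qed.

Lemma is_rderive_rderivable v z f d : is_rderive v z f d -> rderivable f v z.
Proof. by case/is_rderiveP. Qed.

Lemma rderive_val v z f d : is_rderive v z f d -> rderive v f z = d.
Proof. by case/is_rderiveP. Qed.

Lemma line_re0 f v z : line_re f v z 0 = complex.Re (f z).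
Proof. by rewrite /line_re (_ : (0%:C)%C = 0) // scale0r addr0. Qed.

Lemma line_im0 f v z : line_im f v z 0 = complex.Im (f z).
Proof. by rewrite /line_im (_ : (0%:C)%C = 0) // scale0r addr0. Qed.

Lemma is_rderive_cst v z (a : C) : is_rderive v z (fun=> a) 0.
Proof. by split; apply: is_derive_cst. Qed.

Lemma is_rderiveD v z f g df dg : is_rderive v z f df -> is_rderive v z g dg ->
  is_rderive v z (fun x => f x + g x) (df + dg).
Proof.
move=> [f1 f2] [g1 g2]; split.
  rewrite (_ : line_re _ v z = line_re f v z + line_re g v z); last first.
    by apply/funext => t; rewrite /line_re /= !fctE; case: (f _); case: (g _).
  by apply: is_derive_eq; case: df f1 f2; case: dg g1 g2.
rewrite (_ : line_im _ v z = line_im f v z + line_im g v z); last first.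
  by apply/funext => t; rewrite /line_im /= !fctE; case: (f _); case: (g _).
by apply: is_derive_eq; case: df f1 f2; case: dg g1 g2.
Qed.

Lemma is_rderiveM v z f g df dg : is_rderive v z f df -> is_rderive v z g dg ->
  is_rderive v z (fun x => f x * g x) (df * g z + f z * dg).
Proof.
move=> [f1 f2] [g1 g2]; split.
  rewrite (_ : line_re _ v z =
    line_re f v z * line_re g v z - line_im f v z * line_im g v z); last first.
    by apply/funext => t; rewrite /line_re /line_im /= !fctE;
       case: (f _) => ? ?; case: (g _).
  apply: is_derive_eq; rewrite !line_re0 !line_im0.
  case: df f1 f2; case: dg g1 g2; case: (f z); case: (g z) => /= a b c d a' b' _ _ c' d' _ _.
  by rewrite /GRing.scale /=; ring.
rewrite (_ : line_im _ v z =
  line_re f v z * line_im g v z + line_im f v z * line_re g v z); last first.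
  by apply/funext => t; rewrite /line_re /line_im /= !fctE;
     case: (f _) => ? ?; case: (g _).
apply: is_derive_eq; rewrite !line_re0 !line_im0.
case: df f1 f2; case: dg g1 g2; case: (f z); case: (g z) => /= a b c d a' b' _ _ c' d' _ _.
by rewrite /GRing.scale /=; ring.
Qed.

Lemma is_rderive_conj v z f df : is_rderive v z f df ->
  is_rderive v z (fun x => (f x)^*) (df^*).
Proof.
move=> [f1 f2]; split.
  rewrite (_ : line_re _ v z = line_re f v z).
    by case: df f1 f2.
  by apply/funext => t; rewrite /line_re; case: (f _).
rewrite (_ : line_im _ v z = - line_im f v z).
  by apply: is_derive_eq; case: df f1 f2.
by apply/funext => t; rewrite /line_im !fctE; case: (f _).
Qed.

Lemma is_rderiveV v z f df : f z != 0 -> is_rderive v z f df ->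
  is_rderive v z (fun x => (f x)^-1) (- ((f z)^-1 * df * (f z)^-1)).
Proof.
move=> fz0 [f1 f2].
set A := line_re f v z; set B := line_im f v z.
have AB0 : A 0 * A 0 + B 0 * B 0 != 0.
  rewrite /A /B line_re0 line_im0; case: (f z) fz0 => a b /= ab0.
  apply: contra ab0; rewrite paddr_eq0 -?expr2 ?sqr_ge0 // !sqrf_eq0.
  by case/andP => /eqP -> /eqP ->.
(* Along the line, with [f = A + i B], one has 1/f = (A - i B) / (A^2 + B^2); so the derivative of
   1/(A^2 + B^2) is what is missing. *)
have NE : is_derive (0 : R) (1 : R) (fun t : R => ((A * A + B * B) t)^-1 : R)
    (- ((A * A + B * B) 0) ^- 2 *: (A 0 * complex.Re df + complex.Re df * A 0 +
     (B 0 * complex.Im df + complex.Im df * B 0))).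
  have H : is_derive (0 : R) (1 : R) (A * A + B * B) (A 0 * complex.Re df + complex.Re df * A 0 +
     (B 0 * complex.Im df + complex.Im df * B 0)).
    by apply: is_derive_eq; rewrite /GRing.scale /=; ring.
  apply: DeriveDef; first by apply: derivableV => //; case: H.
  by rewrite deriveV //; case: H => // _ ->.
split.
  rewrite (_ : line_re _ v z = A * (fun t : R => ((A * A + B * B) t)^-1)); last first.
    by apply/funext => t; rewrite /line_re /A /B /line_re /line_im !fctE; case: (f _) => a b /=; rewrite !expr2.
  apply: is_derive_eq; move: AB0; rewrite !fctE /GRing.scale /= /A /B !line_re0 !line_im0.
  case: df f1 f2 NE; case: (f z) => /= a b c d _ _ _ ab0.
  by field; rewrite /= !expr2 ?andbb.
rewrite (_ : line_im _ v z = - (B * (fun t : R => ((A * A + B * B) t)^-1))); last first.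
  by apply/funext => t; rewrite /line_im /A /B /line_re /line_im !fctE; case: (f _) => a b /=; rewrite !expr2.
apply: is_derive_eq; move: AB0; rewrite !fctE /GRing.scale /= /A /B !line_re0 !line_im0.
case: df f1 f2 NE; case: (f z) => /= a b c d _ _ _ ab0.
by field; rewrite /= !expr2 ?andbb.
Qed.

Lemma is_rderive_ln v z f df : 0 < complex.Re (f z) -> is_rderive v z f df ->
  is_rderive v z (fun x => ((ln (complex.Re (f x)))%:C)%C)
    (((complex.Re (f z))^-1 * complex.Re df)%:C)%C.
Proof.
move=> fz0 [f1 f2]; split; last exact: is_derive_cst.
rewrite (_ : line_re _ v z = @ln R \o line_re f v z) //.
apply: is_derive1_comp f1; rewrite line_re0; exact: is_derive1_ln.
Qed.

Lemma is_rderive_coord v z (k : 'I_n) : is_rderive v z (fun x => x 0 k) (v 0 k).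
Proof.
split.
  rewrite (_ : line_re _ v z =
     (cst (complex.Re (z 0 k)) + (complex.Re (v 0 k)) *: (id : R -> R))); last first.
    apply/funext => t; rewrite /line_re !fctE !mxE.
    by case: (z 0 k) => a b; case: (v 0 k) => c d /=; rewrite mul0r subr0 mulrC.
  apply: is_derive_eq (is_deriveD (is_derive_cst _ _ _) (is_deriveZ _ (is_derive_id _ _))) _.
  by rewrite add0r; exact: mulr1.
rewrite (_ : line_im _ v z =
   (cst (complex.Im (z 0 k)) + (complex.Im (v 0 k)) *: (id : R -> R))); last first.
  apply/funext => t; rewrite /line_im !fctE !mxE.
  by case: (z 0 k) => a b; case: (v 0 k) => c d /=; rewrite mul0r addr0 mulrC.
apply: is_derive_eq (is_deriveD (is_derive_cst _ _ _) (is_deriveZ _ (is_derive_id _ _))) _.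
by rewrite add0r; exact: mulr1.
Qed.

End RealLines.

(** * Continuity of real and imaginary parts, and real lines in complex space *)

Section Embedding.
Variable R : realType.
Local Notation C := (cplx R).

Lemma normc_real (t : R) : `|(t%:C)%C : C| = (`|t|%:C)%C.
Proof. by rewrite normc_def /= expr0n addr0 sqrtr_sqr. Qed.

Lemma gt0_cplxE (e : C) : 0 < e -> 0 < complex.Re e /\ e = ((complex.Re e)%:C)%C.
Proof. by case: e => a b; rewrite ltcE /= => /andP[/eqP -> ->]. Qed.

Lemma real_complex_continuous : continuous (fun t : R => (t%:C)%C : C).
Proof.
move=> t; apply/cvgrPdist_lt => e /gt0_cplxE [e0 ->].
near=> s; rewrite -rmorphB normc_real ltcR.
by near: s; apply: cvgr_dist_lt.
Unshelve. all: by end_near. Qed.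

Lemma Re_continuous : continuous (@complex.Re R : C -> R).
Proof.
move=> z; apply/(@cvgrPdist_lt _ _ _ _ (nbhs_filter (z : C))) => e e0; near=> w.
rewrite -raddfB -ltcR; apply: le_lt_trans (normc_ge_Re _) _.
near: w; apply: (@cvgr_dist_lt _ _ _ (nbhs z) _ id z); first exact: cvg_id.
by rewrite ltcR.
Unshelve. all: by end_near. Qed.

Lemma normc_ge_Im (z : C) : (`|complex.Im z|%:C)%C <= `|z|.
Proof.
have := normc_ge_Re ('i%C * z : R[i]); rewrite normrM normc_def /= expr0n add0r expr1n sqrtr1.
by case: z => a b; rewrite /= mul0r mul1r sub0r normrN mul1r.
Qed.

Lemma Im_continuous : continuous (@complex.Im R : C -> R).
Proof.
move=> z; apply/(@cvgrPdist_lt _ _ _ _ (nbhs_filter (z : C))) => e e0; near=> w.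
rewrite -raddfB -ltcR; apply: le_lt_trans (normc_ge_Im _) _.
near: w; apply: (@cvgr_dist_lt _ _ _ (nbhs z) _ id z); first exact: cvg_id.
by rewrite ltcR.
Unshelve. all: by end_near. Qed.

Lemma conjc_continuous : continuous (Num.conj : C -> C).
Proof.
move=> z; apply/(@cvgrPdist_lt _ _ _ _ (nbhs_filter (z : C))) => e e0; near=> w.
rewrite -rmorphB norm_conjC.
near: w; apply: (@cvgr_dist_lt _ _ _ (nbhs z) _ id z) => //; exact: cvg_id.
Unshelve. all: by end_near. Qed.

Lemma cvg_mx_entry m n (T : Type) (F : set_system T) (FF : Filter F)
    (f : T -> 'M[C]_(m, n)) (M : 'M[C]_(m, n)) :
  (forall i j, f x i j @[x --> F] --> M i j) -> f x @[x --> F] --> M.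
Proof.
move=> h A [P hP PA]; apply: (@filterS _ F FF _ _ (fun x => PA (f x))).
apply: filter_forall => i; apply: filter_forall => j.
by apply: h; exact: hP.
Qed.

Lemma line_continuous n (z v : 'rV[C]_n) :
  continuous (fun t : R => z + (t%:C)%C *: v).
Proof.
move=> t; apply: cvgD; first exact: cvg_cst.
by apply: cvgZr_tmp; exact: real_complex_continuous.
Qed.

Lemma line_near n (D : set 'rV[C]_n) z v (t : R) : open D -> D (z + (t%:C)%C *: v) ->
  \forall s \near t, D (z + (s%:C)%C *: v).
Proof.
move=> oD Dt; apply: (@line_continuous n z v t).
exact: open_nbhs_nbhs.
Qed.

Lemma is_rderive_eq_on n (D : set 'rV[C]_n) (f g : 'rV[C]_n -> C) v z d : open D ->
  {in D, f =1 g} -> D z -> is_rderive v z f d -> is_rderive v z g d.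
Proof.
move=> oD fg Dz [f1 f2].
have Dn : \forall s \near (0 : R), D (z + (s%:C)%C *: v).
  by apply: line_near => //; rewrite (_ : (0%:C)%C = 0) // scale0r addr0.
split; [apply: near_eq_is_derive f1|apply: near_eq_is_derive f2];
  by apply: filterS Dn => s Ds; rewrite /line_re /line_im fg // inE.
Qed.

End Embedding.

(** One interface for smooth, C^k, real derivable, continuous, complex differentiable and
    holomorphic functions, and for functions whose values converge along a filter. Determinants and
    inverse matrices are treated once for all of them. Functions count up to equality on [D], since
    inverses and chart expressions are meaningful there only. *)
Record fun_class (T : Type) (K : fieldType) (D : set T)
    (P : (T -> K) -> Prop) : Prop := FunClass {
  fc_cst : forall a, P (fun=> a);
  fcD : forall f g, P f -> P g -> P (fun x => f x + g x);
  fcM : forall f g, P f -> P g -> P (fun x => f x * g x);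
  fcV : forall f, P f -> (forall x, D x -> f x != 0) -> P (fun x => (f x)^-1);
  fc_ext : forall f g, P f -> (forall x, D x -> f x = g x) -> P g }.

Section FunClassTheory.
Variables (T : Type) (K : fieldType) (D : set T) (P : (T -> K) -> Prop).
Hypothesis PC : fun_class D P.

Definition mx_class p q (A : T -> 'M[K]_(p, q)) : Prop :=
  forall a b, P (fun x => A x a b).

Lemma fc_sum (I : Type) (s : seq I) (Q : pred I) (f : I -> T -> K) :
  (forall i, P (f i)) -> P (fun x => \sum_(i <- s | Q i) f i x).
Proof.
move=> Pf; elim: s => [|i s IH].
  by apply: (fc_ext PC (fc_cst PC 0)) => x _; rewrite big_nil.
case Qi: (Q i).
  by apply: (fc_ext PC (fcD PC (Pf i) IH)) => x _; rewrite big_cons Qi.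
by apply: (fc_ext PC IH) => x _; rewrite big_cons Qi.
Qed.

Lemma fc_prod (I : Type) (s : seq I) (Q : pred I) (f : I -> T -> K) :
  (forall i, P (f i)) -> P (fun x => \prod_(i <- s | Q i) f i x).
Proof.
move=> Pf; elim: s => [|i s IH].
  by apply: (fc_ext PC (fc_cst PC 1)) => x _; rewrite big_nil.
case Qi: (Q i).
  by apply: (fc_ext PC (fcM PC (Pf i) IH)) => x _; rewrite big_cons Qi.
by apply: (fc_ext PC IH) => x _; rewrite big_cons Qi.
Qed.

Lemma mx_class_cst p q (A : 'M[K]_(p, q)) : mx_class (fun=> A).
Proof. by move=> a b; exact: fc_cst PC _. Qed.

Lemma mx_class_ext p q (A B : T -> 'M[K]_(p, q)) :
  mx_class A -> (forall x, D x -> A x = B x) -> mx_class B.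
Proof. by move=> PA AB a b; apply: (fc_ext PC (PA a b)) => x Dx; rewrite AB. Qed.

Lemma mx_classD p q (A B : T -> 'M[K]_(p, q)) :
  mx_class A -> mx_class B -> mx_class (fun x => A x + B x).
Proof.
move=> PA PB a b; apply: (fc_ext PC (fcD PC (PA a b) (PB a b))) => x _.
by rewrite mxE.
Qed.

Lemma mx_classM p q r (A : T -> 'M[K]_(p, q)) (B : T -> 'M[K]_(q, r)) :
  mx_class A -> mx_class B -> mx_class (fun x => A x *m B x).
Proof.
move=> PA PB a b; apply: (fc_ext PC (fc_sum (index_enum 'I_q) predT (f := fun c x => A x a c * B x c b) _)).
  by move=> c; apply: (fcM PC).
by move=> x _; rewrite mxE.
Qed.

Lemma fc_det p (A : T -> 'M[K]_p) : mx_class A -> P (fun x => \det (A x)).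
Proof.
move=> PA; apply: fc_sum => s; apply: (fcM PC); first exact: fc_cst PC _.
exact: fc_prod.
Qed.

(** Cramer's rule: the entries of the inverse are cofactors divided by the determinant. *)
Lemma mx_class_inv p (A : T -> 'M[K]_p) : mx_class A ->
  (forall x, D x -> A x \in unitmx) -> mx_class (fun x => invmx (A x)).
Proof.
move=> PA uA a b.
have PV : P (fun x => (\det (A x))^-1).
  by apply: (fcV PC (fc_det PA)) => x Dx; rewrite -unitfE -unitmxE uA.
have Padj : P (fun x => cofactor (A x) b a).
  apply: (fcM PC); first exact: fc_cst PC _.
  apply: fc_det => i j; apply: (fc_ext PC (PA (lift b i) (lift a j))) => x _.
  by rewrite !mxE.
apply: (fc_ext PC (fcM PC PV Padj)) => x Dx.
by rewrite /invmx uA // !mxE.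
Qed.

End FunClassTheory.

Lemma eq_differentiable (K : numFieldType) (V W : normedModType K) (f g : V -> W) z :
  (\forall x \near z, f x = g x) -> differentiable f z -> differentiable g z.
Proof.
move=> fg /diffP [cdf ef]; have fgz : f z = g z := nbhs_singleton fg.
apply/diffP.
(* The differential of [g] is chosen among the linear maps satisfying [Q], so it satisfies [Q] as
   soon as some map does; the differential of [f] is such a map. *)
pose Q (df : {linear V -> W}) := continuous df /\ forall x,
  g x = g (lim (nbhs z)) + df (x - lim (nbhs z)) +o_(x \near z) (x - lim (nbhs z)).
suff : Q ('d g z) by [].
apply: getPex; exists ('d f z); split; first exact: cdf.
suff H : g = (fun x => g (lim (nbhs z)) + 'd f z (x - lim (nbhs z)))
    +o_ (nbhs z) (fun x => x - lim (nbhs z)).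
  by move=> x; exact: (congr1 (@^~ x) H).
have {}ef : f = (fun x => f (lim (nbhs z)) + 'd f z (x - lim (nbhs z)))
    +o_ (nbhs z) (fun x => x - lim (nbhs z)) by apply/funext.
apply/eqaddoP => eps eps0; have /eqaddoP/(_ _ eps0) := ef.
rewrite !lim_id //; apply: filter_app; apply: filterS fg => x fgx /=.
by rewrite !fctE /= fgx fgz.
Qed.

(** * Functions of class C^k and smooth functions *)

Section Ck.
Variables (R : realType) (n : nat).
Local Notation C := (cplx R).
Implicit Types (f g : 'rV[C]_n -> C) (v z : 'rV[C]_n) (D : set 'rV[C]_n).

(** Smoothness quantifies over lists of directions, which gives no order of differentiability to
    induct on. The product and inverse rules need one, because the derivative of a product or an
    inverse contains the original functions again. *)
Fixpoint Ck (k : nat) D f : Prop :=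
  (forall z, D z -> {for z, continuous f}) /\
  if k is k'.+1 then
    forall v, (forall z, D z -> rderivable f v z) /\ Ck k' D (rderive v f)
  else True.

Lemma Ck_continuous k D f z : Ck k D f -> D z -> {for z, continuous f}.
Proof. by case: k => [|k] [h _]; exact: h. Qed.

Lemma smooth_onP D f : smooth_on D f <-> forall k, Ck k D f.
Proof.
split=> [sf k|Cf vs].
  elim: k f sf => [|k IH] f sf /=.
    by split; [move=> z /(sf [::]) []|exact: I].
  split; first by move=> z /(sf [::]) [].
  move=> v; split; first by move=> z /(sf [::]) [].
  (* The last direction of the list is the first one applied by [foldr], hence [rcons]. *)
  by apply: IH => vs; have := sf (rcons vs v); rewrite foldr_rcons.
elim/last_ind: vs f Cf => [|vs v IH] f Cf /=.
  move=> z Dz; split; first exact: Ck_continuous (Cf 0%N) Dz.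
  by move=> v; case: (Cf 1%N) => _ /(_ v) [h _]; exact: h.
rewrite foldr_rcons; apply: IH => k.
by case: (Cf k.+1) => _ /(_ v) [].
Qed.

Lemma CkSP k D f : Ck k.+1 D f -> forall v,
  (forall z, D z -> is_rderive v z f (rderive v f z)) /\ Ck k D (rderive v f).
Proof.
case=> _ h v; case: (h v) => h1 h2; split; last exact: h2.
by move=> z Dz; exact: (is_rderive_rderive (h1 z Dz)).
Qed.

Lemma eq_continuous_on D f g : open D -> (forall z, D z -> f z = g z) ->
  (forall z, D z -> {for z, continuous f}) ->
  forall z, D z -> {for z, continuous g}.
Proof.
move=> oD fg cf z Dz; rewrite /prop_for /continuous_at -fg //.
apply: cvg_trans (cf z Dz); apply: (@near_eq_cvg _ _ (nbhs z)).
by have N := open_nbhs_nbhs (conj oD Dz); apply: filterS N => x; exact: fg.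
Qed.

Lemma Ck_eq k D f g : open D -> (forall z, D z -> f z = g z) ->
  Ck k D f -> Ck k D g.
Proof.
move=> oD; elim: k f g => [|k IH] f g fg /=.
  by move=> [cf _]; split; [exact: (eq_continuous_on oD fg cf)|exact: I].
move=> Cf; have cf := Ck_continuous (k := k.+1) Cf.
split; first exact: (eq_continuous_on oD fg cf).
move=> v; have [dv Cv] := CkSP Cf v.
have dg z : D z -> is_rderive v z g (rderive v f z).
  by move=> Dz; apply: (is_rderive_eq_on oD _ Dz (dv z Dz)) => x; rewrite inE => /fg.
split; first by move=> z Dz; exact: is_rderive_rderivable (dg z Dz).
by apply: IH Cv => z Dz; rewrite (rderive_val (dg z Dz)).
Qed.

Lemma CkS_intro k D f : open D -> (forall z, D z -> {for z, continuous f}) ->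
  (forall v, exists g, (forall z, D z -> is_rderive v z f (g z)) /\ Ck k D g) ->
  Ck k.+1 D f.
Proof.
move=> oD cf h; split; first exact: cf.
move=> v; have [g [dg Cg]] := h v.
split; first by move=> z Dz; exact: is_rderive_rderivable (dg z Dz).
by apply: (Ck_eq oD _ Cg) => z Dz; rewrite (rderive_val (dg z Dz)).
Qed.

Lemma CkW k D f : Ck k.+1 D f -> Ck k D f.
Proof.
elim: k f => [|k IH] f; first by case.
move=> [cf h]; split; first exact: cf.
move=> v; have [h1 h2] := h v.
by split; [exact: h1|exact: IH].
Qed.

Lemma Ck_cst k D (a : C) : open D -> Ck k D (fun=> a).
Proof.
move=> oD; elim: k a => [|k IH] a; first by split; [move=> z _; exact: cst_continuous|exact: I].
apply: (CkS_intro oD); first by move=> z _; exact: cst_continuous.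
by move=> v; exists (fun=> 0); split; [move=> z _; exact: is_rderive_cst|exact: (IH 0)].
Qed.

Lemma CkD k D f g : open D -> Ck k D f -> Ck k D g -> Ck k D (fun x => f x + g x).
Proof.
move=> oD; elim: k f g => [|k IH] f g Cf Cg.
  by split; [move=> z Dz; exact: (continuousD (Ck_continuous Cf Dz) (Ck_continuous Cg Dz))|exact: I].
apply: (CkS_intro oD).
  by move=> z Dz; exact: (continuousD (Ck_continuous Cf Dz) (Ck_continuous Cg Dz)).
move=> v; have [df Cdf] := CkSP Cf v; have [dg Cdg] := CkSP Cg v.
exists (fun x => rderive v f x + rderive v g x); split; last exact: IH.
by move=> z Dz; apply: is_rderiveD; [exact: df|exact: dg].
Qed.

Lemma CkM k D f g : open D -> Ck k D f -> Ck k D g -> Ck k D (fun x => f x * g x).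
Proof.
move=> oD; elim: k f g => [|k IH] f g Cf Cg.
  by split; [move=> z Dz; exact: (continuousM (Ck_continuous Cf Dz) (Ck_continuous Cg Dz))|exact: I].
apply: (CkS_intro oD).
  by move=> z Dz; exact: (continuousM (Ck_continuous Cf Dz) (Ck_continuous Cg Dz)).
move=> v; have [df Cdf] := CkSP Cf v; have [dg Cdg] := CkSP Cg v.
exists (fun x => rderive v f x * g x + f x * rderive v g x); split.
  by move=> z Dz; apply: is_rderiveM; [exact: df|exact: dg].
apply: (CkD oD); apply: IH; by [exact: Cdf|exact: Cdg|exact: CkW].
Qed.

(** The derivative of 1/f contains 1/f itself, which is of class C^k by induction when the order k+1
    is treated. *)
Lemma CkV k D f : open D -> (forall z, D z -> f z != 0) -> Ck k D f ->
  Ck k D (fun x => (f x)^-1).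
Proof.
move=> oD f0; elim: k => [|k IH] Cf.
  by split; [move=> z Dz; exact: (continuousV (f0 z Dz) (Ck_continuous Cf Dz))|exact: I].
apply: (CkS_intro oD).
  by move=> z Dz; exact: (continuousV (f0 z Dz) (Ck_continuous Cf Dz)).
move=> v; have [df Cdf] := CkSP Cf v.
exists (fun x => - 1 * ((f x)^-1 * rderive v f x * (f x)^-1)); split.
  move=> z Dz; rewrite mulN1r; apply: is_rderiveV; [exact: f0|exact: df].
apply: (CkM oD); first exact: Ck_cst.
have Cfv := IH (CkW Cf).
exact: (CkM oD (CkM oD Cfv Cdf) Cfv).
Qed.

Lemma Ck_conj k D f : open D -> Ck k D f -> Ck k D (fun x => (f x)^*).
Proof.
move=> oD; have cc (g : 'rV[C]_n -> C) z : {for z, continuous g} -> {for z, continuous (fun x => (g x)^*)}.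
  by move=> cg; exact: (continuous_comp cg (@conjc_continuous R (g z))).
elim: k f => [|k IH] f Cf.
  by split; [move=> z Dz; apply: cc; exact: Ck_continuous Cf Dz|exact: I].
apply: (CkS_intro oD).
  by move=> z Dz; apply: cc; exact: Ck_continuous Cf Dz.
move=> v; have [df Cdf] := CkSP Cf v.
exists (fun x => (rderive v f x)^*); split; last exact: IH.
by move=> z Dz; apply: is_rderive_conj; exact: df.
Qed.

Lemma Ck_coord k D j : open D -> Ck k D (fun x => x 0 j).
Proof.
move=> oD; case: k => [|k].
  by split; [move=> z _; exact: coord_continuous|exact: I].
apply: (CkS_intro oD); first by move=> z _; exact: coord_continuous.
move=> v; exists (fun=> v 0 j); split; last exact: Ck_cst.
by move=> z _; exact: is_rderive_coord.
Qed.

Lemma smooth_eq D f g : open D -> (forall z, D z -> f z = g z) ->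
  smooth_on D f -> smooth_on D g.
Proof.
by move=> oD fg /smooth_onP sf; apply/smooth_onP => k; exact: Ck_eq (sf k).
Qed.

Lemma Ck_class k D : open D -> fun_class D (Ck k D).
Proof.
move=> oD; split.
- by move=> a; exact: Ck_cst.
- by move=> f g; exact: CkD.
- by move=> f g; exact: CkM.
- by move=> f Cf f0; exact: CkV.
- by move=> f g Cf fg; exact: Ck_eq Cf.
Qed.

Lemma smooth_class D : open D -> fun_class D (smooth_on D).
Proof.
move=> oD; split.
- by move=> a; apply/smooth_onP => k; exact: Ck_cst.
- by move=> f g /smooth_onP sf /smooth_onP sg; apply/smooth_onP => k; exact: CkD.
- by move=> f g /smooth_onP sf /smooth_onP sg; apply/smooth_onP => k; exact: CkM.
- by move=> f /smooth_onP sf f0; apply/smooth_onP => k; exact: CkV.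
- by move=> f g sf fg; exact: smooth_eq sf.
Qed.

Lemma smooth_conj D f : open D -> smooth_on D f -> smooth_on D (fun x => (f x)^*).
Proof. by move=> oD /smooth_onP sf; apply/smooth_onP => k; exact: Ck_conj. Qed.

Lemma smooth_coord D j : open D -> smooth_on D (fun x => x 0 j).
Proof. by move=> oD; apply/smooth_onP => k; exact: Ck_coord. Qed.

Lemma smooth_rderive D f v : smooth_on D f -> smooth_on D (rderive v f).
Proof. by move=> sf vs; have := sf (rcons vs v); rewrite foldr_rcons. Qed.

Lemma smooth_is_rderive D f v z : smooth_on D f -> D z ->
  is_rderive v z f (rderive v f z).
Proof. by move=> sf Dz; case: (sf [::] z Dz) => _ /(_ v); exact: is_rderive_rderive. Qed.

Lemma smooth_continuous D f z : smooth_on D f -> D z -> {for z, continuous f}.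
Proof. by move=> sf Dz; case: (sf [::] z Dz). Qed.

Lemma smooth_subset D D' f : D' `<=` D -> smooth_on D f -> smooth_on D' f.
Proof. by move=> DD sf vs g z /DD Dz; exact: sf. Qed.

Lemma differentiable_class D : open D ->
  fun_class D (fun f => forall z, D z -> differentiable f z).
Proof.
move=> oD; split.
- by move=> a z _; exact: differentiable_cst.
- by move=> f g df dg z Dz; apply: differentiableD; [exact: df|exact: dg].
- by move=> f g df dg z Dz; apply: differentiableM; [exact: df|exact: dg].
- by move=> f df f0 z Dz; apply: differentiableV; [exact: df|exact: f0].
- move=> f g df fg z Dz.
  apply: eq_differentiable (df z Dz).
  by have N := open_nbhs_nbhs (conj oD Dz); apply: filterS N => x; exact: fg.
Qed.

End Ck.

Lemma continuous_class (R : realType) (T : topologicalType) (D : set T) : open D ->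
  fun_class D (fun f : T -> cplx R => forall z, D z -> {for z, continuous f}).
Proof.
move=> oD; split.
- by move=> a z _; exact: cst_continuous.
- by move=> f g df dg z Dz; exact: (continuousD (df z Dz) (dg z Dz)).
- by move=> f g df dg z Dz; exact: (continuousM (df z Dz) (dg z Dz)).
- by move=> f df f0 z Dz; exact: (continuousV (f0 z Dz) (df z Dz)).
- move=> f g df fg z Dz; rewrite /prop_for /continuous_at -fg //.
  apply: cvg_trans (df z Dz); apply: (@near_eq_cvg _ _ (nbhs z)).
  by have N := open_nbhs_nbhs (conj oD Dz); apply: filterS N => x; exact: fg.
Qed.

(** * Symmetry of second derivatives and holomorphic functions *)

Section Schwarz.
Variables (R : realType) (n : nat).
Local Notation C := (cplx R).
Implicit Types (f g : 'rV[C]_n -> C) (u v z : 'rV[C]_n) (D : set 'rV[C]_n).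

Lemma is_rderive_line f u z t d : is_rderive u (z + (t%:C)%C *: u) f d ->
  is_derive (t : R) (1 : R) (line_re f u z) (complex.Re d).
Proof.
case=> f1 _.
rewrite (_ : line_re f u z = line_re f u (z + (t%:C)%C *: u) \o (id - cst t)); last first.
  apply/funext => s; rewrite /line_re /= !fctE; congr (complex.Re (f _)).
  by rewrite -addrA -scalerDl -rmorphD /= [t + _]addrC subrK.
rewrite -[complex.Re d]mulr1; apply: is_derive1_comp.
  by rewrite !fctE subrr.
by apply: is_derive_eq; rewrite subr0.
Qed.

(** The mean value theorem, applied twice: to the difference of [f] in direction [v] as a function
    of the parameter along [u], then to the derivative in direction [u] as a function of the
    parameter along [v]. It is a theorem about real functions, hence the restriction to real
    parts. *)
Lemma double_difference D f u v z (s : R) : smooth_on D f -> 0 < s ->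
  (forall a b : R, 0 <= a <= s -> 0 <= b <= s ->
     D (z + (a%:C)%C *: u + (b%:C)%C *: v)) ->
  exists a b : R, [/\ 0 <= a <= s, 0 <= b <= s &
    complex.Re (f (z + (s%:C)%C *: u + (s%:C)%C *: v))
    - complex.Re (f (z + (s%:C)%C *: u))
    - complex.Re (f (z + (s%:C)%C *: v)) + complex.Re (f z) =
    s * s * complex.Re (rderive v (rderive u f) (z + (a%:C)%C *: u + (b%:C)%C *: v))].
Proof.
move=> sf s0 Ds.
have ss : 0 <= s <= s by rewrite lexx ltW.
have s00 : (0 : R) <= 0 <= s by rewrite lexx ltW.
pose ps := line_re f u (z + (s%:C)%C *: v) - line_re f u z.
pose dps a := complex.Re (rderive u f (z + (s%:C)%C *: v + (a%:C)%C *: u))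
  - complex.Re (rderive u f (z + (a%:C)%C *: u)).
have dpsP a : 0 <= a <= s -> is_derive (a : R) (1 : R) ps (dps a).
  move=> as_; apply: is_deriveB.
    apply: is_rderive_line; apply: (smooth_is_rderive u sf).
    by rewrite addrAC; exact: Ds.
  apply: is_rderive_line; apply: (smooth_is_rderive u sf).
  by have := Ds a 0 as_ s00; rewrite (_ : (0%:C)%C = 0) // scale0r addr0.
have drps x : x \in `]0, s[ -> is_derive (x : R) (1 : R) ps (dps x).
  by rewrite in_itv /= => /andP[x0 xs]; apply: dpsP; rewrite !ltW.
have cps : {within `[0, s], continuous ps}.
  by apply: derivable_within_continuous => x; rewrite in_itv /= => /dpsP [].
have [a] := MVT s0 drps cps.
rewrite in_itv /= => /andP[a0 as_]; rewrite subr0 => Ea.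
have aI : 0 <= a <= s by rewrite !ltW.
pose ph := line_re (rderive u f) v (z + (a%:C)%C *: u).
pose dph b := complex.Re (rderive v (rderive u f) (z + (a%:C)%C *: u + (b%:C)%C *: v)).
have dphP b : 0 <= b <= s -> is_derive (b : R) (1 : R) ph (dph b).
  move=> bs; apply: is_rderive_line.
  apply: (smooth_is_rderive v (smooth_rderive u sf)); exact: Ds.
have drph x : x \in `]0, s[ -> is_derive (x : R) (1 : R) ph (dph x).
  by rewrite in_itv /= => /andP[x0 xs]; apply: dphP; rewrite !ltW.
have cph : {within `[0, s], continuous ph}.
  by apply: derivable_within_continuous => x; rewrite in_itv /= => /dphP [].
have [b] := MVT s0 drph cph.
rewrite in_itv /= => /andP[b0 bs]; rewrite subr0 => Eb.
exists a, b; split=> //; first by rewrite !ltW.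
rewrite -/(dph b) -mulrA [s * dph b]mulrC -Eb.
have -> : ph s - ph 0 = dps a.
  have E0 : ph 0 = complex.Re (rderive u f (z + (a%:C)%C *: u)) by exact: line_re0.
  have Es : ph s = complex.Re (rderive u f (z + (s%:C)%C *: v + (a%:C)%C *: u)).
    by rewrite /ph /line_re [z + _ + _]addrAC.
  by rewrite E0 Es.
rewrite [s * _]mulrC -Ea /ps !fctE !line_re0 /line_re opprB addrA.
rewrite [z + _ + (s%:C)%C *: u]addrAC.
by rewrite -!addrA; congr (_ + (_ + _)); rewrite addrC.
Qed.

Lemma square_near D z u v : open D -> D z -> exists2 s : R, 0 < s &
  forall a b : R, 0 <= a <= s -> 0 <= b <= s ->
    D (z + (a%:C)%C *: u + (b%:C)%C *: v).
Proof.
move=> oD Dz.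
have cP : (fun p : R * R => z + (p.1%:C)%C *: u + (p.2%:C)%C *: v) @ (0 : R, 0 : R) -->
    z + (0%:C)%C *: u + (0%:C)%C *: v.
  have c1 : {for (0 : R, 0 : R), continuous (fun p : R * R => (p.1%:C)%C : C)}.
    apply: (@continuous_comp _ _ _ (@fst R R) (fun t : R => (t%:C)%C : C)).
      exact: cvg_fst.
    exact: real_complex_continuous.
  have c2 : {for (0 : R, 0 : R), continuous (fun p : R * R => (p.2%:C)%C : C)}.
    apply: (@continuous_comp _ _ _ (@snd R R) (fun t : R => (t%:C)%C : C)).
      exact: cvg_snd.
    exact: real_complex_continuous.
  apply: cvgD; first apply: cvgD; first exact: cvg_cst.
    exact: cvgZr_tmp c1.
  exact: cvgZr_tmp c2.
have : nbhs (z + (0%:C)%C *: u + (0%:C)%C *: v) D.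
  by rewrite (_ : (0%:C)%C = 0) // !scale0r !addr0; exact: open_nbhs_nbhs.
move=> /cP [[A B] /= [/nbhs_ballP [e e0 Ae] /nbhs_ballP [d d0 Bd]] AB].
exists (Num.min e d / 2); first by rewrite divr_gt0 // lt_min e0.
have H : Num.min e d / 2 < Num.min e d.
  by rewrite ltr_pdivrMr // ltr_pMr ?ltr1n // lt_min e0.
move=> a b /andP[a0 as_] /andP[b0 bs]; apply: (AB (a, b)); split.
  apply: Ae; rewrite /ball /= sub0r normrN ger0_norm //.
  by apply: le_lt_trans as_ (lt_le_trans H _); rewrite ge_min lexx.
apply: Bd; rewrite /ball /= sub0r normrN ger0_norm //.
by apply: le_lt_trans bs (lt_le_trans H _); rewrite ge_min lexx orbT.
Qed.

(** The second difference over a square is symmetric in [u] and [v], so the two mixed derivatives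
    take a common value at points of any small square. If they differed at [z], continuity would
    keep them apart on a small enough square. *)
Lemma Re_schwarz D f u v z : open D -> smooth_on D f -> D z ->
  complex.Re (rderive v (rderive u f) z) = complex.Re (rderive u (rderive v f) z).
Proof.
move=> oD sf Dz.
pose al := complex.Re (rderive v (rderive u f) z).
pose be := complex.Re (rderive u (rderive v f) z).
suff : al = be by [].
apply/eqP; rewrite -subr_eq0; apply/negPn/negP => ne0.
pose e := `|al - be| / 2.
have e0 : 0 < e by rewrite divr_gt0 // normr_gt0.
have cont w w' : \forall x \near z,
   `|complex.Re (rderive w (rderive w' f) z) - complex.Re (rderive w (rderive w' f) x)| < e.
  have cg : {for z, continuous (fun x => complex.Re (rderive w (rderive w' f) x))}.
    apply: (continuous_comp _ (@Re_continuous R _)).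
    exact: (smooth_continuous (smooth_rderive w (smooth_rderive w' sf)) Dz).
  exact: (@cvgr_dist_lt _ _ _ (nbhs z) (nbhs_filter z) _ _ cg _ e0).
have nD : nbhs z D by exact: open_nbhs_nbhs.
pose N := [set x | `|al - complex.Re (rderive v (rderive u f) x)| < e] `&`
  [set x | `|be - complex.Re (rderive u (rderive v f) x)| < e] `&` D.
have nN : nbhs z N.
  exact: (@filterI _ (nbhs z) (nbhs_filter z) _ _
    (@filterI _ (nbhs z) (nbhs_filter z) _ _ (cont v u) (cont u v)) nD).
have [s s0 Hs] := square_near u v (@open_interior _ N) nN.
have sub x : N° x -> N x by exact: interior_subset.
have [a [b [aI bI E1]]] := double_difference sf s0 (fun a b ha hb => (sub _ (Hs a b ha hb)).2).
have Hs' a' b' : 0 <= a' <= s -> 0 <= b' <= s -> D (z + (a'%:C)%C *: v + (b'%:C)%C *: u).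
  by move=> ha hb; rewrite addrAC; exact: (sub _ (Hs b' a' hb ha)).2.
have [b' [a' [bI' aI' E2]]] := double_difference sf s0 Hs'.
have h1 : `|al - complex.Re (rderive v (rderive u f) (z + (a%:C)%C *: u + (b%:C)%C *: v))| < e.
  exact: (sub _ (Hs a b aI bI)).1.1.
have h2 : `|be - complex.Re (rderive u (rderive v f) (z + (a'%:C)%C *: u + (b'%:C)%C *: v))| < e.
  exact: (sub _ (Hs a' b' aI' bI')).1.2.
move: E2; rewrite [z + _ *: v + _ *: u]addrAC [z + _ *: v + _ *: u]addrAC.
rewrite -[LHS]addrA -[LHS]addrA [- _ + (- _ + _)]addrCA ![X in X = _]addrA E1.
move/(mulfI (lt0r_neq0 (mulr_gt0 s0 s0))) => E.
rewrite E in h1; move: (complex.Re _) h1 h2 => x h1 h2.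
have : `|al - be| < e + e.
  rewrite -(subrKA x al); apply: le_lt_trans (ler_normD _ _) _.
  by rewrite [`|x - be|]distrC; exact: (ltrD h1 h2).
by rewrite /e -splitr ltxx.
Qed.

Lemma schwarz D f u v z : open D -> smooth_on D f -> D z ->
  rderive v (rderive u f) z = rderive u (rderive v f) z.
Proof.
move=> oD sf Dz.
(* The real part of [i f] is minus the imaginary part of [f], so the result for real parts also
   settles imaginary parts. *)
pose g := fun x => (Complex 0 1 : C) * f x.
have sg : smooth_on D g.
  by apply: (fcM (smooth_class oD)) sf; exact: (fc_cst (smooth_class oD)).
have gE (h : 'rV[C]_n -> C) w x : smooth_on D h -> D x ->
    rderive w (fun x => (Complex 0 1 : C) * h x) x = (Complex 0 1 : C) * rderive w h x.
  move=> sh Dx; rewrite (rderive_val (is_rderiveM (is_rderive_cst w x _) (smooth_is_rderive w sh Dx))).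
  by rewrite mul0r add0r.
have gE2 w w' : rderive w (rderive w' g) z = (Complex 0 1 : C) * rderive w (rderive w' f) z.
  rewrite -(gE _ _ _ (smooth_rderive w' sf) Dz); apply: rderive_val.
  have H := smooth_is_rderive w (fcM (smooth_class oD) (fc_cst (smooth_class oD) (Complex 0 1 : C)) (smooth_rderive w' sf)) Dz.
  apply: (is_rderive_eq_on oD _ Dz H) => x; rewrite inE => Dx.
  by rewrite gE.
have := Re_schwarz u v oD sg Dz; rewrite (gE2 v u) (gE2 u v).
have := Re_schwarz u v oD sf Dz.
case: (rderive v _ z) => a b; case: (rderive u _ z) => c d /= -> .
by rewrite !mul0r !mul1r !sub0r => /oppr_inj ->.
Qed.

End Schwarz.

Section Holomorphic.
Variables (R : realType) (n : nat).
Local Notation C := (cplx R).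
Implicit Types (f g : 'rV[C]_n -> C) (u v z : 'rV[C]_n) (D : set 'rV[C]_n).

Lemma cvg_real_dnbhs : (fun t : R => (t%:C)%C : C) @ (0 : R)^' --> (0 : C)^'.
Proof.
move=> A A0; have := @real_complex_continuous R 0 _ A0.
rewrite !nbhs_simpl /= => H; apply: filterS H => t At t0; apply: At.
by apply: contra t0 => /eqP [->].
Qed.

Lemma is_derive_cvg (g : R -> R) (d : R) :
  (fun t : R => t^-1 * (g t - g 0)) @ (0 : R)^' --> d -> is_derive (0 : R) (1 : R) g d.
Proof.
move=> cg.
have cl : (fun h : R => h^-1 *: ((g \o shift (0 : R)) (h *: (1 : R)) - g 0)) @ (0 : R)^' --> d.
  rewrite (_ : (fun h => _) = (fun t : R => t^-1 * (g t - g 0))) //.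
  by apply/funext => h; rewrite /= /shift /= addr0 /GRing.scale /= mulr1.
by apply: DeriveDef; [exact: cvgP cl|exact: cvg_lim cl].
Qed.

(** The complex difference quotient converges along the punctured neighbourhood of 0 in C, hence
    along its real points; taking real and imaginary parts is continuous. *)
Lemma is_rderive_holo f v z : differentiable f z -> is_rderive v z f ('d f z v).
Proof.
move=> df; have dv := @diff_derivable _ _ _ f z v df.
have ev := deriveE v df; rewrite /derive in ev.
have cl : (fun h : C => h^-1 *: ((f \o shift z) (h *: v) - f z)) @ (0 : C)^' --> 'd f z v.
  by rewrite -ev; exact: dv.
pose q (t : R) : C := ((t^-1)%:C)%C * (f (z + (t%:C)%C *: v) - f z).
have cr : q @ (0 : R)^' --> 'd f z v.
  have qE : q = (fun h : C => h^-1 *: ((f \o shift z) (h *: v) - f z)) \o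
      (fun t : R => (t%:C)%C : C).
    apply/funext => t /=; rewrite /q [z + _]addrC /GRing.scale /=.
    by rewrite (fmorphV (real_complex R)).
  by rewrite qE; exact: (cvg_comp _ _ cvg_real_dnbhs cl).
have q0 : f (z + (0%:C)%C *: v) = f z by rewrite (_ : (0%:C)%C = 0) // scale0r addr0.
split; apply: is_derive_cvg.
  rewrite (_ : (fun t => _) = @complex.Re R \o q); last first.
    apply/funext => t; rewrite /= /q /line_re q0; case: (f _) => a b; case: (f z) => c e /=.
    by rewrite mul0r subr0.
  exact: (continuous_cvg _ (@Re_continuous R _) cr).
rewrite (_ : (fun t => _) = @complex.Im R \o q); last first.
  apply/funext => t; rewrite /= /q /line_im q0; case: (f _) => a b; case: (f z) => c e /=.
  by rewrite mul0r addr0.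
exact: (continuous_cvg _ (@Im_continuous R _) cr).
Qed.

(** The Cauchy-Riemann equations: the differential is C-linear. *)
Lemma holo_rderiveZ f v z : differentiable f z ->
  rderive ('i *: v) f z = 'i * rderive v f z.
Proof.
move=> df; rewrite (rderive_val (is_rderive_holo v df)).
by rewrite (rderive_val (is_rderive_holo _ df)) linearZ.
Qed.

End Holomorphic.

(** * Derivations and the Levi form of log det *)

(** The rules of calculus are separated from the stability of the class [S] under [d]: a function
    known to be differentiable only once obeys the rules, but its derivative need not lie in the
    class. The regularity of transition matrices is proved in that setting. *)
Record leibniz (T : Type) (K : fieldType) (D : set T)
    (S : (T -> K) -> Prop) (d : (T -> K) -> T -> K) : Prop := Leibniz {
  dn_cst : forall a x, D x -> d (fun=> a) x = 0;
  dnD : forall f g x, S f -> S g -> D x -> d (fun y => f y + g y) x = d f x + d g x;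
  dnM : forall f g x, S f -> S g -> D x ->
    d (fun y => f y * g y) x = d f x * g x + f x * d g x;
  dn_eq : forall f g x, S f -> (forall y, D y -> f y = g y) -> D x -> d f x = d g x }.

Record derivation (T : Type) (K : fieldType) (D : set T)
    (S : (T -> K) -> Prop) (d : (T -> K) -> T -> K) : Prop := Derivation {
  dn_leibniz :> leibniz D S d;
  dn_class : forall f, S f -> S (d f) }.

Definition dmx (T : Type) (K : fieldType) (d : (T -> K) -> T -> K) p q
  (A : T -> 'M[K]_(p, q)) (x : T) : 'M[K]_(p, q) :=
  \matrix_(a, b) d (fun y => A y a b) x.

Section DerivationTheory.
Variables (T : Type) (K : fieldType) (D : set T) (S : (T -> K) -> Prop).
Hypothesis SC : fun_class D S.
Variable d : (T -> K) -> T -> K.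
Hypothesis dd : leibniz D S d.
Local Notation mS := (mx_class S).

Lemma dn_sum (I : Type) (s : seq I) (Q : pred I) (f : I -> T -> K) x :
  (forall i, S (f i)) -> D x ->
  d (fun y => \sum_(i <- s | Q i) f i y) x = \sum_(i <- s | Q i) d (f i) x.
Proof.
move=> Sf Dx; elim: s => [|i s IH].
  rewrite big_nil; apply: etrans (dn_cst dd 0 Dx); apply: (dn_eq dd _ _ Dx); first exact: (fc_sum SC).
  by move=> y _; rewrite big_nil.
rewrite big_cons -IH; case Qi: (Q i); last first.
  by apply: (dn_eq dd _ _ Dx); [exact: (fc_sum SC)|move=> y _; rewrite big_cons Qi].
rewrite -(dnD dd _ _ Dx) //; last exact: (fc_sum SC).
by apply: (dn_eq dd _ _ Dx); [exact: (fc_sum SC)|move=> y _; rewrite big_cons Qi].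
Qed.

Lemma dn_prod (I : finType) (f : I -> T -> K) x : (forall i, S (f i)) -> D x ->
  d (fun y => \prod_i f i y) x = \sum_i d (f i) x * \prod_(j | j != i) f j x.
Proof.
move=> Sf Dx; suff H (s : seq I) : uniq s -> d (fun y => \prod_(i <- s) f i y) x =
    \sum_(i <- s) d (f i) x * \prod_(j <- s | j != i) f j x.
  exact: (H _ (index_enum_uniq I)).
elim: s => [|i s IH] /= us.
  rewrite big_nil; apply: etrans (dn_cst dd 1 Dx); apply: (dn_eq dd _ _ Dx); first exact: (fc_prod SC).
  by move=> y _; rewrite big_nil.
case/andP: us => ins us.
have -> : d (fun y => \prod_(j <- i :: s) f j y) x = d (fun y => f i y * \prod_(j <- s) f j y) x.
  by apply: (dn_eq dd _ _ Dx); [exact: (fc_prod SC)|move=> y _; rewrite big_cons].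
rewrite (dnM dd _ _ Dx) //; last exact: (fc_prod SC).
rewrite (IH us) big_cons big_cons eqxx /=; congr (_ * _ + _).
  rewrite big_seq_cond [RHS]big_seq_cond; apply: eq_bigl => j.
  by case: (boolP (j \in s)) => //= js; case: eqP => // ji; rewrite -ji js in ins.
rewrite mulr_sumr; apply: eq_big_seq => j js; rewrite big_cons.
case: eqP => [ij|_] /=; first by rewrite ij js in ins.
by rewrite mulrCA.
Qed.

Lemma dmx_cst p q (A : 'M[K]_(p, q)) x : D x -> dmx d (fun=> A) x = 0.
Proof. by move=> Dx; apply/matrixP => a b; rewrite !mxE (dn_cst dd). Qed.

Lemma dmx_eq p q (A B : T -> 'M[K]_(p, q)) x : mS A -> (forall y, D y -> A y = B y) ->
  D x -> dmx d A x = dmx d B x.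
Proof.
move=> SA AB Dx; apply/matrixP => a b; rewrite !mxE.
by apply: (dn_eq dd (SA a b) _ Dx) => y Dy; rewrite AB.
Qed.

Lemma dmxD p q (A B : T -> 'M[K]_(p, q)) x : mS A -> mS B -> D x ->
  dmx d (fun y => A y + B y) x = dmx d A x + dmx d B x.
Proof.
move=> SA SB Dx; apply/matrixP => a b; rewrite !mxE -(dnD dd) //.
by apply: (dn_eq dd _ _ Dx); [exact: (mx_classD SC SA SB)|move=> y _; rewrite mxE].
Qed.

Lemma dmxM p q r (A : T -> 'M[K]_(p, q)) (B : T -> 'M[K]_(q, r)) x :
  mS A -> mS B -> D x ->
  dmx d (fun y => A y *m B y) x = dmx d A x *m B x + A x *m dmx d B x.
Proof.
move=> SA SB Dx; apply/matrixP => a b; rewrite !mxE.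
have SAB c : S (fun y => A y a c * B y c b) by apply: (fcM SC).
have -> : d (fun y => (A y *m B y) a b) x = d (fun y => \sum_c A y a c * B y c b) x.
  by apply: (dn_eq dd _ _ Dx); [exact: (mx_classM SC SA SB)|move=> y _; rewrite mxE].
rewrite dn_sum // -big_split /=; apply: eq_bigr => c _.
by rewrite !mxE (dnM dd).
Qed.

Lemma dmxN p q (A : T -> 'M[K]_(p, q)) x : mS A -> D x ->
  dmx d (fun y => - A y) x = - dmx d A x.
Proof.
move=> SA Dx; apply/eqP; rewrite -addr_eq0 -dmxD //; last first.
  move=> a b; apply: (fc_ext SC (fcM SC (fc_cst SC (-1)) (SA a b))) => y _.
  by rewrite mxE mulN1r.
rewrite -(dmx_cst (0 : 'M[K]_(p, q)) Dx); apply/eqP/dmx_eq => //; last first.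
  by move=> y _; rewrite addNr.
by apply: (mx_class_ext SC (mx_class_cst SC 0)) => y _; rewrite addNr.
Qed.

Lemma dn_tr p (A : T -> 'M[K]_p) x : mS A -> D x ->
  d (fun y => \tr (A y)) x = \tr (dmx d A x).
Proof. by move=> SA Dx; rewrite dn_sum //; apply: eq_bigr => i _; rewrite mxE. Qed.

Lemma dmx_inv p (A : T -> 'M[K]_p) x : mS A -> (forall y, D y -> A y \in unitmx) ->
  D x -> dmx d (fun y => invmx (A y)) x =
    - (invmx (A x) *m dmx d A x *m invmx (A x)).
Proof.
move=> SA uA Dx; have SV := mx_class_inv SC SA uA.
have : dmx d (fun y => invmx (A y) *m A y) x = 0.
  rewrite -(dmx_cst (1%:M : 'M[K]_p) Dx); apply: dmx_eq => //; first exact: (mx_classM SC).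
  by move=> y Dy; rewrite mulVmx ?uA.
rewrite dmxM // => /eqP; rewrite addr_eq0 => /eqP /(congr1 (mulmx^~ (invmx (A x)))) /=.
by rewrite -[X in X = _]mulmxA mulmxV ?uA // mulmx1 => ->; rewrite mulNmx.
Qed.

(** Jacobi's formula, from the expansion of the determinant over permutations. *)
Lemma dn_det p (A : T -> 'M[K]_p) x : mS A -> D x ->
  d (fun y => \det (A y)) x = \tr (dmx d A x *m \adj (A x)).
Proof.
move=> SA Dx.
have Sp (s : 'S_p) : S (fun y => \prod_i A y i (s i)) by exact: (fc_prod SC).
have St (s : 'S_p) : S (fun y => (- 1) ^+ s * \prod_i A y i (s i)).
  by apply: (fcM SC) => //; exact: (fc_cst SC).
rewrite dn_sum //.
(* [B i] is [A x] with row i replaced by its derivative. Laplace expansion along that row produces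
   the adjugate; expansion over permutations produces the differentiated products. *)
pose B i : 'M[K]_p := \matrix_(k, l) if k == i then dmx d A x i l else A x k l.
have detB i : \det (B i) = \sum_j dmx d A x i j * cofactor (A x) i j.
  rewrite (expand_det_row _ i); apply: eq_bigr => j _; rewrite !mxE eqxx.
  congr (_ * (_ * \det _)); apply/matrixP => k l; rewrite !mxE.
  by rewrite eq_sym (negPf (neq_lift _ _)).
have -> : \tr (dmx d A x *m \adj (A x)) = \sum_i \det (B i).
  by apply: eq_bigr => i _; rewrite detB !mxE; apply: eq_bigr => j _; rewrite !mxE.
rewrite exchange_big /=; apply: eq_bigr => s _.
rewrite (dnM dd) //; last exact: (fc_cst SC).
rewrite (dn_cst dd) // mul0r add0r dn_prod // -mulr_sumr; congr (_ * _).
apply: eq_bigr => i _; rewrite [RHS](bigD1 i) //= !mxE eqxx; congr (_ * _).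
by apply: eq_bigr => j ji; rewrite !mxE (negPf ji).
Qed.

Lemma dn_log_det p (A : T -> 'M[K]_p) x : mS A -> D x -> A x \in unitmx ->
  (\det (A x))^-1 * d (fun y => \det (A y)) x = \tr (invmx (A x) *m dmx d A x).
Proof.
move=> SA Dx uA; rewrite dn_det // mxtrace_mulC /invmx uA -scalemxAl.
by rewrite linearZ.
Qed.

End DerivationTheory.

Lemma dmx_class (T : Type) (K : fieldType) (D : set T) (S : (T -> K) -> Prop)
    (d : (T -> K) -> T -> K) p q (A : T -> 'M[K]_(p, q)) : fun_class D S ->
  derivation D S d -> mx_class S A -> mx_class S (dmx d A).
Proof.
move=> SC dd SA a b; apply: (fc_ext SC (dn_class dd (SA a b))) => x _.
by rewrite mxE.
Qed.

(** With a = dH, b = d'H and e = dd'H, the left side is the second derivative of k = H^-1. The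
    curvature of H appears between two factors k, and the remainder is d'k H dk. *)
Lemma levi_inverse_algebra (K : comNzRingType) r (k H a b e : 'M[K]_r) : k *m H = 1%:M ->
  - (((- (k *m a *m k) *m b + k *m e) *m k) + k *m b *m (- (k *m a *m k))) =
  k *m (- e + a *m k *m b) *m k + (- (k *m b *m k)) *m H *m (- (k *m a *m k)).
Proof.
move=> kH; rewrite !(mulNmx, mulmxN) opprK.
have -> : k *m b *m k *m H *m (k *m a *m k) = k *m b *m (k *m a *m k).
  by rewrite -[k *m b *m k *m H]mulmxA kH mulmx1.
rewrite !(mulmxDl, mulmxDr, mulmxN, mulNmx) !opprD !opprK !mulmxA.
by rewrite [- _ + _]addrC.
Qed.

(** Completing the square: here [c] and [d'] stand for dk and d'k, and all the terms without
    curvature assemble into Z' H Z. The term coming from the derivative of W^-1 becomes, by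
    cyclicity of the trace, the subtracted Z' Th W^-1 Ph Z. *)
Lemma levi_algebra (K : comNzRingType) r s (k H c d' : 'M[K]_r) (Rm : 'M[K]_r)
    (Th dTh : 'M[K]_(r, s)) (Ph dPh : 'M[K]_(s, r)) (Wi : 'M[K]_s) :
  k *m H = 1%:M -> H *m k = 1%:M ->
  let Z := c *m Th + k *m dTh in let Z' := Ph *m d' + dPh *m k in
  \tr (- (Wi *m (Ph *m Z) *m Wi) *m (Z' *m Th) + Wi *m
    ((Ph *m (k *m Rm *m k + d' *m H *m c) + dPh *m c) *m Th + Z' *m dTh)) =
  \tr (Wi *m (Ph *m k *m Rm *m (k *m Th))) +
    \tr (Wi *m (Z' *m (H - Th *m Wi *m Ph) *m Z)).
Proof.
move=> kH Hk Z Z'.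
have -> : (Ph *m (k *m Rm *m k + d' *m H *m c) + dPh *m c) *m Th + Z' *m dTh =
    Ph *m k *m Rm *m (k *m Th) + Z' *m H *m Z.
  rewrite /Z /Z' !(mulmxDr, mulmxDl) !mulmxA.
  have e1 : Ph *m d' *m H *m k = Ph *m d' by rewrite -mulmxA Hk mulmx1.
  have e2 : dPh *m k *m H = dPh by rewrite -mulmxA kH mulmx1.
  by rewrite e1 e2 -!addrA; congr (_ + (_ + _)); rewrite addrCA.
rewrite mulmxBr mulmxBl mulmxDr mulmxBr !mxtraceD raddfN /= mulNmx raddfN /=.
rewrite addrC -addrA; congr (_ + (_ - _)).
transitivity (\tr ((Wi *m Ph *m Z) *m (Wi *m Z' *m Th))); first by rewrite !mulmxA.
by rewrite mxtrace_mulC !mulmxA.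
Qed.

Section LeviLogDet.
Variables (T : Type) (K : fieldType) (D : set T) (S : (T -> K) -> Prop).
Hypothesis SC : fun_class D S.
Variables (d d' : (T -> K) -> T -> K).
Hypotheses (dd : derivation D S d) (dd' : derivation D S d').
Local Notation mS := (mx_class S).
Variables (r s : nat) (H : T -> 'M[K]_r) (Th : T -> 'M[K]_(r, s)) (Ph : T -> 'M[K]_(s, r)).
Hypotheses (SH : mS H) (STh : mS Th) (SPh : mS Ph).
Hypotheses (uH : forall x, D x -> H x \in unitmx).
Let W x := Ph x *m invmx (H x) *m Th x.
Hypothesis uW : forall x, D x -> W x \in unitmx.
Hypotheses (dTh : forall x, D x -> dmx d' Th x = 0) (dPh : forall x, D x -> dmx d Ph x = 0).

(* d and d' play the roles of the (1,0) and (0,1) derivatives; Th is holomorphic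
   and Ph antiholomorphic, and the vanishing of d d' Ph is the symmetry of second
   derivatives. *)
Lemma levi_log_det x (l : T -> K) : D x -> dmx d (dmx d' Ph) x = 0 ->
  S l -> (forall y, D y -> l y = (\det (W y))^-1 * d' (fun y => \det (W y)) y) ->
  let k := invmx (H x) in
  let Rm := - dmx d (dmx d' H) x + dmx d H x *m k *m dmx d' H x in
  let dk := - (k *m dmx d H x *m k) in
  let d'k := - (k *m dmx d' H x *m k) in
  let Z := dk *m Th x + k *m dmx d Th x in
  let Z' := Ph x *m d'k + dmx d' Ph x *m k in
  d l x = \tr (invmx (W x) *m (Ph x *m k *m Rm *m (k *m Th x))) +
    \tr (invmx (W x) *m (Z' *m (H x - Th x *m invmx (W x) *m Ph x) *m Z)).
Proof.
move=> Dx ddPh Sl lE k Rm dk d'k Z Z'.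
pose V y := invmx (H y).
have SV : mS V := mx_class_inv SC SH uH.
have SPV : mS (fun y => Ph y *m V y) := mx_classM SC SPh SV.
have SW : mS W := mx_classM SC SPV STh.
have SWV : mS (fun y => invmx (W y)) := mx_class_inv SC SW uW.
have SdPh : mS (dmx d' Ph) := dmx_class SC dd' SPh.
have SdH : mS (dmx d' H) := dmx_class SC dd' SH.
have SdW : mS (dmx d' W) := dmx_class SC dd' SW.
pose dV y := - (V y *m dmx d' H y *m V y).
have SVH : mS (fun y => V y *m dmx d' H y) := mx_classM SC SV SdH.
have SVHV : mS (fun y => V y *m dmx d' H y *m V y) := mx_classM SC SVH SV.
have SdV : mS dV.
  move=> a b; apply: (fc_ext SC (fcM SC (fc_cst SC (-1)) (SVHV a b))) => y _.
  by rewrite [in RHS]mxE mulN1r.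
pose Zp y := Ph y *m dV y + dmx d' Ph y *m V y.
have S1 : mS (fun y => Ph y *m dV y) := mx_classM SC SPh SdV.
have S2 : mS (fun y => dmx d' Ph y *m V y) := mx_classM SC SdPh SV.
have SZp : mS Zp := mx_classD SC S1 S2.
have SZT : mS (fun y => Zp y *m Th y) := mx_classM SC SZp STh.
(* [Th] is killed by [d'], so only [Ph] and H^-1 are differentiated. *)
have dWE y : D y -> dmx d' W y = Zp y *m Th y.
  move=> Dy; rewrite (dmxM SC dd') // (dmxM SC dd') // dTh // mulmx0 addr0.
  by rewrite (dmx_inv SC dd') // addrC.
have lE2 y : D y -> l y = \tr (invmx (W y) *m dmx d' W y).
  by move=> Dy; rewrite lE // (dn_log_det SC dd') // uW.
have SWdW : mS (fun y => invmx (W y) *m dmx d' W y) := mx_classM SC SWV SdW.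
have -> : d l x = \tr (dmx d (fun y => invmx (W y) *m dmx d' W y) x).
  rewrite -(dn_tr SC dd) //; exact: (dn_eq dd).
have dWx : dmx d W x = Ph x *m Z.
  rewrite (dmxM SC dd) // (dmxM SC dd) // dPh // mul0mx add0r.
  by rewrite (dmx_inv SC dd) // mulmxDr !mulmxA.
have ddW : dmx d (dmx d' W) x = (Ph x *m dmx d dV x + dmx d' Ph x *m dk) *m Th x
    + Z' *m dmx d Th x.
  rewrite (dmx_eq dd SdW dWE Dx) (dmxM SC dd) //; congr (_ *m _ + _).
  rewrite (dmxD SC dd) // (dmxM SC dd) // (dmxM SC dd) // dPh // mul0mx add0r.
  by rewrite ddPh mul0mx add0r (dmx_inv SC dd).
have kH : k *m H x = 1%:M by rewrite mulVmx ?uH.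
have Hk : H x *m k = 1%:M by rewrite mulmxV ?uH.
have ddV : dmx d dV x = k *m Rm *m k + d'k *m H x *m dk.
  rewrite (dmxN SC dd) // (dmxM SC dd) // (dmxM SC dd) // !(dmx_inv SC dd) //.
  exact: levi_inverse_algebra.
rewrite (dmxM SC dd) // (dmx_inv SC dd) // ddW dWx dWE // ddV.
exact: levi_algebra.
Qed.

End LeviLogDet.

(** * Hermitian matrices *)

Section HermitianForms.
Variable C : numClosedFieldType.
Local Open Scope sesquilinear_scope.

Lemma adjM m n p (A : 'M[C]_(m, n)) (B : 'M[C]_(n, p)) : (A *m B) ^t* = B ^t* *m A ^t*.
Proof. by rewrite trmx_mul map_mxM. Qed.

Lemma adjE m n (A : 'M[C]_(m, n)) i j : A ^t* i j = (A j i)^*.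
Proof. by rewrite !mxE. Qed.

Lemma adjD m n (A B : 'M[C]_(m, n)) : (A + B) ^t* = A ^t* + B ^t*.
Proof. by apply/matrixP => i j; rewrite !mxE rmorphD. Qed.

Lemma adjZ m n a (A : 'M[C]_(m, n)) : (a *: A) ^t* = a^* *: A ^t*.
Proof. by apply/matrixP => i j; rewrite !mxE rmorphM. Qed.

Lemma adj_inv n (A : 'M[C]_n) : (invmx A) ^t* = invmx (A ^t*).
Proof. by rewrite trmx_inv map_invmx. Qed.

Lemma adj_eq0 m n (A : 'M[C]_(m, n)) : (A ^t* == 0) = (A == 0).
Proof. by rewrite map_mx_eq0 trmx_eq0. Qed.

Definition qform r (Q : 'M[C]_r) (c : 'cV[C]_r) : C := (c ^t* *m Q *m c) 0 0.

Definition posdef r (Q : 'M[C]_r) : Prop :=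
  Q ^t* = Q /\ forall c, c != 0 -> 0 < qform Q c.

Lemma qform0 r (Q : 'M[C]_r) : qform Q 0 = 0.
Proof. by rewrite /qform mulmx0 mxE. Qed.

Lemma qform_adj r s (Q : 'M[C]_r) (Z : 'M[C]_(r, s)) c :
  qform (Z ^t* *m Q *m Z) c = qform Q (Z *m c).
Proof. by rewrite /qform adjM !mulmxA. Qed.

Lemma posdef_ge0 r (Q : 'M[C]_r) c : posdef Q -> 0 <= qform Q c.
Proof.
by case=> _ pQ; have [->|/pQ/ltW//] := eqVneq c 0; rewrite qform0.
Qed.

Lemma posdef_eq0 r (Q : 'M[C]_r) c : posdef Q -> qform Q c = 0 -> c = 0.
Proof.
case=> _ pQ q0; apply/eqP; apply/negPn/negP => /pQ; by rewrite q0 ltxx.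
Qed.

Lemma posdef_unit r (Q : 'M[C]_r) : posdef Q -> Q \in unitmx.
Proof.
move=> pQ; rewrite -row_free_unit -kermx_eq0; apply/eqP/row_matrixP => i.
rewrite row0; set u := row i _; have uQ : u *m Q = 0.
  by apply/sub_kermxP; exact: row_sub.
have : u ^t* = 0.
  apply: (posdef_eq0 pQ); rewrite /qform trmxCK uQ mul0mx mxE //.
by move/eqP; rewrite adj_eq0 => /eqP.
Qed.

Lemma posdef_congr r s (Q : 'M[C]_r) (Z : 'M[C]_(r, s)) (L : 'M[C]_(s, r)) :
  posdef Q -> L *m Z = 1%:M -> posdef (Z ^t* *m Q *m Z).
Proof.
move=> [hQ pQ] LZ; split; first by rewrite !adjM hQ trmxCK mulmxA.
move=> c c0; rewrite qform_adj; apply: pQ; apply: contra c0 => /eqP Zc.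
by rewrite -[c]mul1mx -LZ -mulmxA Zc mulmx0.
Qed.

Lemma posdef_inv r (Q : 'M[C]_r) : posdef Q -> posdef (invmx Q).
Proof.
move=> pQ; have uQ := posdef_unit pQ.
have := @posdef_congr _ _ Q (invmx Q) Q pQ (mulmxV uQ).
by rewrite adj_inv pQ.1 mulVmx // mul1mx.
Qed.

Lemma hermitian_spectral n (A : 'M[C]_n) : A ^t* = A ->
  exists U : 'M[C]_n, exists d : 'rV[C]_n,
    [/\ U *m U ^t* = 1%:M, A = U ^t* *m diag_mx d *m U &
        forall i, d 0 i = qform A (U ^t* *m delta_mx i 0)].
Proof.
move=> hA; have /orthomx_spectral_subproof [[U d] /= uU AE] : A \is normalmx.
  by apply/normalmxP; rewrite hA.
have UU : U *m U ^t* = 1%:M by apply/unitarymxP.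
exists U, d; split=> //; first by rewrite -invmx_unitary.
move=> i; rewrite /qform AE invmx_unitary // adjM trmxCK.
rewrite -!mulmxA [U *m (U ^t* *m _)]mulmxA UU mul1mx [U *m (U ^t* *m _)]mulmxA UU mul1mx.
rewrite (_ : (delta_mx i 0) ^t* = delta_mx 0 i :> 'rV_n); last first.
  by apply/matrixP => a b; rewrite !mxE andbC rmorph_nat.
by rewrite mulmxA -rowE row_diag_mx -scalemxAl mul_delta_mx !mxE !eqxx mulr1.
Qed.

Lemma posdef_det_gt0 r (Q : 'M[C]_r) : posdef Q -> 0 < \det Q.
Proof.
move=> [hQ pQ]; have [U [d [UU QE dE]]] := hermitian_spectral hQ.
rewrite QE !det_mulmx det_diag mulrAC -det_mulmx (mulmx1C UU) det1 mul1r.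
apply: prodr_gt0 => i _; rewrite dE; apply: pQ; apply/negP => /eqP Ud.
have : U *m (U ^t* *m delta_mx i 0) = delta_mx i (0 : 'I_1) by rewrite mulmxA UU mul1mx.
rewrite Ud mulmx0 => /matrixP/(_ i 0); rewrite !mxE !eqxx => /eqP.
by rewrite eq_sym oner_eq0.
Qed.

(* The trace is a positive combination of values of [Q], taken at the images
   under [Z] of an eigenbasis of [P]. *)
Lemma trace_qform s (P : 'M[C]_s) : posdef P ->
  exists U : 'M[C]_s, exists d : 'I_s -> C, [/\ U *m U ^t* = 1%:M, forall i, 0 < d i &
    forall r (Q : 'M[C]_r) (Z : 'M[C]_(r, s)), \tr (P *m (Z ^t* *m Q *m Z)) =
      \sum_i d i * qform Q (Z *m (U ^t* *m delta_mx i 0))].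
Proof.
move=> [hP pP]; have [U [d [UU PE dE]]] := hermitian_spectral hP.
exists U, (fun i => d 0 i); split; first exact: UU.
  move=> i; rewrite dE; apply: pP; apply/negP => /eqP Ud.
  have : U *m (U ^t* *m delta_mx i 0) = delta_mx i (0 : 'I_1) by rewrite mulmxA UU mul1mx.
  rewrite Ud mulmx0 => /matrixP/(_ i 0); rewrite !mxE !eqxx => /eqP.
  by rewrite eq_sym oner_eq0.
move=> r Q Z; rewrite {1}PE -!mulmxA mxtrace_mulC -!mulmxA mul_diag_mx.
apply: eq_bigr => i _; rewrite mxE; congr (_ * _).
have ee (A : 'M[C]_s) : A i i = (delta_mx (0 : 'I_1) i *m A *m delta_mx i (0 : 'I_1)) 0 0.
  by rewrite -rowE -colE !mxE.
rewrite ee /qform !adjM trmxCK.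
rewrite (_ : (delta_mx i 0) ^t* = delta_mx 0 i :> 'rV_s) ?mulmxA //.
by apply/matrixP => a b; rewrite !mxE andbC rmorph_nat.
Qed.

Lemma trace_qform_ge0 r s (P : 'M[C]_s) (Q : 'M[C]_r) (Z : 'M[C]_(r, s)) :
  posdef P -> (forall c, 0 <= qform Q c) -> 0 <= \tr (P *m (Z ^t* *m Q *m Z)).
Proof.
move=> pP Q0; have [U [d [_ d0 ->]]] := trace_qform pP.
by apply: sumr_ge0 => i _; rewrite mulr_ge0 // ltW.
Qed.

Lemma trace_qform_eq0 r s (P : 'M[C]_s) (Q : 'M[C]_r) (Z : 'M[C]_(r, s)) :
  posdef P -> (forall c, 0 <= qform Q c) -> \tr (P *m (Z ^t* *m Q *m Z)) = 0 ->
  exists2 U : 'M[C]_s, U *m U ^t* = 1%:M &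
    forall i, qform Q (Z *m (U ^t* *m delta_mx i 0)) = 0.
Proof.
move=> pP Q0; have [U [d [UU d0 ->]]] := trace_qform pP => t0.
exists U => // i; apply/eqP; have := psumr_eq0P _ t0 => /(_ _ i isT) H.
have /eqP := H (fun j _ => mulr_ge0 (ltW (d0 j)) (Q0 _)).
by rewrite mulf_eq0 (gt_eqF (d0 i)).
Qed.

Lemma trace_posdef_eq0 r s (P : 'M[C]_s) (Q : 'M[C]_r) (Z : 'M[C]_(r, s)) :
  posdef P -> posdef Q -> \tr (P *m (Z ^t* *m Q *m Z)) = 0 -> Z = 0.
Proof.
move=> pP pQ t0; have [U UU H] := trace_qform_eq0 pP (fun c => posdef_ge0 c pQ) t0.
suff : Z *m U ^t* = 0 by move/(congr1 (mulmx^~ U)); rewrite /= -mulmxA (mulmx1C UU) mulmx1 mul0mx.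
apply/matrixP => a i; have := posdef_eq0 pQ (H i).
by rewrite mulmxA -colE => /matrixP/(_ a 0); rewrite !mxE.
Qed.

(** [Z0] is the part of [Z] orthogonal, for the form H, to the columns of H^-1 Th: indeed Th^* Z0 =
    0. So H - Th W^-1 Th^* is positive semidefinite, and it vanishes on [Z] only if [Z] factors
    through H^-1 Th. *)
Lemma projection_identity r s (H : 'M[C]_r) (Th Z : 'M[C]_(r, s)) (W := Th ^t* *m invmx H *m Th)
    (Z0 := Z - invmx H *m Th *m invmx W *m Th ^t* *m Z) :
  posdef H -> posdef W ->
  Z ^t* *m (H - Th *m invmx W *m Th ^t*) *m Z = Z0 ^t* *m H *m Z0.
Proof.
move=> pH pW; have uH := posdef_unit pH; have uW := posdef_unit pW.
have hk : (invmx H) ^t* = invmx H by rewrite adj_inv pH.1.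
have hw : (invmx W) ^t* = invmx W by rewrite adj_inv pW.1.
have HZ : H *m Z0 = (H - Th *m invmx W *m Th ^t*) *m Z.
  by rewrite mulmxBr mulmxBl !mulmxA mulmxV // mul1mx.
have TZ : Th ^t* *m Z0 = 0.
  rewrite mulmxBr !mulmxA -/W -[W *m _ *m _]mulmxA.
  by rewrite (mulmxA W) mulmxV // mul1mx subrr.
have XZ : (Z - Z0) ^t* *m (H *m Z0) = 0.
  rewrite opprB addrC subrK !adjM hk hw !trmxCK -!mulmxA (mulmxA (invmx H)) mulVmx // mul1mx.
  by rewrite TZ !mulmx0.
move: XZ; rewrite raddfB /= map_mxB mulmxBl => /eqP; rewrite subr_eq0 => /eqP.
by rewrite {1}HZ mulmxA => ->; rewrite mulmxA.
Qed.

Lemma hermitian_of_real n (A : 'M[C]_n) :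
  (forall u : 'rV[C]_n, (u *m A *m u ^t*) 0 0 \is Num.real) -> A ^t* = A.
Proof.
move=> rA.
have AE (i j : 'I_n) : (delta_mx (0 : 'I_1) i *m A *m (delta_mx (0 : 'I_1) j) ^t*) 0 0 = A i j.
  rewrite (_ : (delta_mx 0 j) ^t* = delta_mx j 0 :> 'cV_n); last first.
    by apply/matrixP => a b; rewrite !mxE andbC rmorph_nat.
  by rewrite -rowE -colE !mxE.
have r1 i : A i i \is Num.real by have := rA (delta_mx 0 i); rewrite AE.
(* Polarisation: the form is real at e_i + a e_j, and the two values a = 1 and a = i determine both
   the sum and the difference of the conjugated entries. *)
have ex (a : C) i j : A i i + a^* * A i j + a * A j i + (a * a^*) * A j j \is Num.real.
  have := rA (delta_mx 0 i + a *: delta_mx 0 j).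
  rewrite adjD adjZ !mulmxDl !mulmxDr.
  rewrite -!scalemxAr -!scalemxAl.
  rewrite -(AE i i) -(AE i j) -(AE j i) -(AE j j).
  move: (delta_mx 0 i *m A *m (delta_mx 0 i) ^t*) (delta_mx 0 i *m A *m (delta_mx 0 j) ^t*)
    (delta_mx 0 j *m A *m (delta_mx 0 i) ^t*) (delta_mx 0 j *m A *m (delta_mx 0 j) ^t*) => a1 a2 a3 a4.
  by rewrite !mxE mulrA [a^* * a]mulrC !addrA.
apply/matrixP => i j; rewrite adjE.
have h1 := CrealP (ex 1 j i); have h2 := CrealP (ex 'i j i).
have := CrealP (r1 i); have := CrealP (r1 j) => hj hi.
move: h1 h2; rewrite !rmorphD !rmorphM /= !conjCK conjCi rmorph1 hi hj !mul1r.
move: (A i j) (A j i) (A i i) (A j j) (A j i)^* (A i j)^* => x y b c y' x' h1 h2.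
have {}h1 : y' + x' = y + x.
  by apply: (addrI c); apply: (addIr b); rewrite !addrA.
have {}h2 : y' - x' = x - y.
  apply: (mulfI (neq0Ci C)); apply: (addrI c); apply: (addIr ('i * - 'i * b)).
  have -> : c + 'i * (y' - x') + 'i * - 'i * b =
    c + 'i * y' + - 'i * x' + - 'i * 'i * b by ring.
  by rewrite h2; ring.
have n2 : (2%:R : C) != 0 by rewrite pnatr_eq0.
apply: (mulIf n2).
have -> : y' * 2%:R = (y' + x') + (y' - x') by ring.
by rewrite h1 h2; ring.
Qed.

Lemma char_poly_unitary n (U : 'M[C]_n) (d : 'rV[C]_n) : U *m U ^t* = 1%:M ->
  char_poly (U ^t* *m diag_mx d *m U) = \prod_i ('X - (d 0 i)%:P).
Proof.
move=> UU; have UU' := mulmx1C UU.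
transitivity (char_poly (diag_mx d)); last first.
  rewrite char_poly_trig ?diag_mx_is_trig //.
  by apply: eq_bigr => i _; rewrite !mxE eqxx.
rewrite /char_poly; pose P := map_mx polyC U; pose P' := map_mx polyC (U ^t*).
have PP : P' *m P = 1%:M by rewrite -map_mxM UU' map_mx1.
have -> : char_poly_mx (U ^t* *m diag_mx d *m U) = P' *m char_poly_mx (diag_mx d) *m P.
  rewrite /char_poly_mx mulmxBr mulmxBl !map_mxM; congr (_ - _).
  by rewrite scalar_mxC -mulmxA PP mulmx1.
by rewrite !det_mulmx mulrAC -det_mulmx PP det1 mul1r.
Qed.

Lemma rank_diag_mx n (d : 'rV[C]_n) : (\rank (diag_mx d) <= \sum_i (d 0%R i != 0%R))%N.
Proof.
have -> : diag_mx d = \sum_i d 0 i *: delta_mx i i.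
  apply/matrixP => a b; rewrite summxE (bigD1 a) //= big1 ?addr0.
    by rewrite !mxE eqxx mulr_natr /= eq_sym.
  by move=> i ia; rewrite !mxE [a == i]eq_sym (negPf ia) mulr0.
elim/big_rec2: _ => [|i k B _ IH]; first by rewrite mxrank0.
apply: leq_trans (mxrank_add _ _) _; apply: leq_add IH.
have [->|d0] := eqVneq (d 0 i) 0; first by rewrite scale0r mxrank0.
by rewrite mxrank_scale_nz // mxrank_delta.
Qed.

(** In a unitary eigenbasis the eigenvalues are nonnegative, and at least rank A of them are
    nonzero; the rank is n minus the dimension of the kernel. *)
Lemma psd_pos_eigenvalues n (A : 'M[C]_n) k :
  (forall u : 'rV[C]_n, 0 <= (u *m A *m u ^t*) 0 0) -> (\rank (kermx A) <= k)%N ->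
  exists s : seq C, char_poly A = \prod_(a <- s) ('X - a%:P) /\
    (n - k <= count (fun a : C => (0 < a)%R) s)%N.
Proof.
move=> A0 rk.
have hA : A ^t* = A by apply: hermitian_of_real => u; exact: ger0_real.
have [U [d [UU AE dE]]] := hermitian_spectral hA.
have d0 i : 0 <= d 0 i.
  by rewrite dE /qform -[X in _ *m X]trmxCK; exact: A0.
exists [seq d 0 i | i <- enum 'I_n]; split.
  by rewrite AE char_poly_unitary // big_map big_enum.
rewrite mxrank_ker leq_subLR addnC in rk; rewrite leq_subLR; apply: leq_trans rk _.
rewrite leq_add2l [X in \rank X]AE.
apply: leq_trans (mxrankM_maxl _ _) _; apply: leq_trans (mxrankM_maxr _ _) _.
apply: leq_trans (rank_diag_mx d) _.
rewrite count_map -sum1_count big_enum_cond [X in (_ <= X)%N]big_mkcond /=.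
by apply: leq_sum => i _ /=; rewrite lt_def d0 andbT; case: (d 0 i == 0).
Qed.

(** In a unitary eigenbasis the value of the form is a sum of nonnegative terms, so each of them
    vanishes. This turns a vanishing curvature number into membership in the kernel bounded by the
    hypothesis. *)
Lemma psd_kernel n (A : 'M[C]_n) (u : 'rV[C]_n) :
  (forall u : 'rV[C]_n, 0 <= (u *m A *m u ^t*) 0 0) -> (u *m A *m u ^t*) 0 0 = 0 ->
  u *m A = 0.
Proof.
move=> A0; have hA : A ^t* = A by apply: hermitian_of_real => w; exact: ger0_real.
have [U [d [UU AE dE]]] := hermitian_spectral hA.
have d0 i : 0 <= d 0 i.
  by rewrite dE /qform -[X in _ *m X]trmxCK; exact: A0.
pose w := u *m U ^t*.
have -> : u *m A *m u ^t* = w *m diag_mx d *m w ^t*.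
  by rewrite AE adjM trmxCK !mulmxA.
rewrite mul_mx_diag mxE => h0.
suff wd : w *m diag_mx d = 0 by rewrite AE !mulmxA -/w wd mul0mx.
apply/matrixP => a i; rewrite (ord1 a) mul_mx_diag !mxE.
have nn i0 : true -> 0 <= (\matrix_(i, j) (w i j * d 0 j)) 0 i0 * w ^t* i0 0.
  by move=> _; rewrite !mxE mulrAC -normCK mulr_ge0 // exprn_ge0.
have h := psumr_eq0P nn h0.
have /eqP := h i isT; rewrite !mxE mulrAC -normCK mulf_eq0 expf_eq0 /= normr_eq0.
by case/orP => /eqP ->; rewrite ?mul0r ?mulr0.
Qed.

(** Passes from the Levi form on pairs of coordinate vectors to its value at [u]: the curvature term
    is sesquilinear through [Rm], the other one because the derivative [Z] is linear in the
    direction. *)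
Lemma hermitian_sum (N r s : nat) (P : 'M[C]_s) (Y : 'M[C]_(r, s))
    (Rm : 'I_N -> 'I_N -> 'M[C]_r) (Q : 'M[C]_r) (Z : 'I_N -> 'M[C]_(r, s)) (u : 'rV[C]_N) :
  \sum_j \sum_k (\tr (P *m (Y ^t* *m Rm j k *m Y)) +
      \tr (P *m ((Z k) ^t* *m Q *m Z j))) * u 0 j * (u 0 k)^* =
  \tr (P *m (Y ^t* *m (\sum_j \sum_k (u 0 j * (u 0 k)^*) *: Rm j k) *m Y)) +
  \tr (P *m ((\sum_j u 0 j *: Z j) ^t* *m Q *m (\sum_j u 0 j *: Z j))).
Proof.
have -> : (\sum_j u 0 j *: Z j) ^t* = \sum_k (u 0 k)^* *: (Z k) ^t*.
  elim/big_rec2: _ => [|i A B _ IH]; first by rewrite trmx0 map_mx0.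
  by rewrite adjD adjZ IH.
rewrite !(mulmx_suml, mulmx_sumr, raddf_sum) /=.
rewrite -big_split /=; apply: eq_bigr => j _.
rewrite !(mulmx_suml, mulmx_sumr, raddf_sum) /= -big_split /=; apply: eq_bigr => k _.
rewrite -!scalemxAr -!scalemxAl -!scalemxAr !mxtraceZ.
by rewrite mulrDl mulrDl; congr (_ + _); ring.
Qed.

Lemma qform_sum (N r : nat) (Rm : 'I_N -> 'I_N -> 'M[C]_r) (u : 'rV[C]_N) (c : 'cV[C]_r) :
  qform (\sum_j \sum_k (u 0 j * (u 0 k)^*) *: Rm j k) c =
  \sum_j \sum_k (\sum_a \sum_b Rm j k a b * (c ^t*) 0 a * (((c ^t*) 0 b)^*)) * u 0 j * (u 0 k)^*.
Proof.
rewrite /qform !(mulmx_suml, mulmx_sumr) summxE; apply: eq_bigr => j _.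
rewrite !(mulmx_suml, mulmx_sumr) summxE; apply: eq_bigr => k _.
rewrite -scalemxAr -scalemxAl mxE -[RHS]mulrA [RHS]mulrC; congr (_ * _).
rewrite mxE [RHS]exchange_big /=; apply: eq_bigr => b _; rewrite !mxE mulr_suml.
apply: eq_bigr => a _; rewrite !mxE conjCK; ring.
Qed.

Lemma herm_mxE n (A : 'M[C]_n) (u : 'rV[C]_n) :
  (u *m A *m u ^t*) 0 0 = \sum_j \sum_k A j k * u 0 j * (u 0 k)^*.
Proof.
rewrite mxE [RHS]exchange_big /=; apply: eq_bigr => k _; rewrite !mxE mulr_suml.
by apply: eq_bigr => j _; rewrite [u 0 j * _]mulrC.
Qed.

(** The projection to the first n coordinates, with matrix [E], sends the kernel of [A] into that of
    [B], and injectively so. *)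
Lemma rank_ker_lsubmx n p (A : 'M[C]_(n + p)) (B : 'M[C]_n) :
  (forall z : 'rV[C]_(n + p), z *m A = 0 -> lsubmx z *m B = 0) ->
  (forall z : 'rV[C]_(n + p), z *m A = 0 -> lsubmx z = 0 -> z = 0) ->
  (\rank (kermx A) <= \rank (kermx B))%N.
Proof.
move=> hB h0; pose E : 'M[C]_(n + p, n) := lsubmx 1%:M.
have EE m (z : 'M[C]_(m, n + p)) : z *m E = lsubmx z.
  by rewrite /E -[in LHS](hsubmxK 1%:M) -[z in RHS]mulmx1 -[in RHS](hsubmxK 1%:M) mul_mx_row !row_mxKl.
rewrite -(mxrank_mul_ker (kermx A) E).
have -> : (kermx A :&: kermx E)%MS = 0.
  apply/eqP; rewrite -submx0; apply/rV_subP => z.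
  rewrite sub_capmx => /andP[/sub_kermxP zA /sub_kermxP]; rewrite EE => zE.
  by rewrite (h0 z zA zE) sub0mx.
rewrite mxrank0 addn0 EE; apply: mxrankS; apply/row_subP => i; apply/sub_kermxP.
rewrite -EE row_mul EE; apply: hB; rewrite -row_mul mulmx_ker row0 //.
Qed.

End HermitianForms.

(** * Wirtinger derivatives *)

Section LinearDerivations.
Variables (T : Type) (K : fieldType) (D : set T) (S : (T -> K) -> Prop).
Hypothesis SC : fun_class D S.
Variables (d1 d2 : (T -> K) -> T -> K).

(** Common shape of the two Wirtinger operators, with [a = 1/2] and [b] equal to -i or i. *)
Definition lin_op (d1 d2 : (T -> K) -> T -> K) (a b : K) : (T -> K) -> T -> K :=
  fun f x => a * (d1 f x + b * d2 f x).

Lemma lin_leibniz a b : leibniz D S d1 -> leibniz D S d2 ->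
  leibniz D S (lin_op d1 d2 a b).
Proof.
move=> dd1 dd2; split.
- by move=> c x Dx; rewrite /lin_op (dn_cst dd1) // (dn_cst dd2) // mulr0 addr0 mulr0.
- by move=> f g x Sf Sg Dx; rewrite /lin_op (dnD dd1) // (dnD dd2) //; ring.
- by move=> f g x Sf Sg Dx; rewrite /lin_op (dnM dd1) // (dnM dd2) //; ring.
- move=> f g x Sf fg Dx; rewrite /lin_op (dn_eq dd1 Sf fg Dx).
  by rewrite (dn_eq dd2 Sf fg Dx).
Qed.

Hypotheses (dd1 : derivation D S d1) (dd2 : derivation D S d2).

Lemma lin_derivation a b : derivation D S (lin_op d1 d2 a b).
Proof.
split; first exact: (lin_leibniz _ _ dd1 dd2).
move=> f Sf; apply: (fcM SC); first exact: (fc_cst SC).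
apply: (fcD SC); first exact: (dn_class dd1).
by apply: (fcM SC); [exact: (fc_cst SC)|exact: (dn_class dd2)].
Qed.

Lemma dn_lin e a b f x : derivation D S e -> S f -> D x ->
  e (lin_op d1 d2 a b f) x = lin_op (fun g => e (d1 g)) (fun g => e (d2 g)) a b f x.
Proof.
move=> de Sf Dx; rewrite /lin_op.
have S1 := dn_class dd1 Sf; have S2 := dn_class dd2 Sf.
have Sb : S (fun x => b * d2 f x) by apply: (fcM SC) => //; exact: (fc_cst SC).
have Sab : S (fun x => d1 f x + b * d2 f x) by exact: (fcD SC).
rewrite (dnM de (fc_cst SC a) Sab Dx) (dn_cst de) // mul0r add0r.
rewrite (dnD de S1 Sb Dx) (dnM de (fc_cst SC b) S2 Dx) (dn_cst de) //.
by rewrite mul0r add0r.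
Qed.

Lemma lin_comm e a b f x : derivation D S e -> S f -> D x ->
  (forall g y, S g -> D y -> e (d1 g) y = d1 (e g) y) ->
  (forall g y, S g -> D y -> e (d2 g) y = d2 (e g) y) ->
  e (lin_op d1 d2 a b f) x = lin_op d1 d2 a b (e f) x.
Proof.
by move=> de Sf Dx c1 c2; rewrite dn_lin // /lin_op c1 // c2.
Qed.

End LinearDerivations.

Section Wirtinger.
Variables (R : realType) (n : nat).
Local Notation C := (cplx R).
Implicit Types (f g : 'rV[C]_n -> C) (v z : 'rV[C]_n) (D : set 'rV[C]_n).

Definition rderivable_on D f : Prop := forall z, D z -> forall v, rderivable f v z.

Lemma smooth_rderivable D f : smooth_on D f -> rderivable_on D f.
Proof. by move=> sf z Dz v; case: (sf [::] z Dz). Qed.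

Lemma rderivable_class D : open D -> fun_class D (rderivable_on D).
Proof.
move=> oD; split.
- by move=> a z _ v; exact: (is_rderive_rderivable (is_rderive_cst v z a)).
- move=> f g df dg z Dz v; apply: is_rderive_rderivable.
  exact: (is_rderiveD (is_rderive_rderive (df z Dz v)) (is_rderive_rderive (dg z Dz v))).
- move=> f g df dg z Dz v; apply: is_rderive_rderivable.
  exact: (is_rderiveM (is_rderive_rderive (df z Dz v)) (is_rderive_rderive (dg z Dz v))).
- move=> f df f0 z Dz v; apply: is_rderive_rderivable.
  exact: (is_rderiveV (f0 z Dz) (is_rderive_rderive (df z Dz v))).
- move=> f g df fg z Dz v; apply: is_rderive_rderivable.
  apply: (is_rderive_eq_on oD _ Dz (is_rderive_rderive (df z Dz v))) => y.
  by rewrite inE => /fg.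
Qed.

Lemma rderive_leibniz D v : open D -> leibniz D (rderivable_on D) (rderive v).
Proof.
move=> oD; split.
- by move=> a x _; apply: rderive_val; exact: is_rderive_cst.
- move=> f g x df dg Dx; apply: rderive_val.
  exact: (is_rderiveD (is_rderive_rderive (df x Dx v)) (is_rderive_rderive (dg x Dx v))).
- move=> f g x df dg Dx; apply: rderive_val.
  exact: (is_rderiveM (is_rderive_rderive (df x Dx v)) (is_rderive_rderive (dg x Dx v))).
- move=> f g x df fg Dx; apply/esym/rderive_val.
  apply: (is_rderive_eq_on oD _ Dx (is_rderive_rderive (df x Dx v))) => y.
  by rewrite inE => /fg.
Qed.

Lemma rderive_derivation D v : open D -> derivation D (smooth_on D) (rderive v).
Proof.
move=> oD; have L := rderive_leibniz v oD; split; last by move=> f; exact: smooth_rderive.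
split.
- exact: (dn_cst L).
- by move=> f g x sf sg; apply: (dnD L); exact: smooth_rderivable.
- by move=> f g x sf sg; apply: (dnM L); exact: smooth_rderivable.
- by move=> f g x sf; apply: (dn_eq L); exact: smooth_rderivable.
Qed.

(** The (1,0) derivative along an arbitrary vector, not only a coordinate one: under the projection
    to the base, the coordinate vectors of a flag chart go to coordinate vectors or to 0. *)
Definition dvec v : ('rV[C]_n -> C) -> 'rV[C]_n -> C :=
  lin_op (rderive v) (rderive ('i *: v)) 2^-1 (- 'i).
Definition dvecbar v : ('rV[C]_n -> C) -> 'rV[C]_n -> C :=
  lin_op (rderive v) (rderive ('i *: v)) 2^-1 'i.

Lemma dzE j f : dz j f = dvec (delta_mx 0 j) f.
Proof. by apply/funext => z; rewrite /dz /dvec /lin_op mulNr. Qed.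

Lemma dvec_leibniz D v : open D -> leibniz D (rderivable_on D) (dvec v).
Proof.
move=> oD; exact: (lin_leibniz _ _ (rderive_leibniz v oD) (rderive_leibniz ('i *: v) oD)).
Qed.

Lemma dvec_derivation D v : open D -> derivation D (smooth_on D) (dvec v).
Proof.
move=> oD; exact: (lin_derivation (smooth_class oD) (rderive_derivation v oD)
  (rderive_derivation ('i *: v) oD)).
Qed.

Lemma dvecbar_derivation D v : open D -> derivation D (smooth_on D) (dvecbar v).
Proof.
move=> oD; exact: (lin_derivation (smooth_class oD) (rderive_derivation v oD)
  (rderive_derivation ('i *: v) oD)).
Qed.

Lemma dz_derivation D j : open D -> derivation D (smooth_on D) (dz j).
Proof.
move=> oD; rewrite (_ : dz j = dvec (delta_mx 0 j)); first exact: dvec_derivation.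
by apply/funext => f; exact: dzE.
Qed.

Lemma dzbar_derivation D j : open D -> derivation D (smooth_on D) (dzbar j).
Proof. exact: dvecbar_derivation. Qed.

Lemma rderive_conj D f v z : smooth_on D f -> D z ->
  rderive v (fun x => (f x)^*) z = (rderive v f z)^*.
Proof.
move=> sf Dz; apply: rderive_val; apply: is_rderive_conj.
exact: (smooth_is_rderive v sf Dz).
Qed.

End Wirtinger.

Lemma wirtinger_conj_alg (K : numClosedFieldType) (a b : K) :
  2^-1 * (a^* + - 'i * b^*) = (2^-1 * (a + 'i * b))^*.
Proof.
by rewrite rmorphM rmorphD rmorphM /= conjCi fmorphV rmorph_nat.
Qed.

Lemma wirtinger_conj_alg2 (K : numClosedFieldType) (a b : K) :
  2^-1 * (a^* + 'i * b^*) = (2^-1 * (a + - 'i * b))^*.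
Proof.
by rewrite rmorphM rmorphD rmorphM rmorphN /= conjCi fmorphV rmorph_nat opprK.
Qed.

Lemma wirtinger_holo_alg (K : numClosedFieldType) (a : K) :
  2^-1 * (a + 'i * ('i * a)) = 0.
Proof. by rewrite mulrA -expr2 sqrCi mulN1r subrr mulr0. Qed.

Lemma wirtinger_holo_alg2 (K : numClosedFieldType) (a : K) :
  2^-1 * (a + - 'i * ('i * a)) = a.
Proof.
rewrite mulrA mulNr -expr2 sqrCi opprK mul1r -mulr2n -[a *+ 2]mulr_natr mulrC mulfK //.
Qed.

Section WirtingerRules.
Variables (R : realType) (n : nat).
Local Notation C := (cplx R).
Implicit Types (f g : 'rV[C]_n -> C) (v z : 'rV[C]_n) (D : set 'rV[C]_n).

Lemma dvec_conj D f v z : smooth_on D f -> D z ->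
  dvec v (fun x => (f x)^*) z = (dvecbar v f z)^*.
Proof.
move=> sf Dz; rewrite /dvec /dvecbar /lin_op (rderive_conj v sf Dz).
rewrite (rderive_conj ('i *: v) sf Dz); exact: wirtinger_conj_alg.
Qed.

Lemma dvecbar_conj D f v z : smooth_on D f -> D z ->
  dvecbar v (fun x => (f x)^*) z = (dvec v f z)^*.
Proof.
move=> sf Dz; rewrite /dvec /dvecbar /lin_op (rderive_conj v sf Dz).
rewrite (rderive_conj ('i *: v) sf Dz); exact: wirtinger_conj_alg2.
Qed.

Lemma dvecbar_holo f v z : differentiable f z -> dvecbar v f z = 0.
Proof.
move=> df; rewrite /dvecbar /lin_op (holo_rderiveZ v df).
exact: wirtinger_holo_alg.
Qed.

Lemma dvec_holo f v z : differentiable f z -> dvec v f z = rderive v f z.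
Proof.
move=> df; rewrite /dvec /lin_op (holo_rderiveZ v df).
exact: wirtinger_holo_alg2.
Qed.

Lemma dvec_conj_holo f v z : differentiable f z -> dvec v (fun x => (f x)^*) z = 0.
Proof.
move=> df; have d1 := is_rderive_conj (is_rderive_holo v df).
have d2 := is_rderive_conj (is_rderive_holo ('i *: v) df).
have e1 := rderive_val d1; have e2 := rderive_val d2.
rewrite linearZ in e2.
rewrite /dvec /lin_op e1 e2; apply: etrans (wirtinger_conj_alg _ _) _.
by apply: etrans (congr1 Num.conj (wirtinger_holo_alg _)) _; exact: rmorph0.
Qed.

Lemma rderive_comm D f u v z : open D -> smooth_on D f -> D z ->
  rderive u (rderive v f) z = rderive v (rderive u f) z.
Proof. by move=> oD sf Dz; exact: (schwarz v u oD sf Dz). Qed.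

Lemma dvecbar_rderive_comm D f u v z : open D -> smooth_on D f -> D z ->
  dvecbar u (rderive v f) z = rderive v (dvecbar u f) z.
Proof.
move=> oD sf Dz; apply/esym.
apply: (lin_comm (smooth_class oD) (rderive_derivation u oD)
  (rderive_derivation ('i *: u) oD) _ _ (rderive_derivation v oD) sf Dz).
  by move=> g y sg Dy; exact: (rderive_comm v u oD sg Dy).
by move=> g y sg Dy; exact: (rderive_comm v ('i *: u) oD sg Dy).
Qed.

Lemma dvecbar_dvec_comm D f u v z : open D -> smooth_on D f -> D z ->
  dvecbar u (dvec v f) z = dvec v (dvecbar u f) z.
Proof.
move=> oD sf Dz.
apply: (lin_comm (smooth_class oD) (rderive_derivation v oD)
  (rderive_derivation ('i *: v) oD) _ _ (dvecbar_derivation u oD) sf Dz).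
  by move=> g y sg Dy; exact: (dvecbar_rderive_comm u v oD sg Dy).
by move=> g y sg Dy; exact: (dvecbar_rderive_comm u ('i *: v) oD sg Dy).
Qed.

(** The derivative of a smooth holomorphic function is again holomorphic: by the symmetry of second
    derivatives the two operators commute, and the (0,1) one kills [f] on all of [D]. *)
Lemma dvecbar_dvec_holo D f u v z : open D -> smooth_on D f ->
  (forall x, D x -> differentiable f x) -> D z -> dvecbar u (dvec v f) z = 0.
Proof.
move=> oD sf hf Dz; rewrite (dvecbar_dvec_comm u v oD sf Dz).
have dv := dvec_derivation v oD.
have e0 y : D y -> dvecbar u f y = 0 by move=> Dy; exact: dvecbar_holo (hf y Dy).
rewrite (dn_eq dv (dn_class (dvecbar_derivation u oD) sf) e0 Dz).
exact: (dn_cst dv 0 Dz).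
Qed.

Lemma smooth_log D g : open D -> smooth_on D g ->
  (forall x, D x -> 0 < g x) ->
  smooth_on D (fun x => ((ln (complex.Re (g x)))%:C)%C) /\
  forall v z, D z -> rderive v (fun x => ((ln (complex.Re (g x)))%:C)%C) z =
    (g z)^-1 * rderive v g z.
Proof.
move=> oD sg g0.
have dg v z : D z -> is_rderive v z (fun x => ((ln (complex.Re (g x)))%:C)%C)
    ((g z)^-1 * rderive v g z).
  move=> Dz; have [g0z gE] := gt0_cplxE (g0 z Dz).
  have H := is_rderive_ln g0z (smooth_is_rderive v sg Dz).
  have gc x : D x -> (g x)^* = g x.
    by move=> Dx; apply: CrealP; apply: gtr0_real; exact: g0.
  (* [g] is real on [D], hence so is its derivative along a real line; the derivative formula for
     the real logarithm is then an identity between complex numbers. *)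
  have rc : (rderive v g z)^* = rderive v g z.
    rewrite -(rderive_conj v sg Dz).
    apply: (dn_eq (rderive_derivation v oD) (smooth_conj oD sg) gc Dz).
  rewrite (_ : (g z)^-1 * rderive v g z =
    (((complex.Re (g z))^-1 * complex.Re (rderive v g z))%:C)%C) //.
  have aux (x y : C) (a c : R) : x = (a%:C)%C -> y = (c%:C)%C ->
      x^-1 * y = ((a^-1 * c)%:C)%C.
    by move=> -> ->; rewrite rmorphM /= (fmorphV (real_complex R)).
  apply: aux; first exact: gE.
  move: rc; case: (rderive v g z) => a b [] /eqP.
  by rewrite -subr_eq0 -opprD oppr_eq0 -mulr2n mulrn_eq0 /= => /eqP ->.
have sV : smooth_on D (fun x => (g x)^-1).
  by apply: (fcV (smooth_class oD) sg) => x Dx; rewrite gt_eqF // g0.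
split; last by move=> v z Dz; exact: (rderive_val (dg v z Dz)).
apply/smooth_onP; have cl z : D z -> {for z, continuous (fun x => ((ln (complex.Re (g x)))%:C)%C : C)}.
  move=> Dz; have [g0z _] := gt0_cplxE (g0 z Dz).
  have c1 : {for z, continuous (fun x => complex.Re (g x))}.
    exact: (continuous_comp (smooth_continuous sg Dz) (@Re_continuous R _)).
  have c2 := continuous_comp c1 (continuous_ln g0z).
  exact: (continuous_comp c2 (@real_complex_continuous R _)).
case=> [|k]; first by split; [exact: cl|exact: I].
apply: (CkS_intro oD cl) => v; exists (fun x => (g x)^-1 * rderive v g x); split.
  by move=> z Dz; exact: dg.
by apply: (CkM oD); [exact: (smooth_onP _ _).1|exact: ((smooth_onP _ _).1 (smooth_rderive v sg))].
Qed.

Lemma dvecbar_log D g v z : open D -> smooth_on D g -> (forall x, D x -> 0 < g x) -> D z ->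
  dvecbar v (fun x => ((ln (complex.Re (g x)))%:C)%C) z = (g z)^-1 * dvecbar v g z.
Proof.
move=> oD sg g0 Dz; have [_ dl] := smooth_log oD sg g0.
rewrite /dvecbar /lin_op (dl v z Dz) (dl ('i *: v) z Dz).
move: (g z)^-1 (rderive _ g z) (rderive _ g z) => a b c.
by rewrite (mulrCA 'i) -mulrDr mulrCA.
Qed.

End WirtingerRules.

(** * Pullback of functions along the projection to the base coordinates *)

Lemma lsubmxDZ (K : pzRingType) m n p (x v : 'M[K]_(m, n + p)) (a : K) :
  lsubmx (x + a *: v) = lsubmx x + a *: lsubmx v.
Proof. by rewrite linearD linearZ. Qed.

Lemma lsubmxZ (K : pzRingType) m n p (v : 'M[K]_(m, n + p)) (a : K) :
  lsubmx (a *: v) = a *: lsubmx v.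
Proof. by rewrite linearZ. Qed.

Section Pullback.
Variables (R : realType) (n p : nat).
Local Notation C := (cplx R).

Lemma rderive_lsubmx (f : 'rV[C]_n -> C) (v : 'rV[C]_(n + p)) :
  rderive v (fun x => f (lsubmx x)) = fun x => rderive (lsubmx v) f (lsubmx x).
Proof.
apply/funext => x.
have re : line_re (fun x => f (lsubmx x)) v x = line_re f (lsubmx v) (lsubmx x).
  by apply/funext => t; rewrite /line_re lsubmxDZ.
have im : line_im (fun x => f (lsubmx x)) v x = line_im f (lsubmx v) (lsubmx x).
  by apply/funext => t; rewrite /line_im lsubmxDZ.
by rewrite /rderive re im.
Qed.

Lemma rderive0 (f : 'rV[C]_n -> C) : rderive 0 f = fun=> 0.
Proof.
apply/funext => x; apply: rderive_val; split.
  rewrite (_ : line_re f 0 x = cst (complex.Re (f x))); first exact: is_derive_cst.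
  by apply/funext => t; rewrite /line_re scaler0 addr0.
rewrite (_ : line_im f 0 x = cst (complex.Im (f x))); first exact: is_derive_cst.
by apply/funext => t; rewrite /line_im scaler0 addr0.
Qed.

Lemma smooth_lsubmx (D : set 'rV[C]_n) (f : 'rV[C]_n -> C) : smooth_on D f ->
  smooth_on [set x : 'rV[C]_(n + p) | D (lsubmx x)] (fun x => f (lsubmx x)).
Proof.
move=> sf vs.
have -> : foldr (@rderive R (n + p)) (fun x : 'rV[C]_(n + p) => f (lsubmx x)) vs =
    fun x => foldr (@rderive R n) f [seq lsubmx v | v <- vs] (lsubmx x).
  by elim: vs => //= v vs ->; exact: rderive_lsubmx.
move=> g z Dz; have [c d] := sf [seq lsubmx v | v <- vs] _ Dz; split.
  exact: (continuous_comp (@continuous_lsubmx _ 1 n p z) c).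
move=> v; have [d1 d2] := d (lsubmx v); split.
  rewrite (_ : line_re g v z = line_re (foldr (@rderive R n) f [seq lsubmx v | v <- vs]) (lsubmx v) (lsubmx z)) //.
  by apply/funext => t; rewrite /line_re /g lsubmxDZ.
rewrite (_ : line_im g v z = line_im (foldr (@rderive R n) f [seq lsubmx v | v <- vs]) (lsubmx v) (lsubmx z)) //.
by apply/funext => t; rewrite /line_im /g lsubmxDZ.
Qed.

Lemma dvec_lsubmx (f : 'rV[C]_n -> C) (v : 'rV[C]_(n + p)) :
  dvec v (fun x => f (lsubmx x)) = fun x => dvec (lsubmx v) f (lsubmx x).
Proof.
by apply/funext => x; rewrite /dvec /lin_op !rderive_lsubmx lsubmxZ.
Qed.

Lemma dvecbar_lsubmx (f : 'rV[C]_n -> C) (v : 'rV[C]_(n + p)) :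
  dvecbar v (fun x => f (lsubmx x)) = fun x => dvecbar (lsubmx v) f (lsubmx x).
Proof.
by apply/funext => x; rewrite /dvecbar /lin_op !rderive_lsubmx lsubmxZ.
Qed.

End Pullback.

(** Specialises the formal identity to the hermitian case: when Ph is the adjoint of Th and the
    (0,1) derivatives are adjoint to the (1,0) ones, the factor Z' becomes the adjoint of a factor
    of the same form as Z. *)
Lemma adjoint_second_form (K : numClosedFieldType) r s (k dHb dHv Q Rm : 'M[K]_r)
    (Th dTh Z : 'M[K]_(r, s)) (dPh : 'M[K]_(s, r)) (Wi : 'M[K]_s) :
  (k ^t* = k)%sesqui -> (dHb = dHv ^t*)%sesqui -> (dPh = dTh ^t*)%sesqui ->
  \tr (Wi *m ((Th ^t*)%sesqui *m k *m Rm *m (k *m Th))) +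
    \tr (Wi *m (((Th ^t*)%sesqui *m (- (k *m dHb *m k)) + dPh *m k) *m Q *m Z)) =
  \tr (Wi *m (((k *m Th) ^t*)%sesqui *m Rm *m (k *m Th))) +
    \tr (Wi *m (((- (k *m dHv *m k) *m Th + k *m dTh) ^t*)%sesqui *m Q *m Z)).
Proof.
move=> hk -> ->; rewrite adjD !adjM hk.
rewrite (_ : ((- (k *m dHv *m k)) ^t* = - (k *m (dHv ^t*) *m k))%sesqui) //.
by rewrite -scaleN1r adjZ !adjM hk rmorphN rmorph1 scaleN1r !mulmxA.
Qed.

(** * The Levi form of log det of a dual Gram matrix *)

Section LeviForm.
Variables (R : realType) (N : nat).
Local Notation C := (cplx R).
Local Open Scope sesquilinear_scope.
Implicit Types (z v u : 'rV[C]_N) (D : set 'rV[C]_N).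

Lemma dmx_conj D p q (A : 'rV[C]_N -> 'M[C]_(p, q)) v z : mx_class (smooth_on D) A -> D z ->
  dmx (dvecbar v) (fun y => (A y) ^t*) z = (dmx (dvec v) A z) ^t*.
Proof.
move=> sA Dz; apply/matrixP => a b; rewrite adjE [in LHS]mxE [in RHS]mxE.
rewrite -(dvecbar_conj v (sA b a) Dz); congr (dvecbar v _ z).
by apply/funext => y; rewrite adjE.
Qed.

Lemma dmx_conj2 D p q (A : 'rV[C]_N -> 'M[C]_(p, q)) v z : mx_class (smooth_on D) A -> D z ->
  dmx (dvec v) (fun y => (A y) ^t*) z = (dmx (dvecbar v) A z) ^t*.
Proof.
move=> sA Dz; apply/matrixP => a b; rewrite adjE [in LHS]mxE [in RHS]mxE.
rewrite -(dvec_conj v (sA b a) Dz); congr (dvec v _ z).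
by apply/funext => y; rewrite adjE.
Qed.

Lemma smooth_mx_adj D p q (A : 'rV[C]_N -> 'M[C]_(p, q)) : open D -> mx_class (smooth_on D) A ->
  mx_class (smooth_on D) (fun y => (A y) ^t*).
Proof.
move=> oD sA a b; rewrite (_ : (fun y => _) = (fun y => (A y b a)^*)).
  exact: smooth_conj oD (sA b a).
by apply/funext => y; rewrite adjE.
Qed.

Variables (D : set 'rV[C]_N) (r s : nat).
Variables (H : 'rV[C]_N -> 'M[C]_r) (Th : 'rV[C]_N -> 'M[C]_(r, s)) (L : 'rV[C]_N -> 'M[C]_(s, r)).
Hypotheses (oD : open D) (sH : mx_class (smooth_on D) H) (sTh : mx_class (smooth_on D) Th).
Hypothesis (pH : forall z, D z -> posdef (H z)).
Hypothesis (hTh : forall z a b, D z -> differentiable (fun y => Th y a b) z).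
Hypothesis (LTh : forall z, D z -> L z *m Th z = 1%:M).

(** The dual metric has matrix H^-1 on linear forms written as columns, so this is the Gram matrix
    of the forms given by the columns of [Th]. The left inverse [L] says that these forms are
    independent. *)
Definition dual_gram z : 'M[C]_s := (Th z) ^t* *m invmx (H z) *m Th z.

Lemma dual_gram_posdef z : D z -> posdef (dual_gram z).
Proof. by move=> Dz; apply: posdef_congr (LTh Dz); exact: posdef_inv (pH Dz). Qed.

Lemma dual_gram_smooth : mx_class (smooth_on D) dual_gram.
Proof.
have SC := smooth_class oD.
apply: (mx_classM SC) sTh; apply: (mx_classM SC); first exact: smooth_mx_adj.
by apply: (mx_class_inv SC sH) => z Dz; exact: posdef_unit (pH Dz).
Qed.

Lemma det_dual_gram_gt0 z : D z -> 0 < \det (dual_gram z).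
Proof. by move=> Dz; exact: posdef_det_gt0 (dual_gram_posdef Dz). Qed.

Definition log_dual z : C := ((ln (complex.Re (\det (dual_gram z))))%:C)%C.

Lemma log_dual_smooth : smooth_on D log_dual.
Proof.
exact: (smooth_log oD (fc_det (smooth_class oD) dual_gram_smooth) det_dual_gram_gt0).1.
Qed.

Definition base_curv u v z : 'M[C]_r :=
  - dmx (dvec u) (dmx (dvecbar v) H) z +
    dmx (dvec u) H z *m invmx (H z) *m dmx (dvecbar v) H z.

(** The derivative of H^-1 Th. Only its class modulo the columns of H^-1 Th matters in the Levi
    form, and that class is a second fundamental form. *)
Definition second_form u z : 'M[C]_(r, s) :=
  - (invmx (H z) *m dmx (dvec u) H z *m invmx (H z)) *m Th z
    + invmx (H z) *m dmx (dvec u) Th z.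

Lemma levi_log_dual u v z : D z ->
  dvec u (dvecbar v log_dual) z =
    \tr (invmx (dual_gram z) *m ((invmx (H z) *m Th z) ^t* *m base_curv u v z
        *m (invmx (H z) *m Th z))) +
    \tr (invmx (dual_gram z) *m ((second_form v z) ^t* *m
        (H z - Th z *m invmx (dual_gram z) *m (Th z) ^t*) *m second_form u z)).
Proof.
move=> Dz; have SC := smooth_class oD.
have du := dvec_derivation u oD; have dv := dvecbar_derivation v oD.
have sPh := smooth_mx_adj oD sTh.
have dTh w x : D x -> dmx (dvecbar w) Th x = 0.
  move=> Dx; apply/matrixP => a b; rewrite [in LHS]mxE [in RHS]mxE.
  exact: dvecbar_holo (hTh a b Dx).
have dPh x : D x -> dmx (dvec u) (fun y => (Th y) ^t*) x = 0.
  by move=> Dx; rewrite (dmx_conj2 u sTh Dx) dTh // trmx0 map_mx0.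
have sdTh : mx_class (smooth_on D) (dmx (dvec v) Th).
  exact: (dmx_class SC (dvec_derivation v oD) sTh).
have dPhE x : D x -> dmx (dvecbar v) (fun y => (Th y) ^t*) x = (dmx (dvec v) Th x) ^t*.
  by move=> Dx; exact: (dmx_conj v sTh Dx).
(* By conjugation this reduces to the vanishing of the (0,1) derivative of the (1,0) derivative of
   the holomorphic matrix [Th]. *)
have ddPh : dmx (dvec u) (dmx (dvecbar v) (fun y => (Th y) ^t*)) z = 0.
  rewrite (dmx_eq du (dmx_class SC dv sPh) dPhE Dz) (dmx_conj2 u sdTh Dz).
  rewrite (_ : dmx (dvecbar u) _ z = 0) ?trmx0 ?map_mx0 //.
  apply/matrixP => a b; rewrite [in LHS]mxE [in RHS]mxE.
  have sab : smooth_on D (fun y => Th y a b) := sTh a b.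
  rewrite -(dvecbar_dvec_holo u v oD sab (fun x Dx => hTh a b Dx) Dz).
  by congr (dvecbar u _ z); apply/funext => y; rewrite mxE.
have uH x (Dx : D x) := posdef_unit (pH Dx).
have uW x (Dx : D x) := posdef_unit (dual_gram_posdef Dx).
have lE y : D y -> dvecbar v log_dual y =
    (\det (dual_gram y))^-1 * dvecbar v (fun y => \det (dual_gram y)) y.
  move=> Dy; exact: (dvecbar_log v oD (fc_det SC dual_gram_smooth) det_dual_gram_gt0 Dy).
have := levi_log_det SC du dv sH sTh sPh uH uW (fun x Dx => dTh v x Dx) dPh Dz ddPh
  (dn_class dv log_dual_smooth) lE.
move=> /= ->.
have hk : (invmx (H z)) ^t* = invmx (H z) by rewrite adj_inv (pH Dz).1.
have dHE : dmx (dvecbar v) H z = (dmx (dvec v) H z) ^t*.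
  rewrite -(dmx_conj v sH Dz); apply: (dmx_eq dv sH _ Dz) => y Dy.
  by rewrite (pH Dy).1.
exact: (adjoint_second_form (H z - Th z *m invmx (dual_gram z) *m (Th z) ^t*) (base_curv u v z) (Th z) (second_form u z) (invmx (dual_gram z)) hk dHE (dPhE z Dz)).
Qed.

End LeviForm.

(** * Positivity of the Levi form *)

(** Undoing the factors one at a time, by [H], [L] and [U], leaves a basis vector. *)
Lemma frame_column_neq0 (K : fieldType) r s (H k : 'M[K]_r) (Th : 'M[K]_(r, s))
    (L : 'M[K]_(s, r)) (U V : 'M[K]_s) (i : 'I_s) :
  H *m k = 1%:M -> L *m Th = 1%:M -> U *m V = 1%:M ->
  k *m Th *m (V *m delta_mx i (0 : 'I_1)) != 0.
Proof.
move=> Hk LT UV; apply/negP => /eqP cE.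
have : U *m (L *m (H *m (k *m Th *m (V *m delta_mx i (0 : 'I_1))))) = delta_mx i 0.
  by rewrite -!mulmxA (mulmxA H) Hk mul1mx (mulmxA L) LT mul1mx mulmxA UV mul1mx.
rewrite cE !mulmx0 => /matrixP/(_ i 0); rewrite !mxE !eqxx => /eqP.
by rewrite eq_sym oner_eq0.
Qed.

Lemma curv_expr_eq (K : pzRingType) r (X X' Y Y' Z Z' k : 'M[K]_r) :
  X = X' -> Y = Y' -> Z = Z' -> - X + Y *m k *m Z = - X' + Y' *m k *m Z'.
Proof. by move=> -> -> ->. Qed.

Lemma curv_expr0l (K : pzRingType) r (X Y Z k : 'M[K]_r) :
  X = 0 -> Y = 0 -> - X + Y *m k *m Z = 0.
Proof. by move=> -> ->; rewrite !mul0mx oppr0 addr0. Qed.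

Lemma curv_expr0r (K : pzRingType) r (X Y Z k : 'M[K]_r) :
  X = 0 -> Z = 0 -> - X + Y *m k *m Z = 0.
Proof. by move=> -> ->; rewrite mulmx0 oppr0 addr0. Qed.

Section LocalPositivity.
Variables (R : realType) (n p r : nat).
Local Notation C := (cplx R).
Local Notation N := (n + p)%N.
Local Open Scope sesquilinear_scope.
Variables (D : set 'rV[C]_N) (B : set 'rV[C]_n) (G : 'rV[C]_n -> 'M[C]_r).
Variables (J : finType) (P : pred J) (s : J -> nat).
Variables (Th : forall j, 'rV[C]_N -> 'M[C]_(r, s j)) (L : forall j, 'rV[C]_N -> 'M[C]_(s j, r)).
Hypotheses (oD : open D) (DB : forall x, D x -> B (lsubmx x)).
Hypotheses (sG : mx_class (smooth_on B) G) (pG : forall z, B z -> posdef (G z)).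
Hypothesis sTh : forall j, mx_class (smooth_on D) (Th j).
Hypothesis hTh : forall j z a b, D z -> differentiable (fun y => Th j y a b) z.
Hypothesis LTh : forall j z, D z -> L j z *m Th j z = 1%:M.

Let H (x : 'rV[C]_N) : 'M[C]_r := G (lsubmx x).

Lemma pullback_smooth : mx_class (smooth_on D) H.
Proof.
by move=> a b; apply: smooth_subset (@smooth_lsubmx R n p B (fun y => G y a b) (sG a b)) => x /DB.
Qed.

Let pH x : D x -> posdef (H x).
Proof. by move=> /DB; exact: pG. Qed.

Definition log_dual_sum (x : 'rV[C]_N) : C := \sum_(j | P j) log_dual H (Th j) x.

Lemma log_dual_sum_smooth : smooth_on D log_dual_sum.
Proof.
apply: (fc_sum (smooth_class oD)) => j.
exact (log_dual_smooth oD pullback_smooth (@sTh j) pH (fun z Dz => LTh j Dz)).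
Qed.

Definition levi_matrix x : 'M[C]_N := \matrix_(a, b) dz a (dzbar b log_dual_sum) x.

Definition chart_curv z (a b : 'I_n) : 'M[C]_r :=
  - dmx (dz a) (dmx (dzbar b) G) z + dmx (dz a) G z *m invmx (G z) *m dmx (dzbar b) G z.

Definition curv_along z (xi : 'rV[C]_n) : 'M[C]_r :=
  \sum_a \sum_b (xi 0 a * (xi 0 b)^*) *: chart_curv z a b.

Lemma delta_lshift (a : 'I_n) : lsubmx (delta_mx 0 (lshift p a) : 'rV[C]_N) = delta_mx 0 a.
Proof. by apply/matrixP => i j; rewrite !mxE eq_lshift. Qed.

Lemma delta_rshift (a : 'I_p) : lsubmx (delta_mx 0 (rshift n a) : 'rV[C]_N) = 0.
Proof. by apply/matrixP => i j; rewrite !mxE eq_lrshift andbF. Qed.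

Lemma dmx_lsubmx_dvec q t (A : 'rV[C]_n -> 'M[C]_(q, t)) (v : 'rV[C]_N) x :
  dmx (dvec v) (fun y => A (lsubmx y)) x = dmx (dvec (lsubmx v)) A (lsubmx x).
Proof.
apply/matrixP => a b; rewrite [in LHS]mxE [in RHS]mxE.
exact: (congr1 (@^~ x) (dvec_lsubmx (fun y => A y a b) v)).
Qed.

Lemma dmx_lsubmx_dvecbar q t (A : 'rV[C]_n -> 'M[C]_(q, t)) (v : 'rV[C]_N) x :
  dmx (dvecbar v) (fun y => A (lsubmx y)) x = dmx (dvecbar (lsubmx v)) A (lsubmx x).
Proof.
apply/matrixP => a b; rewrite [in LHS]mxE [in RHS]mxE.
exact: (congr1 (@^~ x) (dvecbar_lsubmx (fun y => A y a b) v)).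
Qed.

Lemma dvec0 (f : 'rV[C]_n -> C) : dvec 0 f = fun=> 0.
Proof.
by apply/funext => x; rewrite /dvec /lin_op scaler0 rderive0 mulr0 addr0 mulr0.
Qed.

Lemma dvecbar0 (f : 'rV[C]_n -> C) : dvecbar 0 f = fun=> 0.
Proof.
by apply/funext => x; rewrite /dvecbar /lin_op scaler0 rderive0 mulr0 addr0 mulr0.
Qed.

Lemma dmx_dvec0 q t (A : 'rV[C]_n -> 'M[C]_(q, t)) x : dmx (dvec 0) A x = 0.
Proof. by apply/matrixP => a b; rewrite [in LHS]mxE [in RHS]mxE dvec0. Qed.

Lemma dmx_dvecbar0 q t (A : 'rV[C]_n -> 'M[C]_(q, t)) x : dmx (dvecbar 0) A x = 0.
Proof. by apply/matrixP => a b; rewrite [in LHS]mxE [in RHS]mxE dvecbar0. Qed.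

Lemma base_curv_lsubmx (u v : 'rV[C]_N) x : base_curv H u v x =
  base_curv G (lsubmx u) (lsubmx v) (lsubmx x).
Proof.
have e1 : dmx (dvec u) H x = dmx (dvec (lsubmx u)) G (lsubmx x).
  exact: dmx_lsubmx_dvec.
have e2 y : dmx (dvecbar v) H y = dmx (dvecbar (lsubmx v)) G (lsubmx y).
  exact: dmx_lsubmx_dvecbar.
have e3 : dmx (dvecbar v) H = fun y => dmx (dvecbar (lsubmx v)) G (lsubmx y).
  by apply/funext => y; exact: e2.
have e4 : dmx (dvec u) (dmx (dvecbar v) H) x =
    dmx (dvec (lsubmx u)) (dmx (dvecbar (lsubmx v)) G) (lsubmx x).
  exact: (etrans (congr1 (fun A => dmx (dvec u) A x) e3)
    (dmx_lsubmx_dvec (dmx (dvecbar (lsubmx v)) G) u x)).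
exact: curv_expr_eq e4 e1 (e2 x).
Qed.

Lemma base_curv0l v z : base_curv G 0 v z = 0.
Proof. exact: (curv_expr0l _ _ (dmx_dvec0 _ _) (dmx_dvec0 _ _)). Qed.

Lemma base_curv0r u z : B z -> open B -> base_curv G u 0 z = 0.
Proof.
move=> Bz oB; have e0 : dmx (dvecbar 0) G = fun=> 0.
  by apply/funext => y; exact: dmx_dvecbar0.
apply: curv_expr0r; last exact: dmx_dvecbar0.
exact: (etrans (congr1 (fun A => dmx (dvec u) A z) e0) (dmx_cst (dvec_derivation u oB) 0 Bz)).
Qed.

Lemma chart_curvE z a b : chart_curv z a b = base_curv G (delta_mx 0 a) (delta_mx 0 b) z.
Proof.
have da : @dz R n a = @dvec R n (delta_mx 0 a) by apply: funext => f; exact: dzE.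
apply: curv_expr_eq => //.
  exact: (congr1 (fun d => dmx d (dmx (dzbar b) G) z) da).
exact: (congr1 (fun d => dmx d G z) da).
Qed.

(** The metric is pulled back from the base, so a curvature coefficient with a fibre coordinate
    vector in either slot vanishes. *)
Lemma curv_along_lsubmx (ze : 'rV[C]_N) x : open B -> D x ->
  \sum_j \sum_k (ze 0 j * (ze 0 k)^*) *: base_curv H (delta_mx 0 j) (delta_mx 0 k) x =
  curv_along (lsubmx x) (lsubmx ze).
Proof.
move=> oB Dx; rewrite big_split_ord /= [X in _ + X]big1 ?addr0; last first.
  move=> j _; apply: big1 => k _; rewrite base_curv_lsubmx delta_rshift base_curv0l.
  exact: scaler0.
apply: eq_bigr => a _; rewrite big_split_ord /= [X in _ + X]big1 ?addr0; last first.
  move=> k _; rewrite base_curv_lsubmx delta_rshift (base_curv0r _ (DB Dx) oB).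
  exact: scaler0.
apply: eq_bigr => b _; rewrite base_curv_lsubmx !delta_lshift chart_curvE.
by rewrite [lsubmx ze 0 a]mxE [lsubmx ze 0 b]mxE.
Qed.

Lemma levi_matrixE x a b : D x -> levi_matrix x a b =
  \sum_(j | P j) dvec (delta_mx 0 a) (dvecbar (delta_mx 0 b) (log_dual H (Th j))) x.
Proof.
move=> Dx; have SC := smooth_class oD.
have sl j : smooth_on D (log_dual H (Th j)).
  exact (log_dual_smooth oD pullback_smooth (@sTh j) pH (fun z Dz => LTh j Dz)).
have db := dvecbar_derivation (delta_mx 0 b) oD.
have da := dvec_derivation (delta_mx 0 a) oD.
have e1 y : D y -> dvecbar (delta_mx 0 b) log_dual_sum y =
    \sum_(j | P j) dvecbar (delta_mx 0 b) (log_dual H (Th j)) y.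
  move=> Dy; exact: (dn_sum SC db _ _ sl Dy).
have s1 := log_dual_sum_smooth.
have e0 : dz a (dzbar b log_dual_sum) x =
    dvec (delta_mx 0 a) (dvecbar (delta_mx 0 b) log_dual_sum) x.
  exact: (congr1 (@^~ x) (dzE a _)).
apply: etrans (mxE _ _ _ _) _; apply: (etrans e0).
apply: (etrans (dn_eq da (dn_class db s1) e1 Dx)).
exact: (dn_sum SC da _ _ (fun j => dn_class db (sl j)) Dx).
Qed.

Definition theta_along j x (ze : 'rV[C]_N) : 'M[C]_(r, s j) :=
  \sum_k ze 0 k *: second_form H (Th j) (delta_mx 0 k) x.

Lemma herm_levi x (ze : 'rV[C]_N) : open B -> D x ->
  (ze *m levi_matrix x *m ze ^t*) 0 0 = \sum_(j | P j)
    (\tr (invmx (dual_gram H (Th j) x) *m ((invmx (H x) *m Th j x) ^t* *m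
        curv_along (lsubmx x) (lsubmx ze) *m (invmx (H x) *m Th j x))) +
     \tr (invmx (dual_gram H (Th j) x) *m ((theta_along j x ze) ^t* *m
        (H x - Th j x *m invmx (dual_gram H (Th j) x) *m (Th j x) ^t*) *m
        theta_along j x ze))).
Proof.
move=> oB Dx; rewrite herm_mxE.
transitivity (\sum_(j | P j) \sum_a \sum_b
    dvec (delta_mx 0 a) (dvecbar (delta_mx 0 b) (log_dual H (Th j))) x * ze 0 a * (ze 0 b)^*).
  rewrite [RHS]exchange_big /=; apply: eq_bigr => a _.
  rewrite [RHS]exchange_big /=; apply: eq_bigr => b _.
  rewrite (levi_matrixE a b Dx).
  by rewrite -mulrA mulr_suml; apply: eq_bigr => j _; rewrite mulrA.
apply: eq_bigr => j _; rewrite -(curv_along_lsubmx ze oB Dx).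
rewrite -[RHS]hermitian_sum.
apply: eq_bigr => a _; apply: eq_bigr => b _; congr (_ * _ * _).
exact: (levi_log_dual oD pullback_smooth (@sTh j) pH (@hTh j) (fun z Dz => LTh j Dz)).
Qed.

Definition curv_tan z (v : 'rV[C]_r) : 'M[C]_n :=
  \matrix_(a, b) \sum_al \sum_be chart_curv z a b al be * v 0 al * (v 0 be)^*.

(** The number i Theta(xi (x) v, xi (x) v), with v the adjoint of the column c: a form in v on the
    left, a form in xi on the right. The traces in the Levi form involve the first reading, the
    positivity hypothesis [pR] the second. *)
Lemma qform_curv_along z xi c :
  qform (curv_along z xi) c = (xi *m curv_tan z (c ^t*) *m xi ^t*) 0 0.
Proof.
rewrite herm_mxE; apply: etrans (qform_sum _ _ _) _.
by apply: eq_bigr => a _; apply: eq_bigr => b _; rewrite [curv_tan _ _ a b]mxE.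
Qed.

Variable x : 'rV[C]_N.
Hypotheses (oB : open B) (Dx : D x).
Hypothesis pR : forall v : 'rV[C]_r, v != 0 ->
  forall u : 'rV[C]_n, 0 <= (u *m curv_tan (lsubmx x) v *m u ^t*) 0 0.

Lemma curv_along_ge0 xi c : 0 <= qform (curv_along (lsubmx x) xi) c.
Proof.
have [->|c0] := eqVneq c 0; first by rewrite qform0.
by rewrite qform_curv_along; apply: pR; rewrite adj_eq0.
Qed.

Let W j := dual_gram H (Th j) x.

Let pW j : posdef (W j).
Proof. exact: (dual_gram_posdef pH (fun z Dz => LTh j Dz) Dx). Qed.

Lemma levi_terms_ge0 j (ze : 'rV[C]_N) :
  0 <= \tr (invmx (W j) *m ((invmx (H x) *m Th j x) ^t* *m
        curv_along (lsubmx x) (lsubmx ze) *m (invmx (H x) *m Th j x))) /\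
  0 <= \tr (invmx (W j) *m ((theta_along j x ze) ^t* *m
        (H x - Th j x *m invmx (W j) *m (Th j x) ^t*) *m theta_along j x ze)).
Proof.
split; first exact: (trace_qform_ge0 _ (posdef_inv (pW j)) (curv_along_ge0 _)).
have E := projection_identity (theta_along j x ze) (pH Dx) (pW j).
rewrite [X in _ *m X]E.
exact: (trace_qform_ge0 _ (posdef_inv (pW j)) (fun c => posdef_ge0 c (pH Dx))).
Qed.

Lemma levi_ge0 (ze : 'rV[C]_N) : 0 <= (ze *m levi_matrix x *m ze ^t*) 0 0.
Proof.
rewrite (herm_levi ze oB Dx); apply: sumr_ge0 => j _.
by have [h1 h2] := levi_terms_ge0 j ze; exact: addr_ge0 h1 h2.
Qed.

Lemma levi_eq0 (ze : 'rV[C]_N) j : (ze *m levi_matrix x *m ze ^t*) 0 0 = 0 -> P j ->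
  \tr (invmx (W j) *m ((invmx (H x) *m Th j x) ^t* *m
        curv_along (lsubmx x) (lsubmx ze) *m (invmx (H x) *m Th j x))) = 0 /\
  \tr (invmx (W j) *m ((theta_along j x ze) ^t* *m
        (H x - Th j x *m invmx (W j) *m (Th j x) ^t*) *m theta_along j x ze)) = 0.
Proof.
rewrite (herm_levi ze oB Dx) => h0 Pj.
have nn i : P i -> 0 <= _ + _ :=
  fun _ => addr_ge0 (levi_terms_ge0 i ze).1 (levi_terms_ge0 i ze).2.
have /eqP := psumr_eq0P nn h0 Pj.
have [h1 h2] := levi_terms_ge0 j ze.
by rewrite (paddr_eq0 h1 h2) => /andP[/eqP -> /eqP ->].
Qed.

(** [v] is chosen before [ze]: the eigenbasis that splits the trace into nonnegative terms belongs
    to W_j^-1 at the point [x] and does not involve the tangent vector. *)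
Lemma levi_eq0_base j : P j -> (0 < s j)%N -> exists2 v : 'rV[C]_r, v != 0 &
  forall ze : 'rV[C]_N, (ze *m levi_matrix x *m ze ^t*) 0 0 = 0 ->
    lsubmx ze *m curv_tan (lsubmx x) v = 0.
Proof.
move=> Pj sj.
have [U [d [UU d0 tE]]] := trace_qform (posdef_inv (pW j)).
pose i0 : 'I_(s j) := Ordinal sj.
(* The image under H^-1 Th_j of an eigenvector of W_j^-1; its coefficient in the trace is positive,
   so the curvature form must vanish there. Any index would do, and index 0 exists because
   [s j > 0]. *)
pose c := (invmx (H x) *m Th j x) *m (U ^t* *m delta_mx i0 (0 : 'I_1)).
have c0 : c != 0.
  exact: (frame_column_neq0 i0 (mulmxV (posdef_unit (pH Dx))) (LTh j Dx) UU).
exists (c ^t*); first by rewrite adj_eq0.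
move=> ze h0; apply: psd_kernel; first by apply: pR; rewrite adj_eq0.
rewrite -qform_curv_along.
have [h1 _] := levi_eq0 h0 Pj.
have nn i : true -> 0 <= d i * qform (curv_along (lsubmx x) (lsubmx ze))
    (invmx (H x) *m Th j x *m (U ^t* *m delta_mx i 0)).
  by move=> _; exact: mulr_ge0 (ltW (d0 i)) (curv_along_ge0 _ _).
move: h1; rewrite tE => h1.
have /eqP := @psumr_eq0P _ _ _ _ nn h1 i0 isT.
by rewrite mulf_eq0 (gt_eqF (d0 i0)) => /eqP.
Qed.

(** Along a vertical vector H is constant, so Z = H^-1 dTh. A null vector makes the orthogonal part
    of Z vanish, and multiplication by H then puts dTh in the column span of Th. *)
Lemma levi_eq0_fibre (ze : 'rV[C]_N) j : P j ->
  (ze *m levi_matrix x *m ze ^t*) 0 0 = 0 -> lsubmx ze = 0 ->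
  exists Bm : 'M[C]_(s j), \sum_k ze 0 k *: dmx (dvec (delta_mx 0 k)) (Th j) x = Th j x *m Bm.
Proof.
move=> Pj h0 ze0; have [_] := levi_eq0 h0 Pj.
have E := projection_identity (theta_along j x ze) (pH Dx) (pW j).
rewrite [X in _ *m X]E => /(trace_posdef_eq0 (posdef_inv (pW j)) (pH Dx)) /eqP.
rewrite subr_eq0 => /eqP {}E.
have uH := posdef_unit (pH Dx).
have ZE : theta_along j x ze = invmx (H x) *m \sum_k ze 0 k *: dmx (dvec (delta_mx 0 k)) (Th j) x.
  rewrite mulmx_sumr; apply: eq_bigr => k _; rewrite -scalemxAr.
  case: (split_ordP k) => a ->.
    have -> : ze 0 (lshift p a) = 0 by have /matrixP/(_ 0 a) := ze0; rewrite !mxE.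
    exact: etrans (scale0r _) (esym (scale0r _)).
  have e0 : dmx (dvec (delta_mx 0 (rshift n a))) H x = 0.
    apply: etrans (dmx_lsubmx_dvec G _ x) _; rewrite delta_rshift; exact: dmx_dvec0.
  congr (_ *: _); rewrite /second_form e0 mulmx0 mul0mx oppr0 mul0mx.
  exact: add0r.
exists (invmx (W j) *m (Th j x) ^t* *m theta_along j x ze).
have := congr1 (mulmx (H x)) E; rewrite {1}ZE !mulmxA mulmxV // !mul1mx => ->.
by [].
Qed.

Lemma levi_kernel j k : P j -> (0 < s j)%N ->
  (forall v : 'rV[C]_r, v != 0 -> (\rank (kermx (curv_tan (lsubmx x) v)) <= k)%N) ->
  (forall ze : 'rV[C]_N, lsubmx ze = 0 -> (forall j, P j ->
     exists Bm : 'M[C]_(s j),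
       \sum_k ze 0 k *: dmx (dvec (delta_mx 0 k)) (Th j) x = Th j x *m Bm) -> ze = 0) ->
  (\rank (kermx (levi_matrix x)) <= k)%N.
Proof.
move=> Pj sj kR vert; have [v v0 hv] := levi_eq0_base Pj sj.
have q0 (ze : 'rV[C]_N) : ze *m levi_matrix x = 0 -> (ze *m levi_matrix x *m ze ^t*) 0 0 = 0.
  by move=> ->; rewrite mul0mx mxE.
apply: leq_trans (kR v v0); apply: rank_ker_lsubmx => ze /q0 h0; first exact: hv.
by move=> ze0; apply: (vert ze ze0) => i Pi; exact: levi_eq0_fibre.
Qed.

End LocalPositivity.

(** * Linear algebra of flags *)

Section Hat.
Variables (K : fieldType) (r : nat).
Implicit Types (g N : 'M[K]_r) (q : nat).

(* If the rows of g are a frame and the rows b >= q of N span a subspace V, then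
   [theta] gives the functionals vanishing on V that are dual, modulo V, to the
   first q rows of g. *)
Definition hat q g N : 'M[K]_r := pid_mx q *m g + copid_mx q *m N.
Definition theta q g N : 'M[K]_(r, q) := invmx (hat q g N) *m pid_mx q.

Lemma pid_hat q g N : (q <= r)%N ->
  (pid_mx q : 'M[K]_(q, r)) *m hat q g N = pid_mx q *m g.
Proof.
move=> qr; rewrite /hat mulmxDr !mulmxA pid_mx_id // mulmxBr mulmx1 pid_mx_id //.
by rewrite subrr mul0mx addr0.
Qed.

Lemma pid_mx_sq q : (q <= r)%N -> (pid_mx q : 'M[K]_r) *m (pid_mx q : 'M[K]_r) = pid_mx q.
Proof. by move=> qr; rewrite pid_mx_id. Qed.

Lemma copid_mx_sq q : (q <= r)%N -> (copid_mx q : 'M[K]_r) *m (copid_mx q : 'M[K]_r) = copid_mx q.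
Proof. by move=> qr; rewrite copid_mx_id. Qed.

Lemma pid_copid q : (q <= r)%N -> (pid_mx q : 'M[K]_r) *m (copid_mx q : 'M[K]_r) = 0.
Proof. by move=> qr; rewrite mul_pid_mx_copid. Qed.

Lemma copid_pid q : (q <= r)%N -> (copid_mx q : 'M[K]_r) *m (pid_mx q : 'M[K]_r) = 0.
Proof. by move=> qr; rewrite mul_copid_mx_pid. Qed.

Lemma pid_sq_hat q g N : (q <= r)%N -> (pid_mx q : 'M[K]_r) *m hat q g N = pid_mx q *m g.
Proof.
by move=> qr; rewrite /hat mulmxDr !mulmxA pid_mx_sq // pid_copid // mul0mx addr0.
Qed.

Lemma copid_hat q g N : (q <= r)%N -> copid_mx q *m hat q g N = copid_mx q *m N.
Proof.
by move=> qr; rewrite /hat mulmxDr !mulmxA copid_mx_sq // copid_pid // mul0mx add0r.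
Qed.

Lemma theta_left q g N : (q <= r)%N -> hat q g N \in unitmx ->
  (pid_mx q : 'M[K]_(q, r)) *m g *m theta q g N = 1%:M.
Proof.
by move=> qr uh; rewrite -(pid_hat g N qr) /theta mulmxA mulmxK // pid_mx_id // pid_mx_1.
Qed.

Lemma theta_annihilates q g N : (q <= r)%N -> hat q g N \in unitmx ->
  copid_mx q *m N *m theta q g N = 0.
Proof.
by move=> qr uh; rewrite -(copid_hat g N qr) /theta mulmxA mulmxK // mul_copid_mx_pid.
Qed.

(** Both matrices have as columns a basis of the linear forms vanishing on V; the change of basis is
    found by evaluating the forms on the first q rows of [g2]. *)
Lemma theta_change q g g2 N : (q <= r)%N -> hat q g N \in unitmx -> hat q g2 N \in unitmx ->
  theta q g N = theta q g2 N *m ((pid_mx q : 'M[K]_(q, r)) *m g2 *m theta q g N).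
Proof.
move=> qr uh uh2; rewrite {2}/theta -!mulmxA.
have -> : pid_mx q *m ((pid_mx q : 'M[K]_(q, r)) *m (g2 *m theta q g N)) =
    hat q g2 N *m theta q g N.
  rewrite /hat mulmxDl theta_annihilates // addr0 !mulmxA pid_mx_id //.
by rewrite mulKmx.
Qed.

Lemma hat_frame q g N t : hat q (g *m t) (N *m t) = hat q g N *m t.
Proof. by rewrite /hat mulmxDl !mulmxA. Qed.

Lemma hat_unitP q g N : (q <= r)%N -> g \in unitmx -> N \in unitmx ->
  (hat q g N \in unitmx) =
  ((copid_mx q *m N :&: (pid_mx q : 'M[K]_r) *m g)%MS == 0).
Proof.
move=> qr ug uN; apply/idP/eqP => [uh|c0].
  apply/eqP; rewrite -submx0; apply/rV_subP => v; rewrite sub_capmx => /andP[].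
  move=> /submxP[y vy] /submxP[x vx].
  have E : (x *m pid_mx q - y *m copid_mx q) *m hat q g N = 0.
    by rewrite mulmxBl -!mulmxA pid_sq_hat // copid_hat // -vx -vy subrr.
  have E0 : x *m (pid_mx q : 'M[K]_r) - y *m (copid_mx q : 'M[K]_r) = 0.
    by rewrite -[LHS](mulmxK uh) E mul0mx.
  have xp : x *m (pid_mx q : 'M[K]_r) = 0.
    rewrite -(pid_mx_sq qr) mulmxA (subr0_eq E0) -mulmxA copid_pid //.
    exact: mulmx0.
  by rewrite vx mulmxA xp mul0mx sub0mx.
rewrite -row_free_unit -kermx_eq0 -submx0; apply/rV_subP => v /sub_kermxP.
rewrite /hat mulmxDr => /eqP; rewrite addr_eq0 => /eqP E.
have : (v *m (pid_mx q *m g) <= copid_mx q *m N :&: (pid_mx q : 'M[K]_r) *m g)%MS.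
  by rewrite sub_capmx submxMl E -mulNmx submxMl.
rewrite c0 submx0 => /eqP z1.
have z2 : v *m (copid_mx q *m N) = 0.
  by apply: oppr_inj; rewrite oppr0 -E; exact: z1.
have p1 : v *m (pid_mx q : 'M[K]_r) = 0 
  by rewrite -[LHS](mulmxK ug) -[v *m _ *m g]mulmxA [X in X *m _]z1 mul0mx.
have p2 : v *m (copid_mx q : 'M[K]_r) = 0 
  by rewrite -[LHS](mulmxK uN) -[v *m _ *m N]mulmxA z2 mul0mx.
by move: p2; rewrite mulmxBr mulmx1 p1 subr0 => ->; rewrite sub0mx.
Qed.

Lemma theta_vertical q g N g2 (y : 'rV[K]_q) : (q <= r)%N -> g2 \in unitmx ->
  hat q g N \in unitmx -> hat q g2 N \in unitmx ->
  y *m (pid_mx q : 'M[K]_(q, r)) *m g2 *m theta q g N = 0 -> y = 0.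
Proof.
move=> qr ug2 uh uh2 E; have := theta_left qr uh.
rewrite {1}(theta_change qr uh uh2) mulmxA => /mulmx1C lam.
have yl : y *m ((pid_mx q : 'M[K]_(q, r)) *m g2 *m theta q g N) = 0.
  by rewrite mulmxA (mulmxA y).
by rewrite -[y]mulmx1 -lam mulmxA yl mul0mx.
Qed.

Lemma rank_copid q N : (q <= r)%N -> N \in unitmx -> \rank (copid_mx q *m N) = (r - q)%N.
Proof. by move=> qr uN; rewrite mxrankMfree ?row_free_unit // rank_copid_mx. Qed.

End Hat.

Section Blocks.
Variables (r m : nat) (s : 'I_m.+1 -> nat).
Hypotheses (s0 : s ord0 = 0%N) (sm : s ord_max = r).
Hypothesis smono : forall j j' : 'I_m.+1, (j < j')%N -> (s j < s j')%N.

Lemma s_le (j j' : 'I_m.+1) : (j <= j')%N -> (s j <= s j')%N.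
Proof. by rewrite leq_eqVlt => /orP[/eqP/val_inj -> //|/smono/ltnW]. Qed.

Lemma s_ler (j : 'I_m.+1) : (s j <= r)%N.
Proof. by rewrite -sm; apply: s_le; rewrite -ltnS. Qed.

Lemma s_block b : (s (block s b) <= b)%N.
Proof. by rewrite /block; case: arg_maxnP => //; rewrite s0. Qed.

Lemma le_block b (j : 'I_m.+1) : (s j <= b)%N -> (j <= block s b)%N.
Proof.
move=> jb; rewrite leqNgt; apply/negP => /smono.
rewrite /block; case: arg_maxnP => [|i _ H]; first by rewrite s0.
by rewrite ltnNge => /negP; apply; exact: (H j jb).
Qed.

Lemma cell_pairs_lt (a b : 'I_r) : (a, b) \in cell_pairs r s -> (a < b)%N.
Proof. by rewrite inE /= => /leq_trans; apply; exact: s_block. Qed.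

Lemma block_gt0 (a b : 'I_r) : (a, b) \in cell_pairs r s -> (0 < block s b < m)%N.
Proof.
rewrite inE /= => ab; apply/andP; split.
  by rewrite lt0n; apply/negP => /eqP b0; move: ab; rewrite (_ : block s b = ord0) ?s0 //; exact: val_inj.
rewrite ltn_neqAle -ltnS ltn_ord andbT; apply/negP => /eqP bm.
have := s_block b; rewrite (_ : block s b = ord_max) ?sm; last exact: val_inj.
by rewrite leqNgt ltn_ord.
Qed.

Variable K : fieldType.
Local Notation np := #|cell_pairs r s|.

(** Row b is the vector f_b in the cell frame, so the pair (a, b) governs the entry in row b and
    column a. The matrix is lower unitriangular, because a < s (block b) <= b for such a pair. *)
Definition affine (w : 'rV[K]_np) : 'M[K]_r :=
  1%:M + \sum_k w 0 k *: delta_mx (enum_val k).2 (enum_val k).1.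

Lemma affine_pair (w : 'rV[K]_np) (k : 'I_np) :
  affine w (enum_val k).2 (enum_val k).1 = w 0 k.
Proof.
have := enum_valP k; case E: (enum_val k) => [a b] /cell_pairs_lt ab.
have ba : b != a by apply: contraTneq ab => ->; rewrite ltnn.
rewrite !mxE summxE (bigD1 k) //= big1 ?addr0.
  by rewrite !mxE E /= !eqxx mulr1 (negPf ba) add0r.
move=> l lk; rewrite !mxE; case: andP => [[/eqP h1 /eqP h2]|]; last by rewrite mulr0.
case/negP: lk; apply/eqP/enum_val_inj; rewrite E.
by case: (enum_val l) h1 h2 => a' b' /= -> ->.
Qed.

Lemma affine_other (w : 'rV[K]_np) (a b : 'I_r) : (a, b) \notin cell_pairs r s ->
  affine w b a = (b == a)%:R.
Proof.
move=> nab; rewrite !mxE summxE big1 ?addr0 // => k _; rewrite !mxE.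
case: andP => [[/eqP h1 /eqP h2]|]; last by rewrite mulr0.
by case/negP: nab; rewrite h1 h2 -surjective_pairing enum_valP.
Qed.

Lemma affine_unit w : affine w \in unitmx.
Proof.
rewrite unitmxE det_trig.
  rewrite big1 ?unitr1 // => b _; rewrite affine_other ?eqxx //.
  by apply/negP => /cell_pairs_lt; rewrite ltnn.
apply/is_trig_mxP => b a ba; rewrite affine_other.
  by rewrite (_ : (b == a) = false) //; apply/negbTE; apply: contraTneq ba => ->; rewrite ltnn.
by apply/negP => /cell_pairs_lt; rewrite ltnNge (ltnW ba).
Qed.

Lemma pid_mulE q (A : 'M[K]_r) b a : ((pid_mx q : 'M[K]_r) *m A) b a = (b < q)%:R * A b a.
Proof.
rewrite mxE (bigD1 b) //= big1 ?addr0 ?mxE ?eqxx // => c cb.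
rewrite mxE (_ : (b == c :> nat) = false) ?mul0r //.
by apply/negbTE; rewrite eq_sym.
Qed.

Lemma mul_pidE p q (A : 'M[K]_(p, r)) b a : (A *m (pid_mx q : 'M[K]_r)) b a = A b a * (a < q)%:R.
Proof.
rewrite mxE (bigD1 a) //= big1 ?addr0 ?[pid_mx _ _ _]mxE ?eqxx // => c ca.
by rewrite [pid_mx _ _ _]mxE (_ : (c == a :> nat) = false) ?mulr0 //; apply/negbTE.
Qed.

Lemma hat1E q (A : 'M[K]_r) b a : hat q 1%:M A b a = if (b < q)%N then (b == a)%:R else A b a.
Proof.
rewrite /hat mulmx1 mulmxBl mul1mx [LHS]mxE [X in _ + X]mxE [X in _ + (_ + X)]mxE pid_mulE mxE.
by case: ltnP => _; rewrite ?andbT ?andbF ?mul1r ?mul0r ?subrr ?addr0 ?subr0 ?add0r.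
Qed.

(** Replacing the first rows by those of the identity keeps the matrix lower unitriangular. Hence
    every value of the affine coordinates is attained by a flag of the cell. *)
Lemma affine_hat_unit w g j : g \in unitmx -> hat (s j) g (affine w *m g) \in unitmx.
Proof.
move=> ug; have -> : hat (s j) g (affine w *m g) = hat (s j) 1%:M (affine w) *m g.
  by rewrite -hat_frame mul1mx.
rewrite unitmx_mul ug andbT unitmxE det_trig.
  rewrite big1 ?unitr1 // => b _; rewrite hat1E eqxx affine_other ?eqxx ?if_same //.
  by apply/negP => /cell_pairs_lt; rewrite ltnn.
apply/is_trig_mxP => b a ba; rewrite hat1E affine_other.
  rewrite (_ : (b == a) = false) ?if_same //.
  by apply/negbTE; apply: contraTneq ba => ->; rewrite ltnn.
by apply/negP => /cell_pairs_lt; rewrite ltnNge (ltnW ba).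
Qed.

(* Row b of the affine matrix is the projection of the b-th frame vector. *)
Lemma affine_row (w : 'rV[K]_np) g (b : 'I_r) j : g \in unitmx -> block s b = j ->
  row b g *m invmx (hat (s j) g (affine w *m g)) *m (copid_mx (s j) : 'M[K]_r) =
  row b (copid_mx (s j) : 'M[K]_r).
Proof.
move=> ug bj; have sr := s_ler j; have uh := affine_hat_unit w j ug.
set h := hat _ _ _ in uh *.
(* e_b - f_b has coordinates only at the a < s j. So e_b = [y] + f_b is its decomposition along the
   first rows of [hat] and the remaining ones, f_b being one of the latter. *)
pose y : 'rV[K]_r := delta_mx 0 b - row b (affine w).
have sb : (s j <= b)%N by rewrite -bj s_block.
have yp : y *m (pid_mx (s j) : 'M[K]_r) = y.
  apply/matrixP => i a; rewrite (ord1 i) mul_pidE.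
  case: ltnP => ja; rewrite ?mulr1 // mulr0.
  have -> : y 0 a = (b == a)%:R - affine w b a.
    by rewrite /y [LHS]mxE [X in X + _]mxE eqxx eq_sym; congr (_ + _); rewrite [LHS]mxE [X in - X]mxE.
  rewrite affine_other ?subrr //.
  by rewrite inE /= -leqNgt bj.
have dE : delta_mx 0 b *m (copid_mx (s j) : 'M[K]_r) = delta_mx 0 b :> 'rV[K]_r.
  rewrite mulmxBr mulmx1; apply/matrixP => i a; rewrite (ord1 i) [LHS]mxE [X in _ + X]mxE mul_pidE.
  rewrite !mxE eqxx /=; case: eqP => [->|_]; last by rewrite mul0r subr0.
  by rewrite ltnNge sb mulr0 subr0.
have -> : row b g = (y *m (pid_mx (s j) : 'M[K]_r) + delta_mx 0 b *m (copid_mx (s j) : 'M[K]_r)) *m h.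
  rewrite mulmxDl -!mulmxA pid_sq_hat // copid_hat // !mulmxA yp dE -mulmxDl.
  by rewrite /y -rowE subrK -rowE.
rewrite mulmxK // mulmxDl -!mulmxA pid_copid // copid_mx_sq // mulmx0 add0r.
by rewrite -rowE.
Qed.

End Blocks.

(** * Subspaces of a fibre as row spaces of matrices *)

Section RowSpaces.
Variables (K : fieldType) (V : vectType K) (r : nat).
Implicit Types (e : r.-tuple V) (x : 'rV[K]_r).

Definition vec e x : V := \sum_a x 0 a *: e`_a.

Lemma vec_linear e : linear (vec e).
Proof.
move=> a x y; rewrite /vec scaler_sumr -big_split /=; apply: eq_bigr => i _.
by rewrite !mxE scalerDl scalerA.
Qed.

HB.instance Definition _ e := GRing.isSemilinear.Build K 'rV[K]_r V _ (vec e)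
  (GRing.semilinear_linear (vec_linear e)).

Definition rowsub e q (M : 'M[K]_(q, r)) : {vspace V} := (\sum_i <[vec e (row i M)]>)%VS.

Lemma vec_delta e (b : 'I_r) : vec e (delta_mx 0 b) = e`_b.
Proof.
rewrite /vec (bigD1 b) //= big1 ?addr0 ?mxE ?eqxx ?scale1r // => a ab.
by rewrite mxE (negPf ab) scale0r.
Qed.

Lemma vec_mul e q (x : 'rV[K]_q) (M : 'M[K]_(q, r)) :
  vec e (x *m M) = \sum_i x 0 i *: vec e (row i M).
Proof.
by rewrite mulmx_sum_row linear_sum; apply: eq_bigr => i _; rewrite linearZ.
Qed.

Lemma vec_change e e' (T : 'M[K]_r) : (forall b : 'I_r, e'`_b = vec e (row b T)) ->
  forall x, vec e' x = vec e (x *m T).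
Proof.
by move=> eT x; rewrite vec_mul /vec; apply: eq_bigr => a _; rewrite eT.
Qed.

Lemma rowsub_change e e' (T : 'M[K]_r) q (M : 'M[K]_(q, r)) :
  (forall b : 'I_r, e'`_b = vec e (row b T)) -> rowsub e' M = rowsub e (M *m T).
Proof.
move=> eT; apply: eq_bigr => i _.
by rewrite (vec_change eT) row_mul.
Qed.

Variable e : r.-tuple V.
Hypothesis eb : basis_of fullv e.

Lemma coord_vec a x : coord e a (vec e x) = x 0 a.
Proof. exact: (coord_sum_free _ _ (basis_free eb)). Qed.

Lemma vec_coord v : vec e (\row_a coord e a v) = v.
Proof.
rewrite [RHS](coord_basis eb (memvf v)); apply: eq_bigr => a _.
by rewrite mxE.
Qed.

Lemma vec_inj : injective (vec e).
Proof. by move=> x y xy; apply/rowP => a; rewrite -!coord_vec xy. Qed.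

Lemma mem_rowsub q (M : 'M[K]_(q, r)) x : (vec e x \in rowsub e M) = (x <= M)%MS.
Proof.
apply/idP/idP => [|/submxP[y ->]]; last first.
  rewrite vec_mul; apply: memv_sumr => i _; exact: memvZ (memv_line _).
move=> /memv_sumP[vs vsi xE].
have kP i : exists k, vs i = k *: vec e (row i M).
  by have /vlineP[k ->] := vsi i isT; exists k.
pose y : 'rV[K]_q := \row_i sval (cid (kP i)).
have -> : x = y *m M; last exact: submxMl.
apply: vec_inj; rewrite xE vec_mul; apply: eq_bigr => i _.
by rewrite mxE; exact: (svalP (cid (kP i))).
Qed.

Lemma rowsub_le q q' (M : 'M[K]_(q, r)) (M' : 'M[K]_(q', r)) :
  (rowsub e M <= rowsub e M')%VS = (M <= M')%MS.
Proof.
apply/idP/idP => [/subvP MM|MM].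
  by apply/row_subP => i; rewrite -mem_rowsub; apply: MM; rewrite mem_rowsub row_sub.
apply/subvP => v; rewrite -(vec_coord v) !mem_rowsub => /submx_trans; exact.
Qed.

Lemma rowsub_eqmx q q' (M : 'M[K]_(q, r)) (M' : 'M[K]_(q', r)) :
  (M :=: M')%MS -> rowsub e M = rowsub e M'.
Proof.
by move=> MM; apply/vspaceP => v; rewrite -(vec_coord v) !mem_rowsub MM.
Qed.

Lemma rowsub0 : rowsub e (0 : 'M[K]_r) = 0%VS.
Proof.
apply/vspaceP => v; rewrite -(vec_coord v) mem_rowsub memv0 -(linear0 (vec e)) (inj_eq vec_inj).
exact: submx0.
Qed.

Lemma rowsub_full (M : 'M[K]_r) : M \in unitmx -> rowsub e M = fullv.
Proof.
move=> uM; apply/vspaceP => v; rewrite -(vec_coord v) mem_rowsub memvf.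
by rewrite submx_full // row_full_unit.
Qed.

Lemma rowsub_cap0 q q' (M : 'M[K]_(q, r)) (M' : 'M[K]_(q', r)) :
  ((rowsub e M :&: rowsub e M')%VS == 0%VS) = ((M :&: M')%MS == 0).
Proof.
rewrite -submx0 -subv0; apply/idP/idP => [/subvP h|/rV_subP h].
  apply/rV_subP => x; rewrite sub_capmx => /andP[xM xM'].
  have := h (vec e x); rewrite memv_cap !mem_rowsub xM xM' => /(_ isT).
  by rewrite memv0 -(linear0 (vec e)) (inj_eq vec_inj) submx0.
apply/subvP => v; rewrite -(vec_coord v) memv_cap !mem_rowsub => /andP[xM xM'].
have := h (\row_a coord e a v); rewrite sub_capmx xM xM' => /(_ isT).
by rewrite submx0 memv0 -(linear0 (vec e)) (inj_eq vec_inj).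
Qed.

Lemma dim_rowsub q (M : 'M[K]_(q, r)) : \dim (rowsub e M) = \rank M.
Proof.
rewrite -(rowsub_eqmx (eq_row_base M)).
pose b := [tuple vec e (row i (row_base M)) | i < \rank M].
apply: (size_basis (X := b)); apply/andP; split.
  rewrite eqEsubv; apply/andP; split.
    by apply/span_subvP => v /tnthP[i ->]; rewrite tnth_mktuple mem_rowsub row_sub.
  apply/subvP => v /memv_sumP[vs vsi ->]; apply: memv_suml => i _.
  have /vlineP[k ->] := vsi i isT; apply/memvZ/memv_span/tnthP.
  by exists i; rewrite tnth_mktuple.
apply/freeP => k k0 i.
have : vec e ((\row_i k i) *m row_base M) = vec e 0.
  rewrite linear0 -[RHS]k0 vec_mul; apply: eq_bigr => a _.
  by rewrite mxE -tnth_nth tnth_mktuple.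
move/vec_inj => E; have /rowP/(_ i) : (\row_i k i) = 0 :> 'rV[K]_(\rank M).
  by apply: (row_free_inj (row_base_free M)); rewrite /= E mul0mx.
by rewrite !mxE.
Qed.

Lemma rowsub_pid q (g : 'M[K]_r) :
  rowsub e ((pid_mx q : 'M[K]_r) *m g) = (\sum_(a < r | (a < q)%N) <[vec e (row a g)]>)%VS.
Proof.
rewrite [RHS]big_mkcond; apply: eq_bigr => a _.
have -> : row a ((pid_mx q : 'M[K]_r) *m g) = (a < q)%:R *: row a g.
  by apply/rowP => b; rewrite mxE pid_mulE !mxE.
case: ltnP => _; rewrite ?scale1r // scale0r linear0.
by apply/eqP; rewrite -subv0; apply/subvP => v /vlineP[k ->]; rewrite scaler0 mem0v.
Qed.

End RowSpaces.

Lemma row_copid (K : fieldType) r q (N : 'M[K]_r) (b : 'I_r) :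
  row b (copid_mx q *m N) = (q <= b)%:R *: row b N.
Proof.
apply/rowP => a; rewrite mulmxBl mul1mx [LHS]mxE [LHS]mxE [X in _ + X]mxE pid_mulE !mxE.
by case: (ltnP b q); rewrite ?mul1r ?mul0r ?subrr ?subr0.
Qed.

Lemma copid_le (K : fieldType) r q q' (N : 'M[K]_r) : (q <= q')%N ->
  (copid_mx q' *m N <= copid_mx q *m N)%MS.
Proof.
move=> qq; apply/row_subP => b; rewrite row_copid.
have [qb|_] := leqP q' b; last by rewrite scale0r sub0mx.
by have := row_sub b (copid_mx q *m N); rewrite row_copid (leq_trans qq qb).
Qed.

Lemma daddv_piE (K : fieldType) (V : vectType K) (U W : {vspace V}) u w :
  (U :&: W = 0)%VS -> u \in U -> w - u \in W -> daddv_pi U W w = u.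
Proof.
move=> UW uU wW; have WU : (W :&: U = 0)%VS by rewrite capvC.
rewrite -(subrK u w) linearD /= (daddv_pi_id UW uU).
suff -> : daddv_pi U W (w - u) = 0 by rewrite add0r.
have wUW : w - u \in (U + W)%VS by apply: subvP wW; exact: addvSr.
by have := daddv_pi_add UW wUW; rewrite (daddv_pi_id WU wW) -[RHS]add0r => /addIr.
Qed.

Section FlagMatrices.
Variables (K : fieldType) (V : vectType K) (r m : nat) (e : r.-tuple V).
Variable s : 'I_m.+1 -> nat.
Hypothesis eb : basis_of fullv e.
Hypotheses (s0 : s ord0 = 0%N) (sm : s ord_max = r).
Hypothesis smono : forall j j' : 'I_m.+1, (j < j')%N -> (s j < s j')%N.

Definition flag_like (W : 'I_m.+1 -> {vspace V}) : Prop :=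
  [/\ W ord0 = fullv, W ord_max = 0%VS,
      forall j j' : 'I_m.+1, (j <= j')%N -> (W j' <= W j)%VS
    & forall j, (\dim (W j) + s j)%N = \dim {: V}].

Lemma dim_full : \dim {: V} = r.
Proof. exact: (size_basis (X := e)). Qed.

Lemma rowsub_flag (N : 'M[K]_r) : N \in unitmx ->
  flag_like (fun j => rowsub e (copid_mx (s j) *m N)).
Proof.
move=> uN; split.
- by rewrite s0 /copid_mx pid_mx_0 subr0 mul1mx rowsub_full.
- by rewrite sm /copid_mx pid_mx_1 subrr mul0mx rowsub0.
- by move=> j j' jj; rewrite rowsub_le // copid_le // s_le.
- move=> j; have sr := s_ler sm smono j.
  by rewrite (dim_rowsub eb) rank_copid // subnK // dim_full.
Qed.

(** Starting from the zero space at the end of the flag, a basis of a complement is prepended at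
    each step, so the smaller spaces stay tails of the list. *)
Lemma adapted_basis (W : 'I_m.+1 -> {vspace V}) : flag_like W ->
  exists2 l : seq V, basis_of fullv l & forall j, basis_of (W j) (drop (s j) l).
Proof.
case=> W0 Wm Wle Wdim.
(* [k] counts steps from the end. The list is so far a basis of the space of index m - k only, which
   explains the offset subtracted in [drop]. *)
suff H k : (k <= m)%N -> exists2 l : seq V, basis_of (W (inord (m - k))) l &
    forall j : 'I_m.+1, (m - k <= j)%N -> basis_of (W j) (drop (s j - s (inord (m - k))) l).
  have [l bl hl] := H m (leqnn m).
  have i0 : inord (m - m) = ord0 :> 'I_m.+1 by rewrite subnn; apply: val_inj; rewrite /= inordK.
  exists l; first by rewrite -W0 -i0.
  by move=> j; have := hl j; rewrite i0 s0 subn0; apply; rewrite subnn.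
elim: k => [|k IH] km.
  have im : inord (m - 0) = ord_max :> 'I_m.+1 by rewrite subn0; apply: val_inj; rewrite /= inordK.
  exists [::]; first by rewrite im Wm nil_basis.
  move=> j; rewrite subn0 => mj; have -> : j = ord_max.
    by apply/val_inj/eqP; rewrite eqn_leq /= -ltnS ltn_ord.
  by rewrite Wm nil_basis.
have [l bl hl] := IH (ltnW km).
set j0 : 'I_m.+1 := inord (m - k.+1); set j1 : 'I_m.+1 := inord (m - k) in bl hl.
have j0E : j0 = (m - k.+1)%N :> nat by rewrite inordK // ltnS leq_subr.
have j1E : j1 = (m - k)%N :> nat by rewrite inordK // ltnS leq_subr.
have j01 : j1 = j0.+1 :> nat by rewrite j0E j1E subnSK.
have WW : (W j1 <= W j0)%VS by apply: Wle; rewrite j01.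
pose X := vbasis (W j0 :\: W j1)%VS.
have bX : basis_of (W j0) (X ++ l).
  have WE : (W j0 :\: W j1 + W j1)%VS = W j0 by rewrite addv_diff; apply/addv_idPl.
  have : basis_of (W j0 :\: W j1 + W j1)%VS (X ++ l); last by rewrite WE.
  apply: cat_basis bl; last exact: vbasisP.
  by apply/directv_addP; rewrite capv_diff.
have szl : size l = \dim (W j1) := esym (size_basis (X := in_tuple l) bl).
have szX : (size X + s j0 = s j1)%N.
  have := size_basis (X := in_tuple (X ++ l)) bX; rewrite /= size_cat szl => E.
  apply: (@addnI (\dim (W j1))); rewrite Wdim addnA [(_ + size X)%N]addnC -E.
  exact: Wdim.
exists (X ++ l); first exact: bX.
move=> j; rewrite leq_eqVlt => /orP[/eqP jE|jlt].
  by have -> : j = j0; [apply: val_inj; rewrite /= j0E -jE|rewrite subnn drop0].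
have jj1 : (j1 <= j)%N by rewrite j01 j0E.
have s1j := s_le smono jj1.
have -> : (s j - s j0)%N = ((s j - s j1) + size X)%N.
  by move: s1j szX; lia.
by rewrite -drop_drop drop_size_cat // hl // -j1E.
Qed.

Lemma flag_represented (W : 'I_m.+1 -> {vspace V}) : flag_like W ->
  exists2 N : 'M[K]_r, N \in unitmx & forall j, W j = rowsub e (copid_mx (s j) *m N).
Proof.
move=> fW; have [l bl hl] := adapted_basis fW; have [_ _ _ Wdim] := fW.
have szl : size l = r by rewrite -(size_basis (X := in_tuple l) bl) dim_full.
pose N : 'M[K]_r := \matrix_(b, a) coord e a l`_b.
have rN b : vec e (row b N) = l`_b.
  by rewrite -[RHS](vec_coord eb); congr vec; apply/rowP => a; rewrite !mxE.
have uN : N \in unitmx.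
  rewrite -row_full_unit -sub1mx -(rowsub_le eb) (rowsub_full eb (unitmx1 _ _)).
  rewrite -(span_basis bl); apply/span_subvP => v vl.
  have vr : (index v l < r)%N by rewrite -szl index_mem.
  by rewrite -(nth_index 0 vl) -(rN (Ordinal vr)) mem_rowsub // row_sub.
exists N => // j; apply/esym/eqP; rewrite eqEdim.
have sr := s_ler sm smono j.
have dW : (\dim (W j) <= r - s j)%N by have := Wdim j; rewrite dim_full => <-; rewrite addnK.
rewrite (dim_rowsub eb) rank_copid // dW andbT.
apply/subvP => v; rewrite -(vec_coord eb v) mem_rowsub // => /submxP[y ->].
rewrite vec_mul; apply: memv_suml => b _; apply: memvZ.
rewrite row_copid; case: leqP => sb; last by rewrite scale0r linear0 mem0v.
rewrite scale1r rN -(span_basis (hl j)) memv_span //.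
rewrite -(subnKC sb) -nth_drop mem_nth // size_drop szl ltn_sub2r //.
exact: leq_ltn_trans sb (ltn_ord b).
Qed.

End FlagMatrices.

(** Gram-Schmidt preserves the spans of initial rows, while a flag is given by spans of final rows;
    hence the reversal of the rows before and after. *)
Lemma unitary_adapted (C : numClosedFieldType) r (N : 'M[C]_r) : N \in unitmx ->
  exists2 N' : 'M[C]_r, (N' *m N' ^t*)%sesqui = 1%:M &
    forall q, (q <= r)%N -> (copid_mx q *m N' :=: copid_mx q *m N)%MS.
Proof.
move=> uN; pose A : 'M[C]_r := \matrix_(i, j) N (rev_ord i) j.
have /unitarymxP SS := schmidt_unitarymx A (leqnn r).
pose N' : 'M[C]_r := \matrix_(i, j) schmidt A (rev_ord i) j.
have rN b : row b N' = row (rev_ord b) (schmidt A) by apply/rowP => j; rewrite !mxE.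
have rA b : row b N = row (rev_ord b) A by apply/rowP => j; rewrite !mxE rev_ordK.
have NN : (N' *m N' ^t*)%sesqui = 1%:M.
  apply/matrixP => i j; have /matrixP/(_ (rev_ord i) (rev_ord j)) := SS.
  rewrite !mxE (inj_eq rev_ord_inj) => <-; apply: eq_bigr => k _.
  by rewrite !mxE.
exists N' => // q qr; have uN' : N' \in unitmx by case/mulmx1_unit: NN.
apply: eqmx_sym; apply/eqmxP; rewrite -mxrank_leqif_eq ?rank_copid //.
apply/row_subP => b; rewrite row_copid; case: leqP => qb; last by rewrite scale0r sub0mx.
rewrite scale1r rA; apply: submx_trans (row_schmidt_sub _ _) _.
apply/sumsmx_subP => k kb; rewrite genmxE.
have -> : row k (schmidt A) = row (rev_ord k) (copid_mx q *m N').
  rewrite row_copid rN rev_ordK (_ : (q <= rev_ord k)%N) ?scale1r //.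
  apply: leq_trans qb _; have := ltn_ord k; have := ltn_ord b.
  by move: kb => /=; lia.
exact: row_sub.
Qed.

(** * Bundles in charts *)

Section GramMatrices.
Variables (C : numClosedFieldType) (V : vectType C) (r : nat).
Variable h : {dot V for Num.conj}.
Local Open Scope sesquilinear_scope.
Implicit Type e : r.-tuple V.

Definition gram_mx e : 'M[C]_r := \matrix_(a, b) h e`_a e`_b.

Lemma dot_vec e (x y : 'rV[C]_r) :
  h (vec e x) (vec e y) = (x *m gram_mx e *m y ^t*) 0 0.
Proof.
rewrite mxE /vec linear_sumr; apply: eq_bigr => b _.
rewrite linear_sumlz !mxE mulr_suml; apply: eq_bigr => a _.
by rewrite linearZr_LR linearZl_LR /= !mxE; ring.
Qed.

Lemma gram_change e e' (T : 'M[C]_r) : (forall b : 'I_r, e'`_b = vec e (row b T)) ->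
  gram_mx e' = T *m gram_mx e *m T ^t*.
Proof.
move=> eT; apply/matrixP => a b; rewrite [LHS]mxE !eT dot_vec.
rewrite [LHS]mxE [RHS]mxE; apply: eq_bigr => c _; congr (_ * _).
  by rewrite -row_mul mxE.
by rewrite !mxE.
Qed.

Lemma gram_posdef e : basis_of fullv e -> posdef (gram_mx e).
Proof.
move=> eb; split.
  apply/matrixP => a b; rewrite adjE !mxE [RHS]hermC /= expr0 mul1r //.
move=> c c0; have -> : qform (gram_mx e) c = h (vec e (c ^t*)) (vec e (c ^t*)).
  by rewrite dot_vec trmxCK.
rewrite dnorm_gt0 -(linear0 (vec e)) (inj_eq (vec_inj eb)).
by rewrite adj_eq0.
Qed.

End GramMatrices.

Section Charts.
Variables (R : realType) (n : nat) (A : atlas R n).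
Local Notation C := (cplx R).
Local Notation X := (points A).

(** The local conditions on a complex manifold alone. Continuity of charts and openness of domains
    follow from them, and these are needed on the flag bundle before its Hausdorff property and
    compactness can be proved. *)
Definition charted : Prop :=
  [/\ forall i, {in dom i &, injective (@chart _ _ A i)},
      forall i j, open (chart i @` (@dom _ _ A i `&` dom j))
    & forall j, holomorphic_on (dom j) (@chart _ _ A j)].

Lemma in_chart_inj (V : normedModType C) (f : X -> V) i (p : X) :
  {in dom i &, injective (@chart _ _ A i)} -> dom i p -> in_chart i f (chart i p) = f p.
Proof.
move=> inj ip; rewrite /in_chart; case: xgetP.
  by move=> v -> [q [iq qp] <-]; rewrite (inj q p) // inE.
by move=> /(_ (f p)) []; exists p.
Qed.

Hypothesis chA : charted.

Lemma in_chartE (V : normedModType C) (f : X -> V) i (p : X) : dom i p ->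
  in_chart i f (chart i p) = f p.
Proof. by have [inj _ _] := chA; exact: in_chart_inj. Qed.

Lemma chart_image_open i (U : set X) : open U -> open (chart i @` (U `&` dom i)).
Proof.
have [inj ov _] := chA; move=> oU; rewrite openE => _ [p [Up ip] <-].
have n1 := oU p i Up ip; have n2 : nbhs (chart i p) (chart i @` (dom i `&` dom i)).
  by apply: open_nbhs_nbhs; split; [exact: ov|exists p].
apply: filterS2 n1 n2 => z hz [q [iq _] qz]; exists q => //.
by split=> //; exact: hz.
Qed.

Lemma chart_preimage_open i (S : set 'rV[C]_n) : open S ->
  open [set q : X | dom i q /\ S (chart i q)].
Proof.
have [inj ov hol] := chA; move=> oS.
suff : atlas_open [set q : X | dom i q /\ S (chart i q)] by [].
move=> q j [iq Sq] jq.
have cont : {for chart j q, continuous (in_chart j (@chart _ _ A i))}.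
  exact: differentiable_continuous (hol i j q jq iq).
have n1 : nbhs (chart j q) (chart j @` (dom j `&` dom i)).
  by apply: open_nbhs_nbhs; split; [exact: ov|exists q].
have n2 : nbhs (chart j q) (in_chart j (@chart _ _ A i) @^-1` S).
  by apply: cont; rewrite (in_chartE _ jq); exact: open_nbhs_nbhs.
apply: filterS2 n1 n2 => z [q' [jq' iq'] <-] /= Sz q'' jq'' qq.
have -> : q'' = q' by apply: (inj j); rewrite ?inE.
by split=> //; rewrite (in_chartE _ jq') in Sz.
Qed.

Lemma dom_open i : open (@dom _ _ A i : set X).
Proof.
have := @chart_preimage_open i _ openT.
by rewrite (_ : [set q | _] = dom i) //; apply/seteqP; split=> [q []|q iq].
Qed.

Lemma chart_continuous i (p : X) : dom i p -> chart i x @[x --> p] --> chart i p.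
Proof.
move=> ip S /nbhs_interior Sp.
have : nbhs p [set q : X | dom i q /\ S° (chart i q)].
  apply: open_nbhs_nbhs; split; first exact: chart_preimage_open (open_interior _).
  by split=> //; exact: nbhs_singleton Sp.
by apply: filterS => q [_ /interior_subset].
Qed.

Lemma cvg_chart (F : set_system X) i (p : X) : Filter F -> dom i p -> F (dom i) ->
  chart i x @[x --> F] --> chart i p -> F --> p.
Proof.
move=> FF ip Fi cF U; rewrite nbhsE => -[V [oV Vp] VU].
have := cF _ (oV p i Vp ip) => H.
by apply: (@filterS2 _ F FF _ _ _ _ Fi H) => q iq hq; apply: VU; exact: hq.
Qed.

End Charts.

(* T is only assumed to be complex differentiable; since d/dz kills T^*, the
   derivative of G' = T G T^* expresses that of T through T itself and smooth
   functions, so that T is smooth by induction on the order. *)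
Section Bootstrap.
Variables (R : realType) (n r : nat).
Local Notation C := (cplx R).
Local Open Scope sesquilinear_scope.
Variables (D : set 'rV[C]_n) (G G' T : 'rV[C]_n -> 'M[C]_r).
Hypotheses (oD : open D) (sG : mx_class (smooth_on D) G) (sG' : mx_class (smooth_on D) G').
Hypothesis hT : forall a b z, D z -> differentiable (fun y => T y a b) z.
Hypothesis uT : forall z, D z -> T z \in unitmx.
Hypothesis uG : forall z, D z -> G z \in unitmx.
Hypothesis GT : forall z, D z -> G' z = T z *m G z *m (T z) ^t*.

Lemma bootstrap_rderive v z : D z -> dmx (rderive v) T z =
  (dmx (dvec v) G' z - T z *m dmx (dvec v) G z *m (T z) ^t*) *m invmx (G z *m (T z) ^t*).
Proof.
move=> Dz; have SC := rderivable_class oD; have dv := dvec_leibniz v oD.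
have rT : mx_class (rderivable_on D) T.
  by move=> a b y Dy w; exact: (is_rderive_rderivable (is_rderive_holo w (hT a b Dy))).
have rG : mx_class (rderivable_on D) G by move=> a b; exact: smooth_rderivable (sG a b).
have rG' : mx_class (rderivable_on D) G' by move=> a b; exact: smooth_rderivable (sG' a b).
have rTc : mx_class (rderivable_on D) (fun y => (T y) ^t*).
  move=> a b; apply: (fc_ext SC (f := fun y => (T y b a)^*)); last first.
    by move=> y _; rewrite adjE.
  move=> y Dy w; exact: (is_rderive_rderivable (is_rderive_conj (is_rderive_holo w (hT b a Dy)))).
have rTG := mx_classM SC rT rG.
have E := dmx_eq dv rG' GT Dz.
rewrite (dmxM SC dv rTG rTc Dz) (dmxM SC dv rT rG Dz) in E.
have c0 : dmx (dvec v) (fun y => (T y) ^t*) z = 0.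
  apply/matrixP => a b; rewrite [in LHS]mxE [in RHS]mxE.
  rewrite -(dvec_conj_holo v (hT b a Dz)); congr (dvec v _ z).
  by apply/funext => y; rewrite adjE.
(* By the Cauchy-Riemann equations the (1,0) derivative of a complex differentiable function is its
   full derivative along the real line. *)
have dE : dmx (rderive v) T z = dmx (dvec v) T z.
  apply/matrixP => a b; rewrite [in LHS]mxE [in RHS]mxE.
  exact: esym (dvec_holo v (hT a b Dz)).
have uGT : G z *m (T z) ^t* \in unitmx.
  by rewrite unitmx_mul uG //= map_unitmx unitmx_tr uT.
rewrite dE E c0 mulmx0 addr0 mulmxDl addrK -mulmxA.
by rewrite -[LHS]mulmx1 -(mulmxV uGT) !mulmxA.
Qed.

Lemma bootstrap_smooth : mx_class (smooth_on D) T.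
Proof.
suff H k : mx_class (Ck k D) T by move=> a b; apply/smooth_onP => k; exact: H.
have cT a b z : D z -> {for z, continuous (fun y => T y a b)}.
  by move=> Dz; exact: differentiable_continuous (hT a b Dz).
have uGT z : D z -> G z *m (T z) ^t* \in unitmx.
  by move=> Dz; rewrite unitmx_mul uG //= map_unitmx unitmx_tr uT.
elim: k => [|k IH] a b.
  by split; [exact: cT|exact: I].
apply: (CkS_intro oD (cT a b)) => v.
(* This expression for the derivative contains [T] and its adjoint undifferentiated, which are of
   class C^k by induction, together with smooth matrices. *)
pose N y : 'M[C]_r := (dmx (dvec v) G' y - T y *m dmx (dvec v) G y *m (T y) ^t*)
  *m invmx (G y *m (T y) ^t*).
exists (fun y => N y a b); split.
  move=> z Dz; have := bootstrap_rderive v Dz => /matrixP/(_ a b); rewrite [in LHS]mxE => E.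
  rewrite -/(N z) in E; rewrite -E; apply: is_rderive_rderive.
  exact: (is_rderive_rderivable (is_rderive_holo v (hT a b Dz))).
have SC := Ck_class k oD; have dv := dvec_derivation v oD; have SS := smooth_class oD.
have toCk p q (A : 'rV[C]_n -> 'M[C]_(p, q)) : mx_class (smooth_on D) A -> mx_class (Ck k D) A.
  by move=> sA i j; exact: ((smooth_onP _ _).1 (sA i j) k).
have kTc : mx_class (Ck k D) (fun y => (T y) ^t*).
  move=> i j; apply: (Ck_eq oD _ (Ck_conj oD (IH j i))) => y _; by rewrite adjE.
have kG := toCk _ _ _ sG.
have kdG := toCk _ _ _ (dmx_class SS dv sG); have kdG' := toCk _ _ _ (dmx_class SS dv sG').
have kTdG := mx_classM SC (mx_classM SC IH kdG) kTc.
have kV := mx_class_inv SC (mx_classM SC kG kTc) uGT.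
suff kS : mx_class (Ck k D) (fun y => dmx (dvec v) G' y - T y *m dmx (dvec v) G y *m (T y) ^t*).
  exact: (mx_classM SC kS kV a b).
apply: (mx_class_ext SC (mx_classD SC kdG' (mx_classM SC (mx_class_cst SC (- 1)%:M) kTdG))) => y _.
by rewrite mul_scalar_mx scaleN1r.
Qed.

End Bootstrap.

Section BundleCharts.
Variables (R : realType) (n : nat) (A : atlas R n) (U : frame_cover A) (r : nat).
Local Notation C := (cplx R).
Local Notation X := (points A).
Local Open Scope sesquilinear_scope.
Variables (E : bundle U r) (h : metric E).
Hypotheses (chA : charted A) (hE : holomorphic_bundle E) (sh : smooth_metric h).

Lemma tdom_open t : open (@tdom _ _ A U t).
Proof. by case: hE => [[]]. Qed.

Lemma frame_basis t p : tdom t p -> basis_of fullv (frame E t p).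
Proof. by case: hE => _ H _; exact: H. Qed.

(** Transposed, because coordinate vectors are rows here: the rows give the frame t' in the frame
    t. *)
Definition trans (t t' : tindex U) (p : X) : 'M[C]_r := (transition E t t' p)^T.

Lemma frame_trans t t' p : tdom t p -> forall b : 'I_r,
  (frame E t' p)`_b = vec (frame E t p) (row b (trans t t' p)).
Proof.
move=> tp b; rewrite -[LHS](vec_coord (frame_basis tp)); congr vec.
by apply/rowP => a; rewrite !mxE.
Qed.

Lemma trans_mul t t' t'' p : tdom t p -> tdom t' p -> tdom t'' p ->
  trans t t'' p = trans t' t'' p *m trans t t' p.
Proof.
move=> tp tp' tp''; apply/row_matrixP => b; apply: (vec_inj (frame_basis tp)).
rewrite -(frame_trans t'' tp) (frame_trans t'' tp') (vec_change (frame_trans t' tp)).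
by rewrite row_mul.
Qed.

Lemma trans_id t p : tdom t p -> trans t t p = 1%:M.
Proof.
move=> tp; apply/row_matrixP => b; apply: (vec_inj (frame_basis tp)).
by rewrite -(frame_trans t tp) rowE mulmx1 vec_delta.
Qed.

Lemma trans_unit t t' p : tdom t p -> tdom t' p -> trans t t' p \in unitmx.
Proof.
move=> tp tp'; have := trans_mul tp tp' tp; rewrite trans_id // => /esym.
by case/mulmx1_unit.
Qed.

Lemma gram_posdef_at t p : tdom t p -> posdef (gram h t p).
Proof. by move=> tp; exact: (gram_posdef (h p) (frame_basis tp)). Qed.

Lemma gram_trans t t' p : tdom t p ->
  gram h t' p = trans t t' p *m gram h t p *m (trans t t' p) ^t*.
Proof. by move=> tp; exact: (gram_change (h p) (frame_trans t' tp)). Qed.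

Definition gram_chart i t z : 'M[C]_r :=
  \matrix_(a, b) in_chart i (fun p => gram h t p a b : C) z.

Definition trans_chart i t t' z : 'M[C]_r := (in_chart i (transition E t t' : X -> 'M[C]_r) z)^T.

Lemma gram_chartE i t p : dom i p -> gram_chart i t (chart i p) = gram h t p.
Proof. by move=> ip; apply/matrixP => a b; rewrite [LHS]mxE (in_chartE chA). Qed.

Lemma trans_chartE i t t' p : dom i p -> trans_chart i t t' (chart i p) = trans t t' p.
Proof. by move=> ip; rewrite /trans_chart (in_chartE chA). Qed.

Definition base_dom (i : cindex A) (t : tindex U) : set 'rV[C]_n :=
  chart i @` ((@tdom _ _ A U t : set X) `&` dom i).
Definition base_dom2 (i : cindex A) (t t' : tindex U) : set 'rV[C]_n :=
  chart i @` ((@tdom _ _ A U t : set X) `&` @tdom _ _ A U t' `&` dom i).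

Lemma base_dom_open i t : open (base_dom i t).
Proof. by apply: (chart_image_open chA); exact: tdom_open. Qed.

Lemma base_dom2_open i t t' : open (base_dom2 i t t').
Proof. by apply: (chart_image_open chA); apply: openI; exact: tdom_open. Qed.

Lemma gram_chart_smooth i t : mx_class (smooth_on (base_dom i t)) (gram_chart i t).
Proof.
move=> a b; rewrite (_ : (fun x => _) = in_chart i (fun p => gram h t p a b : C)).
  exact: sh.
by apply/funext => z; rewrite mxE.
Qed.

Lemma gram_chart_posdef i t z : base_dom i t z -> posdef (gram_chart i t z).
Proof. by move=> [p [tp ip] <-]; rewrite gram_chartE //; exact: gram_posdef_at. Qed.

Lemma trans_chart_holo i t t' a b z : base_dom2 i t t' z ->
  differentiable (fun y => trans_chart i t t' y a b) z.
Proof.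
move=> [p [[tp tp'] ip] <-]; case: hE => _ _ hT.
have dT := hT t t' i p ip (conj tp tp').
rewrite (_ : (fun y => _) = (fun M : 'M[C]_r => M b a) \o in_chart i (transition E t t' : X -> 'M[C]_r)).
  by apply: differentiable_comp => //; exact: differentiable_coord.
by apply/funext => y; rewrite /trans_chart mxE.
Qed.

Lemma trans_chart_unit i t t' z : base_dom2 i t t' z -> trans_chart i t t' z \in unitmx.
Proof. by move=> [p [[tp tp'] ip] <-]; rewrite trans_chartE //; exact: trans_unit. Qed.

(** The Gram matrices of the two frames are smooth and differ by congruence with the transition
    matrix, which forces that matrix to be smooth. *)
Lemma trans_chart_smooth i t t' : mx_class (smooth_on (base_dom2 i t t')) (trans_chart i t t').
Proof.
have sub1 : base_dom2 i t t' `<=` base_dom i t by move=> z [p [[tp tp'] ip] <-]; exists p.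
have sub2 : base_dom2 i t t' `<=` base_dom i t' by move=> z [p [[tp tp'] ip] <-]; exists p.
refine (@bootstrap_smooth R n r _ (gram_chart i t) (gram_chart i t')
  (trans_chart i t t') (@base_dom2_open i t t') _ _ _ _ _ _).
- by move=> a b; apply: smooth_subset sub1 _; exact: gram_chart_smooth.
- by move=> a b; apply: smooth_subset sub2 _; exact: gram_chart_smooth.
- by move=> a b z; exact: trans_chart_holo.
- by move=> z; exact: trans_chart_unit.
- by move=> z /sub1 /gram_chart_posdef /posdef_unit.
- move=> z [p [[tp tp'] ip] <-]; rewrite !gram_chartE // trans_chartE //.
  exact: gram_trans.
Qed.

End BundleCharts.

(** * The atlas of the flag bundle *)

Lemma basis_change (K : fieldType) (V : vectType K) r (f e : r.-tuple V) (T : 'M[K]_r) :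
  basis_of fullv f -> T \in unitmx -> (forall b : 'I_r, e`_b = vec f (row b T)) ->
  basis_of fullv e.
Proof.
move=> fb uT eT; rewrite basisEdim size_tuple (dim_full fb) leqnn andbT.
apply/subvP => v _; rewrite -(vec_coord fb v); set x := \row_a _.
rewrite -[x](mulmxKV uT) -(vec_change eT); apply: memv_suml => a _.
by apply/memvZ/memv_span/mem_nth; rewrite size_tuple.
Qed.

Section Cells.
Variables (R : realType) (n : nat) (A : atlas R n) (U : frame_cover A) (r : nat).
Local Notation C := (cplx R).
Local Notation X := (points A).
Variables (E : bundle U r) (m : nat) (s : 'I_m.+1 -> nat).
Hypotheses (chA : charted A) (hE : holomorphic_bundle E).
Hypotheses (s0 : s ord0 = 0%N) (sm : s ord_max = r).
Hypothesis smono : forall j j' : 'I_m.+1, (j < j')%N -> (s j < s j')%N.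

Local Notation flagE := (flag E s).
Local Notation np := #|cell_pairs r s|.
Implicit Types (y : flagE) (c : cell U r) (t : tindex U).

Let sr j : (s j <= r)%N := s_ler sm smono j.

Lemma flagP y : flag_like s (flag_sub y).
Proof. by case: y. Qed.

(* In the frame t, the rows b >= s j of N span V_j, for every j. *)
Definition rep t y (N : 'M[C]_r) : Prop := N \in unitmx /\
  forall j, flag_sub y j = rowsub (frame E t (flag_base y)) (copid_mx (s j) *m N).

(** The constant change of frame, transposed so that its rows are the vectors of the cell frame. *)
Definition gam c : 'M[C]_r := (val c.2)^T.

Lemma gam_unit c : gam c \in unitmx.
Proof. by rewrite unitmx_tr; case: c => c [g]. Qed.

Lemma cell_frameE c p (b : 'I_r) :
  (cell_frame E c p)`_b = vec (frame E c.1.2 p) (row b (gam c)) :> fibre E p.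
Proof.
rewrite -tnth_nth tnth_mktuple; apply: eq_bigr => a _.
by rewrite !mxE.
Qed.

Lemma cell_frame_basis c p : tdom c.1.2 p -> basis_of fullv (cell_frame E c p).
Proof.
move=> tp; apply: basis_change (frame_basis hE tp) (gam_unit c) _.
exact: cell_frameE.
Qed.

Lemma cell_spanE c p j :
  cell_span E s c p j = rowsub (frame E c.1.2 p) ((pid_mx (s j) : 'M[C]_r) *m gam c).
Proof.
by rewrite rowsub_pid; apply: eq_bigr => a _; rewrite cell_frameE.
Qed.

Lemma rep_exists t y : tdom t (flag_base y) -> exists N, rep t y N.
Proof.
move=> tp; have [N uN hN] := flag_represented (frame_basis hE tp) s0 sm smono (flagP y).
by exists N.
Qed.

Lemma unitary_rep t y : tdom t (flag_base y) ->
  exists2 N, rep t y N & (N *m N ^t*)%sesqui = 1%:M.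
Proof.
move=> tp; have [N [uN hN]] := rep_exists tp.
have [N' NN' h'] := unitary_adapted uN; exists N' => //.
split; first by case/mulmx1_unit: NN'.
move=> j; rewrite hN; apply: (rowsub_eqmx (frame_basis hE tp)).
exact: eqmx_sym (h' _ (sr j)).
Qed.

Lemma rep_trans t t' y N : tdom t (flag_base y) -> tdom t' (flag_base y) -> rep t y N ->
  rep t' y (N *m invmx (trans E t t' (flag_base y))).
Proof.
move=> tp tp' [uN hN]; have uT := trans_unit hE tp tp'; split.
  by rewrite unitmx_mul uN unitmx_inv.
move=> j; rewrite hN (rowsub_change _ (frame_trans hE t' tp)).
by rewrite mulmxA mulmxKV.
Qed.

Lemma flag_ext t y y' N : rep t y N -> rep t y' N -> flag_base y = flag_base y' -> y = y'.
Proof.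
case: y => p V fV; case: y' => p' V' fV' [_ /= hV] [_ /= hV'] pp'.
case: p' / pp' V' fV' hV' => V' fV' hV'.
have VV : V = V' by apply/funext => j; rewrite hV hV'.
by case: V' / VV fV' {hV'} => fV'; congr Flag; exact: Prop_irrelevance.
Qed.

Lemma flag_of t p (N : 'M[C]_r) : tdom t p -> N \in unitmx ->
  exists2 y, flag_base y = p & rep t y N.
Proof.
move=> tp uN; have fN := rowsub_flag (frame_basis hE tp) s0 sm smono uN.
by exists (@Flag _ _ _ _ _ E _ s p _ fN).
Qed.

Lemma cell_domP c y N : rep c.1.2 y N -> tdom c.1.2 (flag_base y) ->
  cell_dom c y <-> dom c.1.1 (flag_base y) /\
    forall j, hat (s j) (gam c) N \in unitmx.
Proof.
move=> [uN hN] tp; have fb := frame_basis hE tp.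
have H j : (flag_sub y j :&: cell_span E s c (flag_base y) j = 0)%VS <->
    hat (s j) (gam c) N \in unitmx.
  rewrite hN cell_spanE (hat_unitP (sr j) (gam_unit c) uN) -(rowsub_cap0 fb).
  by split=> /eqP.
split=> [[ip _ hj]|[ip hj]].
  by split=> // j; apply/H.
by split=> // j; apply/H.
Qed.

Definition coords c y : 'rV[C]_np :=
  \row_k cell_coord c y (enum_val k).1 (enum_val k).2.

Lemma cell_chartE c y : cell_chart c y = row_mx (chart c.1.1 (flag_base y)) (coords c y).
Proof. by []. Qed.

(** Cell frame coordinates of the projection of e_b to V_j: expand e_b in the rows of [hat], keep
    the part in the rows of [N] spanning V_j, and return to the cell frame. Being rational in [N],
    it shows the regularity of cell coordinates. *)
Definition proj_row c (N : 'M[C]_r) (b : 'I_r) : 'rV[C]_r :=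
  row b (gam c) *m invmx (hat (s (block s b)) (gam c) N) *m copid_mx (s (block s b)) *m N
    *m invmx (gam c).

Lemma cell_coordE c y N a b : cell_dom c y -> rep c.1.2 y N ->
  cell_coord c y a b = proj_row c N b 0 a.
Proof.
move=> cy rN; have [ip tp cap0] := cy; have [uN hN] := rN.
have [_ uh] := (cell_domP rN tp).1 cy.
have fb := frame_basis hE tp; have eb := cell_frame_basis tp.
rewrite /cell_coord; set j := block s b.
pose x := row b (gam c) *m invmx (hat (s j) (gam c) N).
rewrite (@daddv_piE _ _ _ _ (vec (frame E c.1.2 (flag_base y)) (x *m copid_mx (s j) *m N))).
- rewrite -(coord_vec eb) (vec_change (cell_frameE c (flag_base y))).
  by rewrite mulmxKV ?gam_unit.
- exact: cap0.
- by rewrite hN mem_rowsub // -mulmxA submxMl.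
rewrite cell_frameE -linearB cell_spanE mem_rowsub //.
have -> : row b (gam c) = x *m hat (s j) (gam c) N by rewrite mulmxKV ?uh.
rewrite mulmxDr -(mulmxA x (copid_mx (s j))) addrK; exact: submxMl.
Qed.

Lemma proj_row_affine c (w : 'rV[C]_np) b : proj_row c (affine w *m gam c) b = row b (affine w).
Proof.
rewrite /proj_row (affine_row s0 sm smono w (gam_unit c) (erefl (block s b))).
rewrite mulmxA mulmxK ?gam_unit // -row_mul row_copid s_block //.
exact: scale1r.
Qed.

Lemma coords_affine c y (w : 'rV[C]_np) : cell_dom c y -> rep c.1.2 y (affine w *m gam c) ->
  coords c y = w.
Proof.
move=> cy ry; apply/rowP => k; rewrite mxE (cell_coordE _ _ cy ry) proj_row_affine.
by rewrite mxE affine_pair.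
Qed.

(** The projection differs from e_b by a combination of the e_a with a < s j, so its other
    coordinates are those of e_b. *)
Lemma proj_row_shape c N (b a : 'I_r) : (forall j, hat (s j) (gam c) N \in unitmx) ->
  (s (block s b) <= a)%N -> proj_row c N b 0 a = (b == a)%:R.
Proof.
move=> uh ja; rewrite /proj_row; set j := block s b in ja *.
pose x := row b (gam c) *m invmx (hat (s j) (gam c) N).
have E1 : x *m copid_mx (s j) *m N = row b (gam c) - x *m pid_mx (s j) *m gam c.
  have -> : row b (gam c) = x *m hat (s j) (gam c) N by rewrite mulmxKV ?uh.
  rewrite [x *m hat _ _ _]mulmxDr (mulmxA x (pid_mx (s j))) (mulmxA x (copid_mx (s j))).
  by rewrite [X in X - _]addrC addrK.
rewrite -/x E1 mulmxBl mulmxK ?gam_unit // -row_mul mulmxV ?gam_unit //.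
rewrite [LHS]mxE [X in _ + X]mxE mul_pidE ltnNge ja mulr0 subr0 row1 mxE eqxx.
by rewrite eq_sym.
Qed.

(** The rows f_b with s j <= b lie in V_j, and they are independent and as many as the dimension of
    V_j. *)
Lemma rep_affine c y : cell_dom c y -> rep c.1.2 y (affine (coords c y) *m gam c).
Proof.
move=> cy; have [ip tp _] := cy; have [N rN] := rep_exists tp; have [uN hN] := rN.
have [_ uh] := (cell_domP rN tp).1 cy; have fb := frame_basis hE tp.
have uF : affine (coords c y) *m gam c \in unitmx.
  by rewrite unitmx_mul gam_unit andbT affine_unit.
split=> // j; apply/esym/eqP; rewrite eqEdim.
rewrite hN !(dim_rowsub fb) !rank_copid ?sr // leqnn andbT rowsub_le //.
apply/row_subP => b; rewrite row_copid; case: leqP => sb; last by rewrite scale0r sub0mx.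
rewrite scale1r row_mul.
have -> : row b (affine (coords c y)) = proj_row c N b.
  apply/rowP => a; rewrite mxE.
  have [abin|about] := boolP ((a, b) \in cell_pairs r s).
    have kE := enum_rankK_in abin abin.
    have := affine_pair s0 (coords c y) (enum_rank_in abin (a, b)).
    by rewrite kE /= => ->; rewrite mxE kE /= (cell_coordE _ _ cy rN).
  rewrite (affine_other _ about) proj_row_shape //.
  by move: about; rewrite inE /= -leqNgt.
rewrite /proj_row mulmxKV ?gam_unit // -mulmxA.
apply: submx_trans (submxMl _ _) _; apply: copid_le; apply: s_le smono _ _ _.
exact: le_block.
Qed.

Lemma cell_cover_flag y : (exists i, @dom _ _ A i (flag_base y)) ->
  (exists t, @tdom _ _ A U t (flag_base y)) -> exists c, cell_dom c y.
Proof.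
move=> [i ip] [t tp]; have [N rN] := rep_exists tp; have uN := rN.1.
have uNT : N^T \in unitmx by rewrite unitmx_tr.
(* A basis adapted to the flag serves as its own cell frame: its first s j vectors are complementary
   to the remaining ones, which span V_j. *)
pose c : cell U r := (i, t, exist _ N^T uNT); exists c.
apply/(cell_domP (c := c) rN tp); split=> // j.
have -> : hat (s j) (gam c) N = N by rewrite /hat /gam /= trmxK -mulmxDl addrC subrK mul1mx.
exact: uN.
Qed.

Lemma cell_chart_inj c : {in @cell_dom _ _ _ _ _ E _ s c &, injective (@cell_chart _ _ _ _ _ E _ s c)}.
Proof.
move=> y y'; rewrite !inE => cy cy' /eq_row_mx [zE wE].
have [ip tp _] := cy; have [ip' _ _] := cy'.
have bE : flag_base y = flag_base y'.
  by have [inj _ _] := chA; apply: (inj c.1.1); rewrite ?inE.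
have r1 := rep_affine cy; have r2 := rep_affine cy'.
have {}wE : coords c y = coords c y' by [].
by rewrite -wE in r2; exact: flag_ext r1 r2 bE.
Qed.

End Cells.

Lemma differentiable_mx (K : numFieldType) (V : normedModType K) p q
    (F : V -> 'M[K]_(p, q)) z :
  (forall j k, differentiable (fun x => F x j k : K) z) -> differentiable F z.
Proof.
move=> dF; rewrite (_ : F = \sum_(j < p) \sum_(k < q) (fun x => F x j k *: delta_mx j k)).
  apply: differentiable_sum => j; apply: differentiable_sum => k; exact: differentiableZl.
apply/funext => x; rewrite fct_sumE [LHS]matrix_sum_delta; apply: eq_bigr => j _.
by rewrite fct_sumE.
Qed.

Section FlagAtlas.
Variables (R : realType) (n : nat) (A : atlas R n) (U : frame_cover A) (r : nat).
Local Notation C := (cplx R).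
Local Notation X := (points A).
Variables (E : bundle U r) (m : nat) (s : 'I_m.+1 -> nat).
Hypotheses (chA : charted A) (hE : holomorphic_bundle E).
Hypotheses (s0 : s ord0 = 0%N) (sm : s ord_max = r).
Hypothesis smono : forall j j' : 'I_m.+1, (j < j')%N -> (s j < s j')%N.

Local Notation flagE := (flag E s).
Local Notation np := #|cell_pairs r s|.
Local Notation N := (n + np)%N.
Local Notation cchart := (@cell_chart _ _ _ _ _ E _ s).
Local Notation cdom := (@cell_dom _ _ _ _ _ E _ s).
Implicit Types (y : flagE) (c : cell U r) (x : 'rV[C]_N).

Let sr j : (s j <= r)%N := s_ler sm smono j.

(* The flag with coordinates x in the cell c, in the frame of the cell c'. *)
Definition moved c c' x : 'M[C]_r :=
  affine (rsubmx x : 'rV[C]_np) *m gam c *m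
  invmx (trans_chart E c.1.1 c.1.2 c'.1.2 (lsubmx x)).

Lemma rep_moved c c' y : cdom c y -> tdom c'.1.2 (flag_base y) ->
  rep c'.1.2 y (moved c c' (cchart c y)).
Proof.
move=> cy tp'; have [ip tp _] := cy.
rewrite /moved cell_chartE row_mxKl row_mxKr trans_chartE //.
exact: (rep_trans hE tp tp' (rep_affine hE s0 sm smono cy)).
Qed.

Definition base_overlap c c' : set 'rV[C]_n :=
  chart c.1.1 @` ((@tdom _ _ A U c.1.2 : set X) `&` @tdom _ _ A U c'.1.2
    `&` @dom _ _ A c'.1.1 `&` dom c.1.1).

(** A single function whose nonvanishing says that the flag lies in the cell [c'], provided its base
    point does. *)
Definition hat_prod c c' x : C := \prod_j \det (hat (s j) (gam c') (moved c c' x)).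

Definition overlap c c' : set 'rV[C]_N :=
  [set x | base_overlap c c' (lsubmx x) /\ hat_prod c c' x != 0].

Lemma hat_prodP c c' x : hat_prod c c' x != 0 <->
  forall j, hat (s j) (gam c') (moved c c' x) \in unitmx.
Proof.
rewrite /hat_prod prodf_seq_neq0; split=> [/allP h j|h].
  by have := h j (mem_index_enum j); rewrite unitmxE unitfE.
by apply/allP => j _; have := h j; rewrite unitmxE unitfE.
Qed.

(** The affine coordinates in [c] are unrestricted, so the overlap is cut out by a condition on the
    base point and the nonvanishing of one function; openness follows by continuity. *)
Lemma overlapE c c' : cchart c @` (cdom c `&` cdom c') = overlap c c'.
Proof.
apply/seteqP; split=> [_ [y [cy cy'] <-]|x [[p [[[tp tp'] ip'] ip] px] hx]].
  have [ip tp _] := cy; have [ip' tp' _] := cy'; split.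
    by rewrite cell_chartE row_mxKl; exists (flag_base y).
  apply/hat_prodP; exact: ((cell_domP hE sm smono (rep_moved cy tp') tp').1 cy').2.
have uF : affine (rsubmx x : 'rV[C]_np) *m gam c \in unitmx.
  by rewrite unitmx_mul gam_unit andbT; exact: (affine_unit s0).
have [y yp ry] := flag_of hE s0 sm smono tp uF.
have tpy : tdom c.1.2 (flag_base y) by rewrite yp.
have tpy' : tdom c'.1.2 (flag_base y) by rewrite yp.
have cy : cdom c y.
  apply/(cell_domP hE sm smono ry tpy); rewrite yp; split; first exact: ip.
  move=> j; exact: (affine_hat_unit s0 (rsubmx x : 'rV[C]_np) j (gam_unit c)).
have xE : cchart c y = x.
  by rewrite cell_chartE (coords_affine hE s0 sm smono cy ry) yp px hsubmxK.
exists y => //; split=> //.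
apply/(cell_domP hE sm smono (rep_moved cy tpy') tpy'); rewrite yp xE; split; first exact: ip'.
exact/hat_prodP.
Qed.

Lemma base_overlap_open c c' : open (base_overlap c c').
Proof.
apply: (chart_image_open chA); apply: openI; last exact: (dom_open chA).
apply: openI; exact: (tdom_open hE).
Qed.

Definition over_base (B : set 'rV[C]_n) : set 'rV[C]_N := [set x | B (lsubmx x)].

Lemma over_base_open B : open B -> open (over_base B).
Proof. by move=> oB; apply: open_comp oB => x _; exact: continuous_lsubmx. Qed.

Lemma base_overlap2 c c' z : base_overlap c c' z -> base_dom2 c.1.1 c.1.2 c'.1.2 z.
Proof. by move=> [p [[[tp tp'] ip'] ip] <-]; exists p. Qed.

Section Classes.
Variables (c c' : cell U r) (D : set 'rV[C]_N) (P : ('rV[C]_N -> C) -> Prop).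
Hypotheses (PC : fun_class D P) (Pcoord : forall k, P (fun x => x 0 k)).
Hypothesis DB : forall x, D x -> base_dom2 c.1.1 c.1.2 c'.1.2 (lsubmx x).
Hypothesis Ptrans : mx_class P (fun x => trans_chart E c.1.1 c.1.2 c'.1.2 (lsubmx x)).

(** Here and below the class is arbitrary: continuity gives open overlaps, complex differentiability
    the holomorphic atlas and bundles, smoothness the metric. *)
Lemma affine_class : mx_class P (fun x => affine (rsubmx x : 'rV[C]_np)).
Proof.
apply: (mx_classD PC); first exact: (mx_class_cst PC).
move=> b a; apply: (fc_ext PC (f := fun x => \sum_k x 0 (rshift n k) *
    delta_mx (enum_val k).2 (enum_val k).1 b a)).
  apply: (fc_sum PC) => k; apply: (fcM PC) => //; exact: (fc_cst PC).
by move=> x _; rewrite summxE; apply: eq_bigr => k _; rewrite !mxE.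
Qed.

Lemma moved_class : mx_class P (moved c c').
Proof.
apply: (mx_classM PC); first apply: (mx_classM PC affine_class); first exact: (mx_class_cst PC).
by apply: (mx_class_inv PC Ptrans) => x /DB; exact: trans_chart_unit.
Qed.

Lemma hat_class j : mx_class P (fun x => hat (s j) (gam c') (moved c c' x)).
Proof.
apply: (mx_classD PC); first exact: (mx_class_cst PC).
by apply: (mx_classM PC) moved_class; exact: (mx_class_cst PC).
Qed.

Lemma hat_prod_class : P (hat_prod c c').
Proof. by apply: (fc_prod PC) => j; apply: (fc_det PC); exact: hat_class. Qed.

Lemma theta_class j : (forall x, D x -> hat_prod c c' x != 0) ->
  mx_class P (fun x => theta (s j) (gam c') (moved c c' x)).
Proof.
move=> h; apply: (mx_classM PC); last exact: (mx_class_cst PC).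
by apply: (mx_class_inv PC (hat_class j)) => x /h /hat_prodP.
Qed.

Lemma proj_row_class b a : (forall x, D x -> hat_prod c c' x != 0) ->
  P (fun x => proj_row s c' (moved c c' x) b 0 a).
Proof.
move=> h; have cst p q (M : 'M[C]_(p, q)) : mx_class P (fun=> M) by exact: (mx_class_cst PC).
have uh x : D x -> hat (s (block s b)) (gam c') (moved c c' x) \in unitmx.
  by move=> /h /hat_prodP.
have k1 := mx_class_inv PC (hat_class (block s b)) uh.
exact: (mx_classM PC (mx_classM PC (mx_classM PC (mx_classM PC (cst _ _ _) k1) (cst _ _ _))
  moved_class) (cst _ _ _) 0 a).
Qed.

End Classes.

Lemma over_overlap_dom2 c c' x : over_base (base_overlap c c') x ->
  base_dom2 c.1.1 c.1.2 c'.1.2 (lsubmx x).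
Proof. exact: base_overlap2. Qed.

Lemma trans_lsubmx_diff c c' a b x : over_base (base_overlap c c') x ->
  differentiable (fun x => trans_chart E c.1.1 c.1.2 c'.1.2 (lsubmx x) a b) x.
Proof.
move=> /over_overlap_dom2 Bx.
have d1 := trans_chart_holo hE a b Bx.
exact: (differentiable_comp (@differentiable_lsubmx _ 1 n np x) d1).
Qed.

Lemma overlap_open c c' : open (overlap c c').
Proof.
have oB := over_base_open (@base_overlap_open c c').
have SC := @continuous_class R _ _ oB.
have cp : forall x, over_base (base_overlap c c') x -> {for x, continuous (hat_prod c c')}.
  apply: (hat_prod_class SC).
  - by move=> k x _; exact: coord_continuous.
  - exact: over_overlap_dom2.
  - by move=> a b x Bx; exact: differentiable_continuous (trans_lsubmx_diff a b Bx).
rewrite openE => x [Bx hx].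
have n1 : nbhs x (over_base (base_overlap c c')) by exact: open_nbhs_nbhs.
have n2 : \forall z \near x, hat_prod c c' z != 0.
  have cx : hat_prod c c' z @[z --> x] --> hat_prod c c' x by exact: cp.
  exact: (cvgr_neq0 _ cx hx).
by apply: filterS2 n1 n2 => z Bz hz; split.
Qed.

Definition new_coords c c' x : 'rV[C]_np :=
  \row_k proj_row s c' (moved c c' x) (enum_val k).2 0 (enum_val k).1.

Lemma cell_chart_transition c c' y : cdom c y -> cdom c' y ->
  cchart c' y = row_mx (in_chart c.1.1 (@chart _ _ A c'.1.1) (lsubmx (cchart c y)))
    (new_coords c c' (cchart c y)).
Proof.
move=> cy cy'; have [ip tp _] := cy; have [ip' tp' _] := cy'.
have zE : lsubmx (cchart c y) = chart c.1.1 (flag_base y) by rewrite cell_chartE row_mxKl.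
have wE : coords c' y = new_coords c c' (cchart c y).
  apply/rowP => k; rewrite [LHS]mxE [RHS]mxE; exact: (cell_coordE hE sm smono _ _ cy' (rep_moved cy tp')).
by rewrite [LHS]cell_chartE wE zE (in_chartE chA).
Qed.

Lemma flag_charted : charted (flag_bundle E s).
Proof.
have inj c : {in cdom c &, injective (cchart c)} by exact: cell_chart_inj.
split=> [//|c c'|c' c y cy cy'].
  by rewrite [X in open X]overlapE; exact: overlap_open.
have oO := @overlap_open c c'; have Oy : overlap c c' (cchart c y).
  by rewrite -overlapE; exists y.
(* The transition map written out: a base transition on the first coordinates, and projections
   rational in the affine coordinates and the transition matrix on the others. *)
pose F x := row_mx (in_chart c.1.1 (@chart _ _ A c'.1.1) (lsubmx x)) (new_coords c c' x).
apply: (@eq_differentiable _ _ _ F).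
  apply: filterS (open_nbhs_nbhs (conj oO Oy)) => x.
  rewrite -overlapE => -[q [cq cq'] <-].
  rewrite (@in_chart_inj _ _ (flag_bundle E s) _ _ c q (inj c) cq).
  exact: esym (cell_chart_transition cq cq').
have SC := differentiable_class oO.
apply: differentiable_mx => j k; rewrite (ord1 j) {j}; case: (split_ordP k) => l ->.
  rewrite (_ : (fun x => _) = (fun M : 'rV[C]_n => M 0 l) \o
      (in_chart c.1.1 (@chart _ _ A c'.1.1) \o lsubmx)); last first.
    by apply/funext => x; rewrite /F row_mxEl.
  have [_ _ hol] := chA; have [ip _ _] := cy; have [ip' _ _] := cy'.
  have d1 := hol c'.1.1 c.1.1 _ ip ip'.
  have zE : lsubmx (cchart c y) = chart c.1.1 (flag_base y) by rewrite cell_chartE row_mxKl.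
  rewrite -zE in d1.
  apply: differentiable_comp; last exact: differentiable_coord.
  exact: (differentiable_comp (@differentiable_lsubmx _ 1 n np _) d1).
rewrite (_ : (fun x => _) = (fun x => proj_row s c' (moved c c' x) (enum_val l).2 0 (enum_val l).1)); last first.
  by apply/funext => x; rewrite /F row_mxEr mxE.
apply: (proj_row_class SC) Oy => //.
- by move=> i x _; exact: differentiable_coord.
- by move=> x [/base_overlap2].
- by move=> a b x [Bx _]; exact: trans_lsubmx_diff.
- by move=> x [].
Qed.

End FlagAtlas.

(** * Topology of the flag bundle *)

(** Each determinant is a nonzero polynomial in t. Their product has finitely many roots, while the
    field contains infinitely many integers. *)
Lemma generic_point (K : numFieldType) r (I : finType) (M D : I -> 'M[K]_r) :
  (forall i, exists t, \det (M i + t *: D i) != 0) ->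
  exists t, forall i, \det (M i + t *: D i) != 0.
Proof.
move=> h; pose P i := \det (map_mx polyC (M i) + 'X *: map_mx polyC (D i)).
have PE i t : (P i).[t] = \det (M i + t *: D i).
  rewrite -horner_evalE -det_map_mx; congr (\det _); apply/matrixP => a b.
  by rewrite !mxE /= horner_evalE !hornerE.
have P0 : \prod_i P i != 0.
  rewrite prodf_seq_neq0; apply/allP => i _; apply/implyP => _.
  have [t ht] := h i; apply: contraNneq ht => Pi0.
  by rewrite -PE Pi0 horner0.
pose rs := [seq (k%:R : K) | k <- iota 0 (size (\prod_i P i))].
have : ~~ all (root (\prod_i P i)) rs.
  apply/negP => allr; have := max_poly_roots P0 allr.
  rewrite map_inj_uniq ?iota_uniq; last by move=> a b /eqP; rewrite eqr_nat => /eqP.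
  by rewrite size_map size_iota ltnn => /(_ isT).
rewrite -has_predC => /hasP[t _ /= /negbTE]; rewrite rootE horner_prod => /negbT.
rewrite prodf_seq_neq0 => /allP ht; exists t => i; rewrite -PE.
exact: (implyP (ht i (mem_index_enum i)) isT).
Qed.

Lemma ultra_fmap (T T' : Type) (f : T -> T') (F : set_system T) :
  UltraFilter F -> UltraFilter (f @ F).
Proof.
move=> UF; split; first exact: fmap_proper_filter.
move=> G PG FG; apply/seteqP; split=> // S GS.
have [//|FnS] := in_ultra_setVsetC (f @^-1` S) UF.
have /FG GnS : (f @ F) (~` S) by [].
have := @filterI _ G (@filter_filter _ _ PG) _ _ GS GnS; rewrite setICr.
by move=> /(@filter_not_empty _ G PG).
Qed.

Section UltraLimits.
Variables (R : realType) (T : Type) (F : set_system T).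
Hypothesis UF : UltraFilter F.
Local Notation C := (cplx R).

Let FF : Filter F := @filter_filter _ _ (@ultra_proper _ _ UF).

Lemma ultra_real_limit (f : T -> R) : (forall q, `|f q| <= 1) ->
  exists a : R, f x @[x --> F] --> a.
Proof.
move=> f1; have := @segment_compact R (-1) 1; rewrite compact_ultra => h.
have [||a [_ fa]] := h (f @ F); first exact: ultra_fmap.
  by apply: (@filterE _ F FF) => q /=; rewrite in_itv /= -ler_norml.
by exists a.
Qed.

Lemma ultra_cplx_limit (f : T -> C) : (forall q, `|f q| <= 1) ->
  exists a : C, f x @[x --> F] --> a.
Proof.
move=> f1.
have [|a ha] := @ultra_real_limit (fun q => complex.Re (f q)).
  by move=> q; rewrite -lecR; exact: le_trans (normc_ge_Re _) (f1 q).
have [|b hb] := @ultra_real_limit (fun q => complex.Im (f q)).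
  by move=> q; rewrite -lecR; exact: le_trans (normc_ge_Im _) (f1 q).
exists ((a%:C)%C + 'i * (b%:C)%C).
have fE : f = (fun q => (complex.Re (f q))%:C%C + 'i * (complex.Im (f q))%:C%C :> C).
  by apply/funext => q; exact: complexE.
have cC (g : T -> R) (x : R) : g q @[q --> F] --> x -> ((g q)%:C)%C @[q --> F] --> ((x%:C)%C : C).
  by move=> gx; exact: (cvg_comp _ _ gx (@real_complex_continuous R x)).
rewrite fE; apply: cvgD; first exact: (cC _ _ ha).
apply: cvgM; first exact: cvg_cst.
exact: (cC _ _ hb).
Qed.

End UltraLimits.

(** Convergence along a filter obeys the rules of a function class, so limits of determinants and of
    inverse matrices come from the general lemmas. *)
Lemma cvg_class (R : realType) (T S : Type) (F : set_system T) (FF : Filter F)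
   (D : set S) (g : T -> S) (x0 : S) : 
  D x0 -> F (g @^-1` D) ->
  fun_class D (fun f : S -> cplx R => f (g x) @[x --> F] --> f x0).
Proof.
move=> Dx Dg; split.
- by move=> a; exact: cvg_cst.
- by move=> f1 f2 h1 h2; exact: (cvgD h1 h2).
- by move=> f1 f2 h1 h2; exact: (cvgM h1 h2).
- by move=> f hf f0; exact: (cvgV (f0 _ Dx) hf).
- move=> f1 f2 h1 h12; rewrite -(h12 _ Dx); apply: cvg_trans h1.
  apply: (@near_eq_cvg _ _ F FF); apply: (@filterS _ F FF _ _ _ Dg) => q Dq.
  exact: h12.
Qed.

Lemma cluster_map (T T' : topologicalType) (f : T -> T') p q :
  {for p, continuous f} -> {for q, continuous f} ->
  cluster (nbhs p) q -> cluster (nbhs (f p)) (f q).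
Proof.
move=> cp cq h S S' Sp Sq; have [x [Sx S'x]] := h _ _ (cp _ Sp) (cq _ Sq).
by exists (f x).
Qed.

Section FlagTopology.
Variables (R : realType) (n : nat) (A : atlas R n) (U : frame_cover A) (r : nat).
Local Notation C := (cplx R).
Local Notation X := (points A).
Variables (E : bundle U r) (m : nat) (s : 'I_m.+1 -> nat).
Hypotheses (chA : charted A) (hE : holomorphic_bundle E).
Hypothesis coverA : forall p, exists i, @dom _ _ A i p.
Hypotheses (s0 : s ord0 = 0%N) (sm : s ord_max = r).
Hypothesis smono : forall j j' : 'I_m.+1, (j < j')%N -> (s j < s j')%N.

Local Notation FB := (flag_bundle E s).
Local Notation np := #|cell_pairs r s|.
Local Notation N := (n + np)%N.
Local Notation cchart := (@cell_chart _ _ _ _ _ E _ s).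
Local Notation cdom := (@cell_dom _ _ _ _ _ E _ s).
Implicit Types (y : points FB) (c : cell U r).

Let chF : charted FB := flag_charted chA hE s0 sm smono.

Lemma frame_cover_at (p : X) : exists t, @tdom _ _ A U t p.
Proof. by case: hE => [[_]]. Qed.

Lemma cell_cover_at y : exists c, cdom c y.
Proof. exact: (cell_cover_flag hE s0 sm smono (coverA _) (frame_cover_at _)). Qed.

Lemma flag_base_continuous y : {for y, continuous (@flag_base _ _ _ _ _ E _ s : points FB -> X)}.
Proof.
have [c cy] := cell_cover_at y; have [ip tp _] := cy.
have nc : nbhs y (cdom c) by apply: open_nbhs_nbhs; split; last exact: cy; exact: (@dom_open _ _ FB chF c).
apply: (@cvg_chart _ _ A _ c.1.1 (flag_base y) _ ip).
- exact: (fmap_filter _ (nbhs_filter (y : points FB))).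
- by apply: (@filterS _ (nbhs y) _ _ _ _ nc) => q [].
have cc : cchart c q @[q --> y] --> cchart c y := chart_continuous chF cy.
have bE q : lsubmx (cchart c q) = chart c.1.1 (flag_base q) by rewrite cell_chartE row_mxKl.
have lc : lsubmx (cchart c q) @[q --> y] --> lsubmx (cchart c y).
  exact: (cvg_comp _ _ cc (@continuous_lsubmx _ 1 n np (cchart c y))).
rewrite bE in lc; apply: cvg_trans lc; apply: (@near_eq_cvg _ _ (nbhs y)).
by apply: nearW => q; rewrite bE.
Qed.

(* A generic frame on the line through representatives of y and y'. *)
Lemma common_cell y y' : flag_base y = flag_base y' -> exists c, cdom c y /\ cdom c y'.
Proof.
move=> yy; have [t tp] := frame_cover_at (flag_base y).
have [i ip] := coverA (flag_base y).
have [M rM] := rep_exists hE s0 sm smono tp.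
have tp' : tdom t (flag_base y') by rewrite -yy.
have [M' rM'] := rep_exists hE s0 sm smono tp'.
have [uM _] := rM; have [uM' _] := rM'.
have hatN q : hat q M M = M by rewrite /hat -mulmxDl addrC subrK mul1mx.
have hatN' q : hat q M' M' = M' by rewrite /hat -mulmxDl addrC subrK mul1mx.
have hatL q (L : 'M[C]_r) x : hat q (M + x *: (M' - M)) L =
    hat q M L + x *: ((pid_mx q : 'M[C]_r) *m (M' - M)).
  by rewrite /hat mulmxDr -scalemxAr addrAC.
have MM' : M + 1 *: (M' - M) = M' by rewrite scale1r addrC subrK.
pose I : finType := (bool * 'I_m.+1)%type.
have [|x hx] := @generic_point C r I
    (fun bj => hat (s bj.2) M (if bj.1 then M else M'))
    (fun bj => (pid_mx (s bj.2) : 'M[C]_r) *m (M' - M)).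
  (* The line of frames passes through [M] at parameter 0 and through [M'] at 1, and each is a good
     frame for its own flag. So no determinant in the family vanishes identically. *)
  move=> [b j] /=; case: b.
    by exists 0; rewrite scale0r addr0 hatN -unitfE -unitmxE.
  by exists 1; rewrite -hatL MM' hatN' -unitfE -unitmxE.
pose g := M + x *: (M' - M).
have ug L (b : bool) j : L = (if b then M else M') -> hat (s j) g L \in unitmx.
  by move=> ->; rewrite unitmxE unitfE hatL; exact: (hx (b, j)).
(* At the last index s = r, so [hat] is [g] itself. *)
have g_unit : g \in unitmx.
  have := ug M true ord_max erefl; rewrite sm /hat /copid_mx pid_mx_1 subrr mul0mx addr0.
  by rewrite mul1mx.
have gT : g^T \in unitmx by rewrite unitmx_tr.
pose c : cell U r := (i, t, exist _ g^T gT).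
have gc : gam c = g by rewrite /gam trmxK.
exists c; split.
  refine ((cell_domP (c := c) hE sm smono rM tp).2 (conj ip _)) => j.
  by rewrite gc; exact: (ug M true).
have ip' : dom i (flag_base y') by rewrite -yy.
refine ((cell_domP (c := c) hE sm smono rM' tp').2 (conj ip' _)) => j.
by rewrite gc; exact: (ug M' false).
Qed.

(** Inseparable flags have inseparable, hence equal, base points. They then lie in a common cell,
    whose chart is continuous and injective. *)
Lemma flag_hausdorff : hausdorff_space X -> hausdorff_space (points FB).
Proof.
move=> hX y y' cl.
have bE : flag_base y = flag_base y'.
  by apply: hX; apply: cluster_map cl; exact: flag_base_continuous.
have [c [cy cy']] := common_cell bE.
have [inj _ _] := chF; apply: (inj c); rewrite ?inE //.
apply: norm_hausdorff; apply: cluster_map cl; exact: (chart_continuous chF).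
Qed.

Lemma unitary_entry (K : numClosedFieldType) p (M : 'M[K]_p) a b :
  (M *m M ^t*)%sesqui = 1%:M -> `|M a b| <= 1.
Proof.
move=> /matrixP /(_ a a); rewrite [LHS]mxE [RHS]mxE eqxx => h.
rewrite -(@ler_pXn2r _ 2) ?nnegrE // expr1n -[X in _ <= X]h (bigD1 b) //=.
rewrite !mxE -normCK lerDl; apply: sumr_ge0 => k _; rewrite !mxE -normCK.
exact: exprn_ge0.
Qed.

Lemma unitary_det_norm (K : numClosedFieldType) p (M : 'M[K]_p) :
  (M *m M ^t*)%sesqui = 1%:M -> `|\det M| = 1.
Proof.
move=> h; apply/eqP; rewrite -(@eqrXn2 _ 2) // expr1n normCK.
have := congr1 determinant h; rewrite det_mulmx det1 det_map_mx det_tr => dd.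
by apply/eqP; exact: dd.
Qed.

(* Flags have unitary representatives, whose entries are bounded. *)
Lemma flag_compact : compact [set: X] -> compact [set: points FB].
Proof.
rewrite (@compact_ultra X) (@compact_ultra (points FB)) => cX F UF _.
have PF : ProperFilter F := @ultra_proper _ _ UF.
have FF : Filter F := @filter_filter _ _ PF.
have UbF := ultra_fmap (@flag_base _ _ _ _ _ E _ s : points FB -> X) UF.
have [p [_ bp]] := cX _ UbF filterT.
have [t tp] := frame_cover_at p; have [i ip] := coverA p.
have Ft : F [set q : points FB | tdom t (flag_base q)].
  by apply: bp; apply: open_nbhs_nbhs; split=> //; exact: (tdom_open hE).
have Fi : F [set q : points FB | dom i (flag_base q)].
  by apply: bp; apply: open_nbhs_nbhs; split=> //; exact: (dom_open chA).
have hN (q : points FB) : exists L : 'M[C]_r,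
    (L *m L ^t*)%sesqui = 1%:M /\ (tdom t (flag_base q) -> rep t q L).
  have [tq|ntq] := pselect (tdom t (flag_base q)).
    by have [L rL uL] := unitary_rep hE s0 sm smono tq; exists L.
  (* An arbitrary unitary value off the domain of the frame, so that the bounds on entries hold for
     every q. *)
  by exists 1%:M; split=> //; rewrite trmx1 map_mx1 mulmx1.
have [M hM] := choice hN.
have [M0 hM0] : exists M0 : 'M[C]_r, forall a b, M q a b @[q --> F] --> M0 a b.
  have h ab : exists l : C, M q ab.1 ab.2 @[q --> F] --> l.
    by apply: (ultra_cplx_limit UF) => q; apply: unitary_entry; case: (hM q).
  have [l hl] := choice h; exists (\matrix_(a, b) l (a, b)) => a b.
  by rewrite mxE; exact: hl (a, b).
have PT := @cvg_class R _ _ F FF setT M M0 I (@filterT _ F FF).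
have dM : \det (M q) @[q --> F] --> \det M0 by exact: (fc_det PT (A := fun L => L) hM0).
(* Determinants of unitary matrices have modulus 1, so they cannot tend to 0. *)
have uM0 : M0 \in unitmx.
  rewrite unitmxE unitfE; apply/negP => /eqP d0; rewrite d0 in dM.
  have := @cvgr0_norm_lt _ _ _ F FF _ dM 1 ltr01 => /(@filter_ex _ F PF)[q].
  by rewrite unitary_det_norm ?ltxx //; case: (hM q).
have gT : M0^T \in unitmx by rewrite unitmx_tr.
(* The limit matrix serves as cell frame. This cell contains the flag of [M0] and, the cell
   condition being open, almost all flags of the ultrafilter; convergence can then be checked in its
   chart. *)
pose c : cell U r := (i, t, exist _ M0^T gT).
have gc : gam c = M0 by rewrite /gam trmxK.
have hatM0 q : hat q M0 M0 = M0 by rewrite /hat -mulmxDl addrC subrK mul1mx.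
have hat_cls j (D : set 'M[C]_r) (P : ('M[C]_r -> C) -> Prop) : fun_class D P ->
    (forall a b, P (fun L => L a b)) -> mx_class P (fun L => hat (s j) M0 L).
  move=> PC Pab; apply: (mx_classD PC); first exact: (mx_class_cst PC).
  by apply: (mx_classM PC) => //; exact: (mx_class_cst PC).
have dH : \prod_j \det (hat (s j) M0 (M q)) @[q --> F] -->
    \prod_j \det (hat (s j) M0 M0).
  refine (@fc_prod _ _ _ _ PT _ (index_enum 'I_m.+1) predT (fun j L => \det (hat (s j) M0 L)) _) => j.
  exact: (fc_det PT (hat_cls j _ _ PT hM0)).
pose D : set 'M[C]_r := [set L | forall j, hat (s j) M0 L \in unitmx].
have hatP L : \prod_j \det (hat (s j) M0 L) != 0 -> D L.
  rewrite prodf_seq_neq0 => /allP h j; rewrite unitmxE unitfE.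
  exact: (implyP (h j (mem_index_enum j)) isT).
have FD : F (M @^-1` D).
  have n0 : \prod_j \det (hat (s j) M0 M0) != 0.
    rewrite prodf_seq_neq0; apply/allP => j _; apply/implyP => _.
    by rewrite hatM0 -unitfE -unitmxE.
  apply: (@filterS _ F FF _ _ _ (@cvgr_neq0 _ _ _ F FF _ _ dH n0)) => q; exact: hatP.
have DM0 : D M0 by move=> j; rewrite hatM0.
have Fc : F (cdom c).
  have FI := @filterI _ F FF _ _ Ft (@filterI _ F FF _ _ Fi FD).
  apply: (@filterS _ F FF _ _ _ FI) => q [tq [iq Dq]].
  refine ((cell_domP (c := c) hE sm smono ((hM q).2 tq) tq).2 (conj iq _)) => j.
  by rewrite gc; exact: Dq.
have [y0 by0 ry0] := flag_of hE s0 sm smono tp uM0.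
have tp0 : tdom t (flag_base y0) by rewrite by0.
have cy0 : cdom c y0.
  have ip0 : dom i (flag_base y0) by rewrite by0.
  refine ((cell_domP (c := c) hE sm smono ry0 tp0).2 (conj ip0 _)) => j.
  by rewrite gc hatM0.
exists y0; split=> //.
apply: (@cvg_chart _ _ FB F c y0 FF cy0 Fc).
have PD := @cvg_class R _ _ F FF D M M0 DM0 FD.
have prc b a : proj_row s c (M q) b 0 a @[q --> F] --> proj_row s c M0 b 0 a.
  have cst p' q' (L : 'M[C]_(p', q')) := mx_class_cst PD L.
  have ih : mx_class _ (fun L => invmx (hat (s (block s b)) M0 L)) :=
    mx_class_inv PD (hat_cls (block s b) _ _ PD hM0) (fun L DL => DL (block s b)).
  rewrite /proj_row gc.
  exact: (mx_classM PD (mx_classM PD (mx_classM PD (mx_classM PD (cst _ _ _) ih) (cst _ _ _))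
    (hM0 : mx_class _ id)) (cst _ _ _) 0 a).
apply: (@cvg_mx_entry R 1 N _ F FF) => i0 k; rewrite (ord1 i0) {i0}.
case: (split_ordP k) => l ->.
  have bi : chart i (flag_base q) @[q --> F] --> chart i p.
    have ci : chart i x @[x --> p] --> chart i p := chart_continuous chA ip.
    exact: cvg_trans (cvg_app _ bp) ci.
  have cE (q : points FB) : cchart c q 0 (lshift np l) = chart i (flag_base q) 0 l.
    by rewrite cell_chartE row_mxEl.
  change (cchart c q 0 (lshift np l) @[q --> F] --> cchart c y0 0 (lshift np l)).
  rewrite (funext cE) cE by0.
  exact: (cvg_comp _ _ bi (@coord_continuous _ _ _ 0 l _)).
have cE (q : points FB) : cchart c q 0 (rshift n l) =
    cell_coord c q (enum_val l).1 (enum_val l).2.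
  by rewrite cell_chartE row_mxEr mxE.
change (cchart c q 0 (rshift n l) @[q --> F] --> cchart c y0 0 (rshift n l)).
rewrite (funext cE) cE (cell_coordE hE sm smono _ _ cy0 ry0).
apply: cvg_trans (prc _ _); apply: (@near_eq_cvg _ _ F FF).
have FI := @filterI _ F FF _ _ Ft Fc.
apply: (@filterS _ F FF _ _ _ FI) => q [tq cq].
by rewrite (cell_coordE hE sm smono _ _ cq ((hM q).2 tq)).
Qed.

Lemma flag_compact_complex_manifold : hausdorff_space X -> compact [set: X] ->
  compact_complex_manifold FB.
Proof.
move=> hX cX; have [inj ov hol] := chF; split=> //; first exact: cell_cover_at.
split; [exact: flag_hausdorff|exact: flag_compact].
Qed.

End FlagTopology.

(** * Tautological quotients *)

Section HolomorphicFunctions.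
Variables (R : realType) (n : nat) (A : atlas R n).
Local Notation C := (cplx R).
Local Notation X := (points A).
Hypothesis chA : charted A.
Variable D : set X.
Hypothesis oD : open D.

Let im i : set 'rV[C]_n := chart i @` (D `&` dom i).

Lemma holomorphic_onP (V : normedModType C) (f : X -> V) :
  holomorphic_on D f <-> forall i z, im i z -> differentiable (in_chart i f) z.
Proof.
split=> [hf i _ [p [Dp ip] <-]|hf i p ip Dp]; first exact: hf.
by apply: hf; exists p.
Qed.

Lemma holomorphic_class : fun_class D (fun f : X -> C => holomorphic_on D f).
Proof.
have DC i := @differentiable_class R n (im i) (chart_image_open chA oD).
split.
- move=> a; apply/holomorphic_onP => i; apply: (fc_ext (DC i) (fc_cst (DC i) a)).
  by move=> _ [p [_ ip] <-]; rewrite (in_chartE chA).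
- move=> f g /holomorphic_onP hf /holomorphic_onP hg; apply/holomorphic_onP => i.
  apply: (fc_ext (DC i) (fcD (DC i) (hf i) (hg i))).
  by move=> _ [p [_ ip] <-]; rewrite !(in_chartE chA).
- move=> f g /holomorphic_onP hf /holomorphic_onP hg; apply/holomorphic_onP => i.
  apply: (fc_ext (DC i) (fcM (DC i) (hf i) (hg i))).
  by move=> _ [p [_ ip] <-]; rewrite !(in_chartE chA).
- move=> f /holomorphic_onP hf f0; apply/holomorphic_onP => i.
  have f0' z : im i z -> in_chart i f z != 0.
    by move=> [p [Dp ip] <-]; rewrite (in_chartE chA) // f0.
  apply: (fc_ext (DC i) (fcV (DC i) (hf i) f0')).
  by move=> _ [p [_ ip] <-]; rewrite !(in_chartE chA).
- move=> f g /holomorphic_onP hf fg; apply/holomorphic_onP => i.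
  apply: (fc_ext (DC i) (hf i)).
  by move=> _ [p [Dp ip] <-]; rewrite !(in_chartE chA) // fg.
Qed.

Lemma holomorphic_mx p q (T : X -> 'M[C]_(p, q)) :
  holomorphic_on D T <-> mx_class (fun f : X -> C => holomorphic_on D f) T.
Proof.
have DC i := @differentiable_class R n (im i) (chart_image_open chA oD).
split=> [/holomorphic_onP hT a b|hT]; apply/holomorphic_onP => i.
  apply: (fc_ext (DC i) (f := fun z => in_chart i T z a b)) => [z Oz|].
    exact: (differentiable_comp (hT i z Oz) (differentiable_coord _ _ _)).
  by move=> _ [x [_ ix] <-]; rewrite !(in_chartE chA).
move=> z Oz; apply: (@eq_differentiable _ _ _ (fun z => \matrix_(a, b) in_chart i (fun x => T x a b : C) z)).
  apply: filterS (open_nbhs_nbhs (conj (chart_image_open chA oD) Oz)).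
  move=> _ [x [_ ix] <-]; apply/matrixP => a b; rewrite mxE.
  by rewrite !(in_chartE chA).
apply: differentiable_mx => a b.
rewrite (_ : (fun x => _) = in_chart i (fun x => T x a b : C)).
  by have /holomorphic_onP := hT a b; apply.
by apply/funext => x; rewrite mxE.
Qed.

End HolomorphicFunctions.

Section LineBundles.
Variables (R : realType) (n : nat) (A : atlas R n) (U : frame_cover A).
Local Notation C := (cplx R).
Local Notation X := (points A).
Hypothesis chA : charted A.
Implicit Types (L : line_bundle U) (t : tindex U).

Let oU2 : open_frame_cover U -> forall t t', open (@tdom _ _ A U t `&` @tdom _ _ A U t').
Proof. by move=> [oU _] t t'; apply: openI; exact: oU. Qed.

Lemma holomorphic_det_bundle r (E : bundle U r) : holomorphic_bundle E ->
  holomorphic_line_bundle (det_bundle E).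
Proof.
move=> hE; have [cU _ hT] := hE.
have dE t t' p : det_bundle E t t' p = \det (trans E t t' p) by rewrite det_tr.
split=> //.
- by move=> t p tp; rewrite dE (trans_id hE tp) det1.
- move=> t t' t'' p tp tp' tp''.
  by rewrite !dE (trans_mul hE tp tp' tp'') det_mulmx mulrC.
- move=> t t'; have o2 := @oU2 cU t t'.
  have /(holomorphic_mx chA o2) h := hT t t'.
  exact: (fc_det (holomorphic_class chA o2) h).
Qed.

Lemma holomorphic_line_trivial : open_frame_cover U ->
  holomorphic_line_bundle (@line_trivial _ _ _ U).
Proof.
move=> cU; split=> // [t t' t'' p _ _ _|t t']; first exact: mulr1.
exact: (fc_cst (holomorphic_class chA (@oU2 cU t t')) 1).
Qed.

Lemma holomorphic_line_tensor L L' : holomorphic_line_bundle L ->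
  holomorphic_line_bundle L' -> holomorphic_line_bundle (line_tensor L L').
Proof.
move=> [cU L1 Lm Lh] [_ L1' Lm' Lh']; split=> //.
- by move=> t p tp; rewrite /line_tensor L1 // L1' // mulr1.
- by move=> t t' t'' p tp tp' tp''; rewrite /line_tensor mulrACA Lm // Lm'.
- by move=> t t'; exact: (fcM (holomorphic_class chA (@oU2 cU t t')) (Lh t t') (Lh' t t')).
Qed.

Lemma holomorphic_big_tensor (I : Type) (l : seq I) (P : pred I) (L : I -> line_bundle U) :
  open_frame_cover U -> (forall i, P i -> holomorphic_line_bundle (L i)) ->
  holomorphic_line_bundle
    (\big[@line_tensor _ _ _ _/@line_trivial _ _ _ _]_(i <- l | P i) L i).
Proof.
move=> cU hL; apply: big_ind => //; first exact: holomorphic_line_trivial.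
by move=> L1 L2; exact: holomorphic_line_tensor.
Qed.

Lemma big_tensorE (I : Type) (l : seq I) (P : pred I) (L : I -> line_bundle U) t t' p :
  (\big[@line_tensor _ _ _ _/@line_trivial _ _ _ _]_(i <- l | P i) L i) t t' p =
  \prod_(i <- l | P i) L i t t' p.
Proof. exact: (big_morph (fun M : line_bundle U => M t t' p)). Qed.

End LineBundles.

Lemma quotient_map_eq (K : fieldType) (V : vectType K) (W : {vspace V}) u v :
  (quotient_map W u == quotient_map W v) = (u - v \in W).
Proof.
have := quotient_map_linear W (-1) v u; rewrite /= !scaleN1r ![- _ + _]addrC => E.
by rewrite -quotient_map_eq0 E subr_eq0.
Qed.

(** The row [x *m theta] gives the coordinates of the class of [x] modulo V in the frame formed by
    the classes of the first q rows of [g]. *)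
Lemma theta_quotient (K : fieldType) r q (g N : 'M[K]_r) (x : 'rV[K]_r) : (q <= r)%N ->
  hat q g N \in unitmx ->
  (x - x *m theta q g N *m (pid_mx q : 'M[K]_(q, r)) *m g <= copid_mx q *m N)%MS.
Proof.
move=> qr uh; set y := x *m invmx (hat q g N).
have xE : x = y *m pid_mx q *m g + y *m copid_mx q *m N.
  by rewrite -{1}(mulmxKV uh x) -/y [LHS]mulmxDr !mulmxA.
have -> : x *m theta q g N *m (pid_mx q : 'M[K]_(q, r)) *m g = y *m pid_mx q *m g.
  rewrite /theta (mulmxA x) -(mulmxA y (pid_mx q : 'M[K]_(r, q)) (pid_mx q : 'M[K]_(q, r))).
  by rewrite pid_mx_id.
rewrite {1}xE addrAC subrr add0r -mulmxA; exact: submxMl.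
Qed.

Section TautologicalBundles.
Variables (R : realType) (n : nat) (A : atlas R n) (U : frame_cover A) (r : nat).
Local Notation C := (cplx R).
Local Notation X := (points A).
Variables (E : bundle U r) (m : nat) (s : 'I_m.+1 -> nat).
Hypotheses (chA : charted A) (hE : holomorphic_bundle E).
Hypothesis coverA : forall p, exists i, @dom _ _ A i p.
Hypotheses (s0 : s ord0 = 0%N) (sm : s ord_max = r).
Hypothesis smono : forall j j' : 'I_m.+1, (j < j')%N -> (s j < s j')%N.

Local Notation FB := (flag_bundle E s).
Local Notation np := #|cell_pairs r s|.
Local Notation N := (n + np)%N.
Local Notation cchart := (@cell_chart _ _ _ _ _ E _ s).
Local Notation cdom := (@cell_dom _ _ _ _ _ E _ s).
Implicit Types (y : points FB) (c : cell U r) (j : 'I_m.+1).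

Let chF : charted FB := flag_charted chA hE s0 sm smono.
Let sr j : (s j <= r)%N := s_ler sm smono j.

Lemma cell_cover_open : open_frame_cover (cell_cover E s).
Proof.
split; first by move=> c; exact: (@dom_open _ _ FB chF c).
exact: (cell_cover_at hE coverA s0 sm smono).
Qed.

Lemma vec_quotient c y j (x : 'rV[C]_(s j)) :
  vec (frame (taut_quotient E s j) c y) x =
  quotient_map (flag_sub y j) (vec (frame E c.1.2 (flag_base y))
    (x *m (pid_mx (s j) : 'M[C]_(s j, r)) *m gam c)).
Proof.
have lin := @quotient_map_linear _ _ (flag_sub y j).
pose qm : {linear fibre E (flag_base y) -> quotient_space (flag_sub y j)} :=
  HB.pack (quotient_map (flag_sub y j)) (GRing.isLinear.Build _ _ _ _ _ lin).
rewrite -[RHS]/(qm _) -(vec_change (cell_frameE E c (flag_base y))) /vec linear_sum.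
under [RHS]eq_bigr => a _ do rewrite linearZ.
transitivity (\sum_(a < r | (a < s j)%N) (x *m (pid_mx (s j) : 'M[C]_(s j, r))) 0 a *:
    qm (cell_frame E c (flag_base y))`_a); last first.
  rewrite [RHS](bigID (fun a : 'I_r => (a < s j)%N)) /= [X in _ = _ + X]big1 ?addr0 //.
  move=> a; rewrite -leqNgt => ja; rewrite mxE big1 ?scale0r // => b _.
  rewrite mxE; case: eqP => [ba|_]; last by rewrite mulr0.
  by have := ltn_ord b; rewrite ba ltnNge ja.
rewrite (big_ord_narrow (sr j)) /=; apply: eq_bigr => a _; congr (_ *: _).
  rewrite mxE (bigD1 a) //= big1 ?addr0; first by rewrite mxE eqxx ltn_ord mulr1.
  by move=> b ba; rewrite mxE /= (inj_eq val_inj) (negPf ba) mulr0.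
exact: etrans (esym (tnth_nth _ _ _)) (tnth_mktuple _ _).
Qed.

Lemma quotient_vec c y j (M : 'M[C]_r) (x : 'rV[C]_r) : cdom c y -> rep c.1.2 y M ->
  quotient_map (flag_sub y j) (vec (frame E c.1.2 (flag_base y)) x) =
  vec (frame (taut_quotient E s j) c y) (x *m theta (s j) (gam c) M).
Proof.
move=> cy rM; have [ip tp _] := cy; have [_ uh] := (cell_domP hE sm smono rM tp).1 cy.
apply/eqP; rewrite vec_quotient quotient_map_eq -linearB (proj2 rM).
by rewrite (mem_rowsub (frame_basis hE tp)) theta_quotient.
Qed.

Lemma taut_basis c y j : cdom c y -> basis_of fullv (frame (taut_quotient E s j) c y).
Proof.
move=> cy; have [ip tp _] := cy; have [M rM] := rep_exists hE s0 sm smono tp.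
have [_ uh] := (cell_domP hE sm smono rM tp).1 cy.
apply/andP; split.
  rewrite eqEsubv subvf; apply/subvP => w _.
  have [v <-] := quotient_map_surj (w : quotient_space (flag_sub y j)).
  rewrite -(vec_coord (frame_basis hE tp) v) (quotient_vec _ _ cy rM).
  by apply: memv_suml => a _; apply/memvZ/memv_span/mem_nth; rewrite size_tuple.
apply/freeP => k k0 a.
have : vec (frame (taut_quotient E s j) c y) (\row_a k a) = 0.
  by rewrite -[RHS]k0; apply: eq_bigr => b _; rewrite mxE.
move/eqP; rewrite vec_quotient quotient_map_eq0 (proj2 rM).
rewrite (mem_rowsub (frame_basis hE tp)) => /submxP[z zE].
have := congr1 (fun x => x *m theta (s j) (gam c) M) zE.
rewrite -(mulmxA z) theta_annihilates // mulmx0; set x := \row_a0 k a0.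
rewrite -(mulmxA x (pid_mx (s j) : 'M[C]_(s j, r)) (gam c)).
rewrite -(mulmxA x _ (theta (s j) (gam c) M)) theta_left // mulmx1.
by move=> /rowP/(_ a); rewrite !mxE.
Qed.

(** The frame vectors of c' are rewritten in the E-frame of c, and [theta] reads off their classes.
    The transition matrices are thus holomorphic because [theta] is. *)
Lemma taut_trans c c' y j (M : 'M[C]_r) : cdom c y -> tdom c'.1.2 (flag_base y) ->
  rep c.1.2 y M ->
  trans (taut_quotient E s j) c c' y =
  (pid_mx (s j) : 'M[C]_(s j, r)) *m gam c' *m trans E c.1.2 c'.1.2 (flag_base y)
    *m theta (s j) (gam c) M.
Proof.
move=> cy tp' rM; have [ip tp _] := cy; apply/matrixP => a b.
rewrite [LHS]mxE [LHS]mxE -(vec_delta _ a) vec_quotient.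
rewrite (vec_change (frame_trans hE c'.1.2 tp)) (quotient_vec _ _ cy rM).
rewrite (coord_vec (taut_basis j cy)); set T := trans E _ _ _; set Th := theta _ _ _.
set P := pid_mx (s j).
have <- : row a (P *m gam c' *m T *m Th) 0 b = (P *m gam c' *m T *m Th) a b by rewrite mxE.
by rewrite !row_mul rowE.
Qed.

Lemma trans_chart_diff (x : 'rV[C]_N) i t t' a b : base_dom2 i t t' (lsubmx x) ->
  differentiable (fun x : 'rV[C]_N => trans_chart E i t t' (lsubmx x) a b) x.
Proof.
move=> Bx; have d1 := trans_chart_holo hE a b Bx.
exact: (differentiable_comp (@differentiable_lsubmx _ 1 n np x) d1).
Qed.

Lemma overlap_dom2 c0 c (x : 'rV[C]_N) : overlap E (s := s) c0 c x ->
  base_dom2 c0.1.1 c0.1.2 c.1.2 (lsubmx x).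
Proof. by case=> /base_overlap2. Qed.

Lemma mem_overlap c0 c y : cdom c0 y -> cdom c y ->
  overlap E (s := s) c0 c (cchart c0 y).
Proof. by move=> c0y cy; rewrite -(overlapE chA hE s0 sm smono); exists y. Qed.

(** Coordinates come from the cell [c0] and the frame from the cell [c]: the curvature of a line
    bundle is tested for every such pair independently. *)
Definition theta_chart c0 c j (x : 'rV[C]_N) : 'M[C]_(r, s j) :=
  theta (s j) (gam c) (moved E (s := s) c0 c x).

Lemma theta_chart_diff c0 c j :
  mx_class (fun f : 'rV[C]_N -> C => forall x, overlap E (s := s) c0 c x -> differentiable f x)
    (theta_chart c0 c j).
Proof.
have oD := @overlap_open _ _ _ _ _ E _ s chA hE c0 c.
apply: (theta_class chA hE (c := c0) (differentiable_class oD)).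
- by move=> k x _; exact: differentiable_coord.
- exact: overlap_dom2.
- by move=> a b x /overlap_dom2; exact: trans_chart_diff.
- by move=> x [].
Qed.

Lemma taut_holomorphic j : holomorphic_bundle (taut_quotient E s j).
Proof.
have cU := cell_cover_open; split=> // [c y cy|c c']; first exact: taut_basis.
have oD : open ((cdom c : set (points FB)) `&` cdom c') by apply: openI; exact: cU.1.
apply/(holomorphic_mx chF oD) => a b; apply/holomorphic_onP => c0.
set O := cell_chart c0 @` _; have oO : open O := chart_image_open chF oD.
have DC := differentiable_class oO.
have th : mx_class (fun f : 'rV[C]_N -> C => forall z, O z -> differentiable f z)
    (theta_chart c0 c j).
  by move=> a' b' _ [y [[cy cy'] c0y] <-]; apply: theta_chart_diff; exact: mem_overlap.
have tr : mx_class (fun f : 'rV[C]_N -> C => forall z, O z -> differentiable f z)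
    (fun x => trans_chart E c0.1.1 c.1.2 c'.1.2 (lsubmx x)).
  move=> a' b' _ [y [[cy cy'] c0y] <-]; apply: trans_chart_diff => //.
  have [_ tp _] := cy; have [_ tp' _] := cy'; have [ip0 _ _] := c0y.
  by rewrite cell_chartE row_mxKl; exists (flag_base y).
have cls := mx_classM DC (mx_classM DC (mx_class_cst DC
  ((pid_mx (s j) : 'M[C]_(s j, r)) *m gam c')) tr) th.
apply: (fc_ext DC (cls b a)) => _ [y [[cy cy'] c0y] <-].
have [_ tp _] := cy; have [_ tp' _] := cy'; have [ip0 _ _] := c0y.
rewrite (in_chartE chF) // cell_chartE row_mxKl (trans_chartE E chA) //.
have rM := rep_moved chA hE s0 sm smono c0y tp.
by rewrite -cell_chartE -(taut_trans j cy tp' rM) mxE.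
Qed.

Lemma det_taut_holomorphic : holomorphic_line_bundle (det_taut_quotients E s).
Proof.
rewrite /det_taut_quotients.
refine (@holomorphic_big_tensor _ _ FB _ chF _ (index_enum 'I_m.+1) (fun j => (0 < j < m)%N)
  (fun j => det_bundle (taut_quotient E s j)) cell_cover_open _) => j _.
exact: (holomorphic_det_bundle chF (taut_holomorphic j)).
Qed.

Lemma det_tautE c c' y : det_taut_quotients E s c c' y =
  \prod_(j < m.+1 | (0 < j < m)%N) \det (trans (taut_quotient E s j) c c' y).
Proof. by rewrite [LHS]big_tensorE; apply: eq_bigr => j _; rewrite det_tr. Qed.

End TautologicalBundles.

(** * The metric and its curvature *)

(** If G' = T G T^* then G^-1 = T^* G'^-1 T, so the two dual Gram matrices are congruent through
    [l]. *)
Lemma det_dual_change (K : numClosedFieldType) r q (G T : 'M[K]_r) (Th Th' : 'M[K]_(r, q))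
    (l : 'M[K]_q) : G \in unitmx -> T \in unitmx -> T *m Th = Th' *m l ->
  \det ((Th ^t*)%sesqui *m invmx G *m Th) =
  `|\det l| ^+ 2 * \det ((Th' ^t*)%sesqui *m invmx (T *m G *m (T ^t*)%sesqui) *m Th').
Proof.
move=> uG uT E; set G' := T *m G *m _.
have uTa : (T ^t*)%sesqui \in unitmx by rewrite map_unitmx unitmx_tr.
have uG' : G' \in unitmx by rewrite !unitmx_mul uT uG.
have GE : invmx G = (T ^t*)%sesqui *m invmx G' *m T.
  have H : (T ^t*)%sesqui *m invmx G' *m T *m G = 1%:M.
    have -> : (T ^t*)%sesqui *m invmx G' *m T *m G =
        (T ^t*)%sesqui *m (invmx G' *m G') *m invmx (T ^t*)%sesqui.
      by rewrite -!mulmxA mulmxV // mulmx1.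
    by rewrite mulVmx // mulmx1 mulmxV.
  by rewrite -[RHS](mulmxK uG) H mul1mx.
have -> : (Th ^t*)%sesqui *m invmx G *m Th =
    (l ^t*)%sesqui *m ((Th' ^t*)%sesqui *m invmx G' *m Th') *m l.
  have Ea : (Th ^t*)%sesqui *m (T ^t*)%sesqui = (l ^t*)%sesqui *m (Th' ^t*)%sesqui.
    by rewrite -!adjM E.
  by rewrite GE -!mulmxA E !mulmxA Ea.
set W := _ *m Th'; rewrite (det_mulmx (_ *m W)) (det_mulmx _ W) det_map_mx det_tr.
by rewrite normCK mulrC mulrA.
Qed.

Lemma dn_opp (T : Type) (K : fieldType) (D : set T) (S : (T -> K) -> Prop)
    (d : (T -> K) -> T -> K) f g x : fun_class D S -> leibniz D S d -> S f ->
  (forall y, D y -> g y = - f y) -> D x -> d g x = - d f x.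
Proof.
move=> SC dd Sf gf Dx; have Sm := fc_cst SC (- 1).
rewrite -(@dn_eq _ _ _ _ _ dd (fun y => - 1 * f y)) //.
- by rewrite (dnM dd) // (dn_cst dd) // mul0r add0r mulN1r.
- exact: (fcM SC).
- by move=> y Dy; rewrite gf // mulN1r.
Qed.

Lemma ln_prodV (R : realType) (I : Type) (l : seq I) (P : pred I) (f : I -> R) :
  (forall i, P i -> 0 < f i) ->
  ln (\prod_(i <- l | P i) (f i)^-1) = - \sum_(i <- l | P i) ln (f i).
Proof.
move=> f0; rewrite -sumrN.
have [] : 0 < \prod_(i <- l | P i) (f i)^-1 /\
    ln (\prod_(i <- l | P i) (f i)^-1) = \sum_(i <- l | P i) - ln (f i); last by [].
apply: (big_ind2 (fun a b => 0 < a /\ ln a = b)); first by rewrite ln1.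
- by move=> a b a' b' [a0 <-] [b0 <-]; rewrite mulr_gt0 // lnM.
- by move=> i Pi; rewrite invr_gt0 f0 // lnV // posrE f0.
Qed.

Lemma ln_prodV_cplx (R : realType) (I : Type) (l : seq I) (P : pred I) (f : I -> R) :
  (forall i, P i -> 0 < f i) ->
  ((ln (\prod_(i <- l | P i) (f i)^-1))%:C)%C = - \sum_(i <- l | P i) ((ln (f i))%:C)%C :> R[i].
Proof. by move=> f0; rewrite ln_prodV // rmorphN rmorph_sum. Qed.

Lemma prod_norm_change (K : numClosedFieldType) (I : Type) (l : seq I) (P : pred I)
    (f d d' : I -> K) (L h h' : K) :
  h = \prod_(i <- l | P i) (d i)^-1 -> h' = \prod_(i <- l | P i) (d' i)^-1 ->
  L = \prod_(i <- l | P i) f i -> (forall i, d i = `|f i| ^+ 2 * d' i) ->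
  (forall i, f i != 0) -> h' = `|L| ^+ 2 * h.
Proof.
move=> -> -> -> dE f0; rewrite normr_prod -prodrXl -big_split; apply: eq_bigr => i _ /=.
by rewrite dE invfM mulrA divff ?mul1r // expf_neq0 // normr_eq0.
Qed.

Section TautologicalMetric.
Variables (R : realType) (n : nat) (A : atlas R n) (U : frame_cover A) (r : nat).
Local Notation C := (cplx R).
Local Notation X := (points A).
Local Open Scope sesquilinear_scope.
Variables (E : bundle U r) (h : metric E) (m : nat) (s : 'I_m.+1 -> nat).
Hypotheses (chA : charted A) (hE : holomorphic_bundle E) (sh : smooth_metric h).
Hypothesis coverA : forall p, exists i, @dom _ _ A i p.
Hypotheses (s0 : s ord0 = 0%N) (sm : s ord_max = r).
Hypothesis smono : forall j j' : 'I_m.+1, (j < j')%N -> (s j < s j')%N.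

Local Notation FB := (flag_bundle E s).
Local Notation np := #|cell_pairs r s|.
Local Notation N := (n + np)%N.
Local Notation cchart := (@cell_chart _ _ _ _ _ E _ s).
Local Notation cdom := (@cell_dom _ _ _ _ _ E _ s).
Implicit Types (y : points FB) (c : cell U r) (j : 'I_m.+1).

Let chF : charted FB := flag_charted chA hE s0 sm smono.
Let sr j : (s j <= r)%N := s_ler sm smono j.

Definition theta_at c y j : 'M[C]_(r, s j) :=
  theta (s j) (gam c) (affine (coords c y) *m gam c).

(** The rows of [theta] are the coordinates, in the quotient frame, of the classes of the frame
    vectors of E; they depend on the flag only, not on the matrix representing it. *)
Lemma theta_atE c y j (M : 'M[C]_r) : cdom c y -> rep c.1.2 y M ->
  theta_at c y j = theta (s j) (gam c) M.
Proof.
move=> cy rM; have rM' := rep_affine hE s0 sm smono cy.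
apply/row_matrixP => b; apply: (vec_inj (taut_basis hE s0 sm smono j cy)).
have e := quotient_vec hE sm smono j (delta_mx 0 b) cy rM.
have e' := quotient_vec hE sm smono j (delta_mx 0 b) cy rM'.
have r1 : row b (theta_at c y j) = delta_mx 0 b *m theta_at c y j := rowE _ _.
have r2 : row b (theta (s j) (gam c) M) = delta_mx 0 b *m theta (s j) (gam c) M := rowE _ _.
exact: etrans (congr1 _ r1) (etrans (etrans (esym e') e) (congr1 _ (esym r2))).
Qed.

Definition dual_det c y j : C :=
  \det ((theta_at c y j) ^t* *m invmx (gram h c.1.2 (flag_base y)) *m theta_at c y j).

Lemma dual_det_gt0 c y j : cdom c y -> 0 < dual_det c y j.
Proof.
move=> cy; have [ip tp _] := cy; have rM := rep_affine hE s0 sm smono cy.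
have [_ uh] := (cell_domP hE sm smono rM tp).1 cy.
apply: posdef_det_gt0; apply: posdef_congr (theta_left (sr j) (uh j)).
exact: posdef_inv (gram_posdef_at h hE tp).
Qed.

(** The classes of the frame vectors of E over c' can be expanded in the quotient frame of c
    directly or through that of c'. Since [dual_det] is the inverse of a squared norm, the factor
    stands on the side opposite to the one in the transformation law of a metric. *)
Lemma dual_det_change c c' y j : cdom c y -> cdom c' y ->
  dual_det c y j = `|\det (trans (taut_quotient E s j) c c' y)| ^+ 2 * dual_det c' y j.
Proof.
move=> cy cy'; have [ip tp _] := cy; have [ip' tp' _] := cy'.
have hj := taut_holomorphic chA hE coverA s0 sm smono j.
rewrite /dual_det (gram_trans h hE c'.1.2 tp); apply: det_dual_change.
- exact: posdef_unit (gram_posdef_at h hE tp).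
- exact: (trans_unit hE tp tp').
apply/row_matrixP => b; apply: (vec_inj (taut_basis hE s0 sm smono j cy)).
have rM := rep_affine hE s0 sm smono cy; have rM' := rep_affine hE s0 sm smono cy'.
have e := quotient_vec hE sm smono j (row b (trans E c.1.2 c'.1.2 (flag_base y))) cy rM.
have e' := quotient_vec hE sm smono j (delta_mx 0 b) cy' rM'.
rewrite -(frame_trans hE c'.1.2 tp) in e; rewrite vec_delta in e'.
set lam := trans (taut_quotient E s j) c c' y.
have -> : row b (trans E c.1.2 c'.1.2 (flag_base y) *m theta_at c y j) =
  row b (trans E c.1.2 c'.1.2 (flag_base y)) *m theta_at c y j := row_mul _ _ _.
have -> : row b (theta_at c' y j *m lam) = delta_mx 0 b *m theta_at c' y j *m lam.
  by rewrite rowE mulmxA.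
rewrite -(vec_change (frame_trans hj c' cy)); exact: etrans (esym e) e'.
Qed.

(** Taking real parts loses nothing on the cell, where the determinants are positive. *)
Definition taut_metric c y : R := \prod_(j < m.+1 | (0 < j < m)%N) (complex.Re (dual_det c y j))^-1.

Lemma taut_metricE c y : cdom c y ->
  ((taut_metric c y)%:C)%C = \prod_(j < m.+1 | (0 < j < m)%N) (dual_det c y j)^-1 :> C.
Proof.
move=> cy; rewrite [LHS]rmorph_prod; apply: eq_bigr => j _.
have [_ {2}->] := gt0_cplxE (dual_det_gt0 j cy).
exact: fmorphV.
Qed.

Lemma taut_metric_gt0 c y : cdom c y -> 0 < taut_metric c y.
Proof.
move=> cy; apply: prodr_gt0 => j _; rewrite invr_gt0.
by case: (gt0_cplxE (dual_det_gt0 j cy)).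
Qed.

Lemma taut_metric_change c c' y : cdom c y -> cdom c' y ->
  ((taut_metric c' y)%:C)%C =
  `|det_taut_quotients E s c c' y| ^+ 2 * ((taut_metric c y)%:C)%C :> C.
Proof.
move=> cy cy'; apply: (prod_norm_change (taut_metricE cy) (taut_metricE cy') (det_tautE c c' y)).
  by move=> j; exact: dual_det_change.
move=> j; rewrite -unitfE -unitmxE.
exact: (trans_unit (taut_holomorphic chA hE coverA s0 sm smono j) cy cy').
Qed.

Section Chart.
Variables c0 c : cell U r.

Definition shared : set 'rV[C]_N := overlap E c0 c.

Lemma shared_open : open shared.
Proof. exact: (@overlap_open _ _ _ _ _ E _ s chA hE c0 c). Qed.

Lemma sharedP x : shared x -> exists y, [/\ cdom c0 y, cdom c y & cchart c0 y = x].
Proof.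
rewrite /shared -(overlapE chA hE s0 sm smono) => -[y [c0y cy] yx].
by exists y.
Qed.

Lemma shared_base x : shared x -> base_dom c0.1.1 c.1.2 (lsubmx x).
Proof.
case/sharedP => y [[ip _ _] [_ tp _] <-]; rewrite cell_chartE row_mxKl.
by exists (flag_base y).
Qed.

Lemma trans_shared_smooth : mx_class (smooth_on shared)
  (fun x : 'rV[C]_N => trans_chart E c0.1.1 c0.1.2 c.1.2 (lsubmx x)).
Proof.
move=> a b; have st := @trans_chart_smooth _ _ _ _ _ _ _ chA hE sh c0.1.1 c0.1.2 c.1.2 a b.
have := @smooth_lsubmx R n np _ (fun z => trans_chart E c0.1.1 c0.1.2 c.1.2 z a b) st.
by apply: smooth_subset => x /overlap_dom2.
Qed.

Lemma theta_chart_smooth j : mx_class (smooth_on shared) (theta_chart E c0 c j).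
Proof.
have SC := smooth_class shared_open.
apply: (theta_class chA hE (c := c0) SC).
- by move=> k; exact: smooth_coord shared_open.
- exact: overlap_dom2.
- exact: trans_shared_smooth.
- by move=> x [].
Qed.

Lemma theta_chartE j y : cdom c0 y -> cdom c y -> theta_chart E c0 c j (cchart c0 y) = theta_at c y j.
Proof.
move=> c0y cy; have [_ tp _] := cy.
by rewrite (theta_atE j cy (rep_moved chA hE s0 sm smono c0y tp)).
Qed.

Definition gram_shared : 'rV[C]_n -> 'M[C]_r := gram_chart h c0.1.1 c.1.2.

Lemma dual_det_chart j y : cdom c0 y -> cdom c y ->
  dual_det c y j =
  \det (dual_gram (fun x : 'rV[C]_N => gram_shared (lsubmx x)) (theta_chart E c0 c j) (cchart c0 y)).
Proof.
move=> c0y cy; have [ip0 _ _] := c0y.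
rewrite /dual_gram (theta_chartE j c0y cy) cell_chartE row_mxKl /gram_shared.
by rewrite (gram_chartE h chA).
Qed.

Definition left_inverse j (x : 'rV[C]_N) : 'M[C]_(s j, r) := pid_mx (s j) *m gam c.

Lemma left_inverseP j x : shared x -> left_inverse j x *m theta_chart E c0 c j x = 1%:M.
Proof. by case=> _ /hat_prodP uh; exact: theta_left (sr j) (uh j). Qed.

Definition log_shared : 'rV[C]_N -> C :=
  log_dual_sum gram_shared (fun j => (0 < j < m)%N) (theta_chart E c0 c).

Let pG z : base_dom c0.1.1 c.1.2 z -> posdef (gram_shared z).
Proof. exact: (gram_chart_posdef h chA hE). Qed.

Let sG : mx_class (smooth_on (base_dom c0.1.1 c.1.2)) gram_shared.
Proof. exact: (gram_chart_smooth sh). Qed.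

Lemma log_shared_smooth : smooth_on shared log_shared.
Proof.
exact: (log_dual_sum_smooth _ shared_open shared_base sG pG theta_chart_smooth left_inverseP).
Qed.

Lemma ln_taut_metric x : shared x ->
  in_chart (A := FB) c0 (fun q => ((ln (taut_metric c q))%:C)%C : C) x = - log_shared x.
Proof.
case/sharedP => y [c0y cy <-]; rewrite (in_chartE chF) //.
have f0 j : (0 < j < m)%N -> 0 < complex.Re (dual_det c y j).
  by move=> _; case: (gt0_cplxE (dual_det_gt0 j cy)).
apply: etrans (ln_prodV_cplx _ f0) _; apply: (congr1 -%R).
by apply: eq_bigr => j _; rewrite (dual_det_chart j c0y cy).
Qed.

Lemma taut_metric_smooth : smooth_on shared (in_chart (A := FB) c0 (fun q => ((taut_metric c q)%:C)%C : C)).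
Proof.
have SC := smooth_class shared_open.
have sH := pullback_smooth shared_base sG.
have sd j := fc_det SC (dual_gram_smooth shared_open sH (@theta_chart_smooth j)
  (fun x Dx => pG (shared_base Dx))).
have d0 j x : shared x -> \det (dual_gram (fun x : 'rV[C]_N => gram_shared (lsubmx x))
    (theta_chart E c0 c j) x) != 0.
  case/sharedP => y [c0y cy <-]; rewrite -(dual_det_chart j c0y cy).
  exact: lt0r_neq0 (dual_det_gt0 j cy).
have sp := fc_prod SC (index_enum 'I_m.+1) (fun j => (0 < j < m)%N)
  (fun j => fcV SC (sd j) (d0 j)).
apply: (fc_ext SC sp) => x /sharedP[y [c0y cy <-]].
rewrite (in_chartE chF) // (taut_metricE cy); apply: eq_bigr => j _.
by rewrite (dual_det_chart j c0y cy).
Qed.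

(** The metric is a product of inverses, so the sign from its logarithm cancels the one in the
    definition of the curvature. *)
Lemma taut_curvatureE y : cdom c0 y -> cdom c y ->
  line_curvature (A := FB) (U := cell_cover E s) taut_metric c0 c y = (((2 * pi)^-1 : R)%:C)%C *:
    levi_matrix gram_shared (fun j => (0 < j < m)%N) (theta_chart E c0 c) (cchart c0 y).
Proof.
move=> c0y cy; have Dx : shared (cchart c0 y) by exact: mem_overlap.
have SC := smooth_class shared_open; have sS := log_shared_smooth.
apply/matrixP => a b; rewrite [LHS]mxE [RHS]mxE [X in _ = _ * X]mxE.
set F := in_chart _ _; have FE := ln_taut_metric : forall x, shared x -> F x = - log_shared x.
have db := dzbar_derivation b shared_open; have da := dz_derivation a shared_open.
have e1 x : shared x -> dzbar b F x = - dzbar b log_shared x.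
  by move=> Sx; exact: (dn_opp SC db sS FE Sx).
have e2 : dz a (dzbar b F) (cchart c0 y) = - dz a (dzbar b log_shared) (cchart c0 y).
  exact: (dn_opp SC da (dn_class db sS) e1 Dx).
by rewrite [X in _ * X]e2 mulrNN.
Qed.

End Chart.

Lemma taut_line_metric : line_metric (det_taut_quotients E s) taut_metric.
Proof.
split; [exact: taut_metric_gt0|exact: taut_metric_change|move=> c c0].
suff -> : cchart c0 @` (cdom c `&` cdom c0) = shared c0 c by exact: taut_metric_smooth.
by rewrite /shared -(overlapE chA hE s0 sm smono) setIC.
Qed.

End TautologicalMetric.

(** * Vertical null vectors *)

Section TautologicalPositivity.
Variables (R : realType) (n : nat) (A : atlas R n) (U : frame_cover A) (r : nat).
Local Notation C := (cplx R).
Local Open Scope sesquilinear_scope.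
Variables (E : bundle U r) (h : metric E) (m : nat) (s : 'I_m.+1 -> nat).
Hypotheses (chA : charted A) (hE : holomorphic_bundle E) (sh : smooth_metric h).
Hypotheses (s0 : s ord0 = 0%N) (sm : s ord_max = r).
Hypothesis smono : forall j j' : 'I_m.+1, (j < j')%N -> (s j < s j')%N.

Local Notation np := #|cell_pairs r s|.
Local Notation N := (n + np)%N.
Implicit Types j : 'I_m.+1.

Let sr j : (s j <= r)%N := s_ler sm smono j.

Lemma dvec_coord (v : 'rV[C]_N) l x : dvec v (fun x : 'rV[C]_N => x 0 l : C) x = v 0 l.
Proof.
rewrite dvec_holo; last exact: differentiable_coord.
exact: rderive_val (is_rderive_coord v x l).
Qed.

Variables c0 c : cell U r.
Local Notation D := (shared E (s := s) c0 c).

Let oD : open D := @shared_open _ _ _ _ _ E _ s chA hE c0 c.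
Let SC := smooth_class oD.

Let affine_smooth : mx_class (smooth_on D) (fun x => affine (rsubmx x : 'rV[C]_np)).
Proof. by apply: (affine_class SC) => k; exact: smooth_coord oD. Qed.

Lemma dmx_affine k (x : 'rV[C]_N) : D x ->
  dmx (dvec (delta_mx 0 (rshift n k))) (fun x => affine (rsubmx x : 'rV[C]_np)) x =
  delta_mx (enum_val k).2 (enum_val k).1.
Proof.
move=> Dx; have dd := dvec_derivation (delta_mx 0 (rshift n k) : 'rV[C]_N) oD.
have sl l (b a : 'I_r) : smooth_on D (fun x : 'rV[C]_N => x 0 (rshift n l) *
    (delta_mx (enum_val l).2 (enum_val l).1 : 'M[C]_r) b a).
  exact: (fcM SC (smooth_coord _ oD) (fc_cst SC _)).
apply/matrixP => b a; rewrite [LHS]mxE.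
pose f (x : 'rV[C]_N) : C := (1%:M : 'M[C]_r) b a + \sum_l x 0 (rshift n l) *
  (delta_mx (enum_val l).2 (enum_val l).1 : 'M[C]_r) b a.
have sf : smooth_on D f.
  exact: (fcD SC (fc_cst SC _) (fc_sum SC (index_enum 'I_np) predT (fun l => sl l b a))).
rewrite -(@dn_eq _ _ _ _ _ dd f) //; last first.
  by move=> z _; rewrite /f !mxE summxE; congr (_ + _); apply: eq_bigr => l _; rewrite !mxE.
rewrite (dnD dd (fc_cst SC _) (fc_sum SC (index_enum 'I_np) predT (fun l => sl l b a)) Dx).
rewrite (dn_cst dd) // add0r (dn_sum SC dd _ _ (fun l => sl l b a) Dx).
rewrite (bigD1 k) //= big1 ?addr0.
  rewrite (dnM dd (smooth_coord _ oD) (fc_cst SC _) Dx) (dn_cst dd) // mulr0 addr0.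
  by rewrite dvec_coord mxE !eqxx mul1r.
move=> l lk; rewrite (dnM dd (smooth_coord _ oD) (fc_cst SC _) Dx) (dn_cst dd) // mulr0 addr0.
by rewrite dvec_coord mxE eqxx /= (inj_eq (@rshift_inj _ _)) (negPf lk) mul0r.
Qed.

Definition inv_trans (x : 'rV[C]_N) : 'M[C]_r :=
  invmx (trans_chart E c0.1.1 c0.1.2 c.1.2 (lsubmx x)).

Let trans_smooth : mx_class (smooth_on D)
  (fun x : 'rV[C]_N => trans_chart E c0.1.1 c0.1.2 c.1.2 (lsubmx x)).
Proof. exact: (trans_shared_smooth chA hE sh). Qed.

Let trans_unit_at (x : 'rV[C]_N) : D x ->
  trans_chart E c0.1.1 c0.1.2 c.1.2 (lsubmx x) \in unitmx.
Proof. by move=> /overlap_dom2; exact: trans_chart_unit. Qed.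

Let inv_smooth : mx_class (smooth_on D) inv_trans.
Proof. exact: (mx_class_inv SC trans_smooth trans_unit_at). Qed.

Lemma dmx_moved k (x : 'rV[C]_N) : D x ->
  dmx (dvec (delta_mx 0 (rshift n k))) (moved E (s := s) c0 c) x =
  delta_mx (enum_val k).2 (enum_val k).1 *m (gam c0 *m inv_trans x).
Proof.
move=> Dx; have dd := dvec_derivation (delta_mx 0 (rshift n k) : 'rV[C]_N) oD.
have cst := mx_class_cst SC (gam c0).
have e1 := dmxM SC dd (mx_classM SC affine_smooth cst) inv_smooth Dx.
have e2 := dmxM SC dd affine_smooth cst Dx.
have e3 : dmx (dvec (delta_mx 0 (rshift n k))) inv_trans x = 0.
  have := dmx_lsubmx_dvec (fun z => invmx (trans_chart E c0.1.1 c0.1.2 c.1.2 z))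
    (delta_mx 0 (rshift n k) : 'rV[C]_N) x.
  by rewrite delta_rshift => e; apply: (etrans e); exact: dmx_dvec0.
have e4 : dmx (dvec (delta_mx 0 (rshift n k))) (fun=> gam c0) x = 0 := dmx_cst dd _ Dx.
apply: (etrans e1); rewrite e2 e3 e4 mulmx0 addr0 mulmx0 addr0 (dmx_affine k Dx).
by rewrite mulmxA.
Qed.

(* Along a vertical vector the moving row f_b of the flag would have to stay in
   V_j, j = block b; its variation is a combination of the e_a with a < s_j. *)
Lemma taut_vertical (x ze : 'rV[C]_N) : D x -> lsubmx ze = 0 ->
  (forall j, (0 < j < m)%N -> exists Bm : 'M[C]_(s j),
     \sum_k ze 0 k *: dmx (dvec (delta_mx 0 k)) (theta_chart E c0 c j) x =
     theta_chart E c0 c j x *m Bm) -> ze = 0.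
Proof.
move=> Dx z0 hB; have [_ /hat_prodP uh] := Dx.
(* The frame of the cell [c0], expressed in the frame of E used by [c]. *)
pose g2 := gam c0 *m inv_trans x.
have ug2 : g2 \in unitmx by rewrite unitmx_mul gam_unit unitmx_inv trans_unit_at.
have zl a : ze 0 (lshift np a) = 0 by have /rowP/(_ a) := z0; rewrite !mxE.
(* The first-order variation of the affine matrix along [ze]; its entries at the cell pairs are the
   fibre coordinates of [ze], so it suffices to show that they vanish. *)
pose Z : 'M[C]_r := \sum_k ze 0 (rshift n k) *: delta_mx (enum_val k).2 (enum_val k).1.
have ZE k : Z (enum_val k).2 (enum_val k).1 = ze 0 (rshift n k).
  rewrite summxE (bigD1 k) //= big1 ?addr0; first by rewrite !mxE !eqxx mulr1.
  move=> l lk; rewrite !mxE; case: andP => [[/eqP h1 /eqP h2]|]; last by rewrite mulr0.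
  case/negP: lk; apply/eqP/enum_val_inj.
  by case: (enum_val l) h1 h2 => a' b' /= <- <-; rewrite -surjective_pairing.
have Z0 (b a : 'I_r) : (s (block s b) <= a)%N -> Z b a = 0.
  move=> ba; rewrite summxE big1 // => k _; rewrite !mxE.
  case: andP => [[/eqP h1 /eqP h2]|]; last by rewrite mulr0.
  have := enum_valP k; rewrite inE -h1 -h2 ltnNge.
  by rewrite ba.
have mov_smooth : mx_class (smooth_on D) (moved E (s := s) c0 c).
  exact: (mx_classM SC (mx_classM SC affine_smooth (mx_class_cst SC (gam c0))) inv_smooth).
(* Differentiate the relation saying that the forms Th_j vanish on V_j. As dTh_j = Th_j Bm, the term
   with dTh_j vanishes by the same relation, so the variation of the rows spanning V_j is killed by
   Th_j. *)
have key j : (0 < j < m)%N -> copid_mx (s j) *m Z *m g2 *m theta_chart E c0 c j x = 0.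
  move=> jm; have [Bm hBm] := hB j jm.
  pose cM x' := (copid_mx (s j) : 'M[C]_r) *m moved E (s := s) c0 c x'.
  have scM : mx_class (smooth_on D) cM.
    exact: (mx_classM SC (mx_class_cst SC (copid_mx (s j) : 'M[C]_r)) mov_smooth).
  have sth := @theta_chart_smooth _ _ _ _ _ _ h _ s chA hE sh c0 c j.
  have ann x' : D x' -> cM x' *m theta_chart E c0 c j x' = 0.
    by move=> [_ /hat_prodP uh']; exact: theta_annihilates (sr j) (uh' j).
  have dk k : dmx (dvec (delta_mx 0 k)) cM x *m theta_chart E c0 c j x +
      cM x *m dmx (dvec (delta_mx 0 k)) (theta_chart E c0 c j) x = 0.
    have dd := dvec_derivation (delta_mx 0 k : 'rV[C]_N) oD.
    have <- := dmxM SC dd scM sth Dx.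
    rewrite (dmx_eq dd (B := fun=> 0) (mx_classM SC scM sth) ann Dx).
    exact: (dmx_cst dd 0 Dx).
  have dcM k : dmx (dvec (delta_mx 0 (rshift n k))) cM x =
      copid_mx (s j) *m (delta_mx (enum_val k).2 (enum_val k).1 *m g2).
    have dd := dvec_derivation (delta_mx 0 (rshift n k) : 'rV[C]_N) oD.
    have e := dmxM SC dd (mx_class_cst SC (copid_mx (s j) : 'M[C]_r)) mov_smooth Dx.
    apply: (etrans e); rewrite (dmx_cst dd _ Dx) mul0mx add0r.
    by rewrite (dmx_moved k Dx).
  have : \sum_k ze 0 k *: (dmx (dvec (delta_mx 0 k)) cM x *m theta_chart E c0 c j x +
      cM x *m dmx (dvec (delta_mx 0 k)) (theta_chart E c0 c j) x) = 0.
    by apply: big1 => k _; rewrite dk scaler0.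
  under eq_bigr => k _ do rewrite scalerDr.
  rewrite big_split /=.
  have -> : \sum_k ze 0 k *: (cM x *m dmx (dvec (delta_mx 0 k)) (theta_chart E c0 c j) x) = 0.
    under eq_bigr => k _ do rewrite scalemxAr.
    by rewrite -mulmx_sumr hBm (mulmxA (cM x)) ann // mul0mx.
  rewrite addr0 big_split_ord /= big1 ?add0r; last by move=> a _; rewrite zl scale0r.
  move=> e; rewrite -[RHS]e /Z mulmx_sumr !mulmx_suml; apply: eq_bigr => k _.
  by rewrite dcM -scalemxAr -!scalemxAl (mulmxA (copid_mx (s j))).
apply/rowP => k; rewrite [RHS]mxE; case: (split_ordP k) => l -> //.
rewrite -ZE; set b := (enum_val l).2; set a := (enum_val l).1.
have ab : (a, b) \in cell_pairs r s by rewrite -surjective_pairing enum_valP.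
set j := block s b; have jm : (0 < j < m)%N := block_gt0 s0 sm ab.
have sb : (s j <= b)%N := s_block s0 b.
(* Row b of [Z] has entries only at the columns a < s j, so it is a combination of the first s j
   vectors of the frame [g2], with coefficients [z]. *)
pose z : 'rV[C]_(s j) := \row_i Z b (widen_ord (sr j) i).
have zE : z *m (pid_mx (s j) : 'M[C]_(s j, r)) = row b Z.
  apply/rowP => i; rewrite [LHS]mxE [RHS]mxE.
  case: (ltnP i (s j)) => ij; last first.
    rewrite (Z0 _ _ ij) big1 // => l' _; rewrite !mxE; case: eqP => [e|_]; last by rewrite mulr0.
    by have := ltn_ord l'; rewrite e ltnNge ij.
  rewrite (bigD1 (Ordinal ij)) //= big1 ?addr0.
    by rewrite !mxE eqxx ltn_ord mulr1; congr (Z _ _); exact: val_inj.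
  by move=> l' li; rewrite !mxE -val_eqE /= in li *; rewrite (negPf li) mulr0.
(* The flag also lies in the cell [c0], so V_j is complementary to the span of the first s j vectors
   of [g2]; a combination of these that lies in V_j is zero. *)
have uh2 : hat (s j) g2 (moved E (s := s) c0 c x) \in unitmx.
  have -> : moved E (s := s) c0 c x = (affine (rsubmx x : 'rV[C]_np) *m gam c0) *m inv_trans x.
    by [].
  rewrite /g2 hat_frame unitmx_mul unitmx_inv trans_unit_at // andbT.
  exact: (affine_hat_unit s0 (rsubmx x : 'rV[C]_np) j (gam_unit c0)).
have zero : z = 0.
  apply: (theta_vertical (sr j) ug2 (uh j) uh2).
  have := congr1 (row b) (key j jm).
  rewrite row0 row_mul row_mul row_copid sb scale1r zE.
  by [].
have : row b Z 0 a = 0 by rewrite -zE zero mul0mx mxE.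
by rewrite mxE.
Qed.

End TautologicalPositivity.

Section BaseCurvature.
Variables (R : realType) (n : nat) (A : atlas R n) (U : frame_cover A) (r : nat).
Local Notation C := (cplx R).
Variables (E : bundle U r) (h : metric E).
Hypothesis chA : charted A.

(** Bridges the entrywise curvature formula and the matrix-valued derivatives of the local
    computation; the one pointwise factor, the inverse Gram matrix at [p], is read through the
    chart. *)
Lemma curvature_chart i t p j k : dom i p ->
  curvature h i t p j k = chart_curv (gram_chart h i t) (chart i p) j k.
Proof.
move=> ip; have HE a b : (fun z => gram_chart h i t z a b) =
    in_chart i (fun q => gram h t q a b : C).
  by apply/funext => z; rewrite mxE.
have ge : invmx (gram h t p) = invmx (gram_chart h i t (chart i p)).
  exact: (congr1 _ (esym (gram_chartE h chA t ip))).
have e1 a b : dzbar k (in_chart i (fun q => gram h t q a b : C)) =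
    (fun z => dmx (dzbar k) (gram_chart h i t) z a b).
  by apply/funext => z; rewrite [RHS]mxE HE.
have e2 : \matrix_(a, b) dz j (dzbar k (in_chart i (fun q => gram h t q a b : C))) (chart i p) =
    dmx (dz j) (dmx (dzbar k) (gram_chart h i t)) (chart i p).
  by apply/matrixP => a b; rewrite [LHS]mxE [RHS]mxE e1.
have e3 : \matrix_(a, b) dz j (in_chart i (fun q => gram h t q a b : C)) (chart i p) =
    dmx (dz j) (gram_chart h i t) (chart i p).
  by apply/matrixP => a b; rewrite [LHS]mxE [RHS]mxE HE.
have e4 : \matrix_(a, b) dzbar k (in_chart i (fun q => gram h t q a b : C)) (chart i p) =
    dmx (dzbar k) (gram_chart h i t) (chart i p).
  by apply/matrixP => a b; rewrite [LHS]mxE e1.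
have M3 (x x' y y' z z' w w' : 'M[C]_r) : x = x' -> y = y' -> z = z' -> w = w' ->
    - x + y *m z *m w = - x' + y' *m z' *m w'.
  by move=> -> -> -> ->.
exact: (M3 _ _ _ _ _ _ _ _ e2 e3 ge e4).
Qed.

Lemma curv_tangent_chart i t p v : dom i p ->
  curv_tangent h i t p v = curv_tan (gram_chart h i t) (chart i p) v.
Proof.
move=> ip; apply/matrixP => j k; rewrite [LHS]mxE [RHS]mxE.
by apply: eq_bigr => a _; apply: eq_bigr => b _; rewrite (curvature_chart _ _ _ ip).
Qed.

End BaseCurvature.

Lemma psd_scale (K : numClosedFieldType) q (M : 'M[K]_q) a : 0 <= a ->
  (forall u : 'rV[K]_q, 0 <= (u *m M *m (u ^t*)%sesqui) 0 0) ->
  forall u : 'rV[K]_q, 0 <= (u *m (a *: M) *m (u ^t*)%sesqui) 0 0.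
Proof.
by move=> a0 M0 u; rewrite -scalemxAr -scalemxAl mxE; apply: mulr_ge0.
Qed.

Lemma rank_kermx_scale (K : fieldType) q (M : 'M[K]_q) a : a != 0 ->
  \rank (kermx (a *: M)) = \rank (kermx M).
Proof. by move=> a0; rewrite !mxrank_ker mxrank_scale_nz. Qed.

Theorem theorem5p3 (R : realType) (n : nat) (X : atlas R n)
    (U : frame_cover X) (r : nat) (E : bundle U r) (h : metric E) (k : nat)
    (m : nat) (s : 'I_m.+1 -> nat) :
  compact_complex_manifold X ->
  holomorphic_bundle E ->
  smooth_metric h ->
  griffiths_k_positive h k ->
  (2 <= m)%N ->
  s ord0 = 0%N ->
  s ord_max = r ->
  (forall j j' : 'I_m.+1, (j < j')%N -> (s j < s j')%N) ->
  k_positive (det_taut_quotients E s) k.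
Proof.
move=> [coverX injX ovX holX [hausX compX]] hE sh gk m2 s0 sm smono.
have chX : charted X by split.
split; first exact: flag_compact_complex_manifold.
  exact: det_taut_holomorphic.
exists (taut_metric h (s := s)); first exact: taut_line_metric.
move=> c0 c y c0y cy.
have [ip0 _ _] := c0y; have [_ tp _] := cy; set p := flag_base y in ip0 tp.
pose G := gram_shared h c0 c.
pose P := fun j : 'I_m.+1 => (0 < j < m)%N.
pose x := cell_chart c0 y; have Dx : shared E (s := s) c0 c x by exact: mem_overlap.
have xE : lsubmx x = chart c0.1.1 p by rewrite /x cell_chartE row_mxKl.
have pR (v : 'rV[cplx R]_r) : v != 0 -> forall u : 'rV[cplx R]_n,
    0 <= (u *m curv_tan G (lsubmx x) v *m (u ^t*)%sesqui) 0 0.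
  move=> v0 u; have [/(_ v v0)[ps _] _] := gk c0.1.1 c.1.2 p ip0 tp.
  by rewrite herm_mxE xE /G /gram_shared -(curv_tangent_chart h chX _ _ ip0); exact: ps.
have kR (v : 'rV[cplx R]_r) : v != 0 -> (\rank (kermx (curv_tan G (lsubmx x) v)) <= k)%N.
  move=> v0; have [/(_ v v0)[_ kd] _] := gk c0.1.1 c.1.2 p ip0 tp.
  by rewrite xE /G /gram_shared -(curv_tangent_chart h chX _ _ ip0); exact: kd.
have oD : open (shared E (s := s) c0 c) by exact: (@shared_open _ _ _ _ _ E _ s chX hE c0 c).
have DB := @shared_base _ _ _ _ _ E _ s chX hE s0 sm smono c0 c.
have oB : open (base_dom c0.1.1 c.1.2) := @base_dom_open _ _ _ _ _ E chX hE c0.1.1 c.1.2.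
have sG : mx_class (smooth_on (base_dom c0.1.1 c.1.2)) G by exact: gram_chart_smooth.
have pG z : base_dom c0.1.1 c.1.2 z -> posdef (G z) by exact: gram_chart_posdef.
have sTh j := @theta_chart_smooth _ _ _ _ _ _ h _ s chX hE sh c0 c j.
have hTh (j : 'I_m.+1) z a b : shared E (s := s) c0 c z ->
    differentiable (fun y => theta_chart E (s := s) c0 c j y a b) z.
  by move=> Dz; exact: (theta_chart_diff chX hE a b Dz).
have LTh := @left_inverseP _ _ _ _ _ E _ s sm smono c0 c.
have psL := levi_ge0 P oD DB sG pG sTh hTh LTh oB Dx pR.
have m1 : (1 < m.+1)%N by exact: ltnW.
(* The index 1 satisfies 0 < 1 < m because m >= 2, and s 1 > s 0 = 0, so Q_(s_1) has a nonzero fibre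
   from which to take the vector v. *)
pose j1 : 'I_m.+1 := Ordinal m1.
have Pj1 : P j1 by rewrite /P /= m2.
have sj1 : (0 < s j1)%N by rewrite -s0; exact: smono.
have rkL := levi_kernel oD DB sG pG sTh hTh LTh oB Dx pR Pj1 sj1 kR
  (fun ze => @taut_vertical _ _ _ _ _ E h _ s chX hE sh s0 sm smono c0 c x ze Dx).
have a0 : 0 < (((2 * pi)^-1 : R)%:C)%C :> cplx R.
  by rewrite ltcR invr_gt0 mulr_gt0 // pi_gt0.
rewrite (taut_curvatureE chX hE sh s0 sm smono c0y cy).
have psA := psd_scale (ltW a0) psL.
split; first by move=> u; rewrite /herm_form -herm_mxE; exact: psA.
apply: psd_pos_eigenvalues; first exact: psA.
by rewrite (rank_kermx_scale _ (lt0r_neq0 a0)).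
Qed.
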